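(* Let $B$ be the canonical $d$-dimensional $G$-Brownian motion and let $b^i,h^i_{\alpha\beta},V^i_\alpha:\mathbb{R}^N\to\mathbb{R}$ ($1\le i\le N$, $1\le\alpha,\beta\le d$) be bounded and uniformly Lipschitz. Let $\xi\in\mathbb{R}^N$ and let $X$ be the solution over $[0,1]$ of the SDE $$dX_t=b(X_t)\,dt+h_{\alpha\beta}(X_t)\,d\langle B^\alpha,B^\beta\rangle_t+V_\alpha(X_t)\,dB^\alpha_t,\qquad X_0=\xi .$$ For $n\ge 1$ let $t^n_k=k/2^n$ ($k=0,\dots,2^n$), $\Delta t^n=2^{-n}$, and let $X^n$ be the Euler-Maruyama approximation defined by $X^n_0=\xi$ and, for $t\in[t^n_{k-1},t^n_k]$, $$(X^n_t)^i=(X^n_{t^n_{k-1}})^i+V^i_\alpha(X^n_{t^n_{k-1}})(B^\alpha_t-B^\alpha_{t^n_{k-1}})+b^i(X^n_{t^n_{k-1}})(t-t^n_{k-1})+h^i_{\alpha\beta}(X^n_{t^n_{k-1}})(\langle B^\alpha,B^\beta\rangle_t-\langle B^\alpha,B^\beta\rangle_{t^n_{k-1}}).$$ Then there is a constant $C>0$ depending only on $d,N,G$ and the coefficients $b,h_{\alpha\beta},V_\alpha$ such that for all $n\ge1$ $$\sup_{t\in[0,1]}\mathbb{E}^G[|X^n_t-X_t|^2]\le C\,\Delta t^n .$$ In particular, $\lim_{n\to\infty}\sup_{t\in[0,1]}\mathbb{E}^G[|X^n_t-X_t|^2]=0$.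
   Context: Einstein summation is used for repeated upper/lower Greek indices. $S(d)$ is the space of real symmetric $d\times d$ matrices and $S_+(d)$ the nonnegative definite ones. $G:S(d)\to\mathbb{R}$ is $G(A)=\frac12\sup_{D\in\Sigma}\mathrm{tr}(AD)$, with $\Sigma\subset S_+(d)$ bounded, closed, convex. $C_{l,Lip}(\mathbb{R}^n)$: functions with $|\varphi(x)-\varphi(y)|\le C(1+|x|^m+|y|^m)|x-y|$ for some $C,m$. $\Omega=C_0([0,\infty);\mathbb{R}^d)$ is the space of continuous paths started at $0$, $B_t(\omega)=\omega_t$ the coordinate process, $L_{ip}(\Omega)$ the set of random variables $\varphi(B_{t_1},\dots,B_{t_n})$ with $\varphi\in C_{l,Lip}(\mathbb{R}^{d\times n})$, and $L_{ip}(\Omega_t)$ those with all $t_i\in[0,t]$. The $G$-expectation $\mathbb{E}^G$ is the sublinear expectation on $L_{ip}(\Omega)$ (monotone, preserving constants, subadditive, positively homogeneous) under which $B$ is a $G$-Brownian motion: (i) for $s,t\ge0$, $\mathbb{E}^G[\varphi(B_{t+s}-B_t)]=u(s,0)$, where $u$ is the (polynomial growth) viscosity solution of $\partial_tu-G(D^2u)=0$, $u|_{t=0}=\varphi$; (ii) $Y=B_{t+s}-B_t$ is independent from every $Z=(B_{t_1},\dots,B_{t_n})$ with $t_i\le t$, i.e. $\mathbb{E}^G[\varphi(Z,Y)]=\mathbb{E}^G[\mathbb{E}^G[\varphi(z,Y)]_{z=Z}]$. $L^p_G(\Omega)$ and $L^p_G(\Omega_t)$ are the completions of $L_{ip}(\Omega)$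 and $L_{ip}(\Omega_t)$ under $(\mathbb{E}^G[|\cdot|^p])^{1/p}$, with $\mathbb{E}^G$ extended continuously. Simple processes on $[0,T]$ are $\eta_t=\sum_k\xi_{k-1}\mathbf 1_{[t_{k-1},t_k)}(t)$ with $\xi_k\in L^p_G(\Omega_{t_k})$. $M^p_G(0,T)$ is their completion under $(\mathbb{E}^G[\int_0^T|\eta_t|^pdt])^{1/p}$, and $\overline M^p_G(0,T;\mathbb{R}^N)$ is the completion of $\mathbb{R}^N$-valued simple processes under $(\int_0^T\mathbb{E}^G[|\eta_t|^p]dt)^{1/p}$. The Itô integral $\int\eta\,dB^\alpha$ ($\eta\in M^2_G$) is the continuous extension, with values in $L^2_G$, of the elementary integral of simple processes. The cross variation is $\langle B^\alpha,B^\beta\rangle_t=B^\alpha_tB^\beta_t-\int_0^tB^\alpha_sdB^\beta_s-\int_0^tB^\beta_sdB^\alpha_s$, and $\int\eta\,d\langle B^\alpha,B^\beta\rangle$ ($\eta\in M^1_G$) is the continuous extension of the elementary integral. A solution of the SDE is a process $X\in\overline M^2_G(0,1;\mathbb{R}^N)$ satisfying the integral form; it exists and is unique. *)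

(* Defs.v *)
From HB Require Import structures.
From mathcomp Require Import all_boot all_order all_algebra.
From mathcomp Require Import all_classical all_reals all_analysis.

Set Implicit Arguments.
Unset Strict Implicit.
Unset Printing Implicit Defensive.

Import Order.TTheory GRing.Theory Num.Theory.
Import numFieldNormedType.Exports.

Local Open Scope classical_set_scope.
Local Open Scope ring_scope.

(* C_0([0,oo); R^d): a path is extended by 0 to negative times, so that records
   are in bijection with continuous paths on [0,oo) started at 0. *)
Record C0path (R : realType) (d : nat) := MkC0path {
  path_fun :> R -> 'rV[R]_d;
  path_continuous : continuous path_fun;
  path_start : forall t : R, t <= 0 -> path_fun t = 0 }.

Section GNonlinearity.
Context (R : realType) (d : nat).

Definition psd (D : 'M[R]_d) : Prop :=
  D^T = D /\ forall x : 'rV[R]_d, 0 <= (x *m D *m x^T) 0 0.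

Definition Gfun (Sigma : set 'M[R]_d) (A : 'M[R]_d) : R :=
  sup [set \tr (A *m D) | D in Sigma] / 2.

End GNonlinearity.

Definition ClLip (R : realType) (U V : normedModType R) (phi : U -> V) : Prop :=
  exists (C : R) (m : nat), forall x y,
    `|phi x - phi y| <= C * (1 + `|x| ^+ m + `|y| ^+ m) * `|x - y|.

Section GHeatEquation.
Context (R : realType) (d : nat) (G : 'M[R]_d -> R).
(* functions of (t, x) in [0,oo) x R^d; values at t < 0 are irrelevant *)
Implicit Types (u psi : R * 'rV[R]_d -> R) (p : R * 'rV[R]_d).

Definition dir_t : R * 'rV[R]_d := (1, 0).
Definition dir_x (i : 'I_d) : R * 'rV[R]_d := (0, delta_mx 0 i).

Definition C12 psi : Prop :=
  (forall p, 0 < p.1 ->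
     [/\ derivable psi p dir_t, {for p, continuous ('D_dir_t psi)} &
         forall i, derivable psi p (dir_x i) /\
                   {for p, continuous ('D_(dir_x i) psi)}]) /\
  (forall p, 0 < p.1 -> forall i j,
     derivable ('D_(dir_x j) psi) p (dir_x i) /\
     {for p, continuous ('D_(dir_x i) ('D_(dir_x j) psi))}).

Definition hessian psi p : 'M[R]_d :=
  \matrix_(i, j) 'D_(dir_x i) ('D_(dir_x j) psi) p.

Definition viscosity_subsolution u : Prop :=
  forall psi p, C12 psi -> 0 < p.1 ->
    (\forall q \near p, u q - psi q <= u p - psi p) ->
    'D_dir_t psi p - G (hessian psi p) <= 0.

Definition viscosity_supersolution u : Prop :=
  forall psi p, C12 psi -> 0 < p.1 ->
    (\forall q \near p, u p - psi p <= u q - psi q) ->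
    0 <= 'D_dir_t psi p - G (hessian psi p).

Definition polynomial_growth u : Prop :=
  forall T : R, exists (C : R) (m : nat), forall (t : R) x,
    0 <= t <= T -> `|u (t, x)| <= C * (1 + `|x| ^+ m).

Definition Gheat_solution (phi : 'rV[R]_d -> R) u : Prop :=
  [/\ {within [set p | 0 <= p.1], continuous u},
      polynomial_growth u,
      viscosity_subsolution u,
      viscosity_supersolution u &
      forall x, u (0, x) = phi x].

End GHeatEquation.

Section Cylinder.
Context (R : realType) (d : nat) (V : normedModType R).

(* the matrix with rows B_{t_1}, ..., B_{t_n} *)
Definition sample (n : nat) (ts : 'I_n -> R) (w : C0path R d) : 'M[R]_(n, d) :=
  \matrix_(i, j) w (ts i) 0 j.

(* V-valued L_ip(Omega_t) and L_ip(Omega) *)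
Definition Lip_upto (t : R) : set (C0path R d -> V) :=
  [set X | exists (n : nat) (ts : 'I_n -> R) (phi : 'M[R]_(n, d) -> V),
    [/\ ClLip phi, forall i, 0 <= ts i <= t &
        X = fun w => phi (sample ts w)]].

Definition Lip : set (C0path R d -> V) := [set X | exists t, Lip_upto t X].

End Cylinder.

Section GExpectation.
Context (R : realType) (d : nat).

(* Only the values of E on L_ip(Omega) are constrained, and only they are ever
   used. *)
Record is_Gexpectation (G : 'M[R]_d -> R) (E : (C0path R d -> R) -> R) : Prop := {
  Gexp_mono : forall X Y : C0path R d -> R, Lip X -> Lip Y ->
    (forall w, X w <= Y w) -> E X <= E Y;
  Gexp_cst : forall c : R, E (fun=> c) = c;
  Gexp_subadd : forall X Y : C0path R d -> R, Lip X -> Lip Y ->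
    E (fun w => X w + Y w) <= E X + E Y;
  Gexp_poshom : forall (c : R) (X : C0path R d -> R), 0 <= c -> Lip X ->
    E (fun w => c * X w) = c * E X;
  (* u is the solution: one exists, and the identity holds for any *)
  Gexp_incr : forall phi : 'rV[R]_d -> R, ClLip phi ->
    (exists u, Gheat_solution G phi u) /\
    forall u, Gheat_solution G phi u -> forall s t : R, 0 <= s -> 0 <= t ->
      E (fun w => phi (w (t + s) - w t)) = u (s, 0);
  Gexp_indep : forall (n : nat) (ts : 'I_n -> R) (t s : R)
      (phi : 'M[R]_(n, d) * 'rV[R]_d -> R),
    (forall i, 0 <= ts i <= t) -> 0 <= t -> 0 <= s -> ClLip phi ->
    E (fun w => phi (sample ts w, w (t + s) - w t)) =
    E (fun w => E (fun w' => phi (sample ts w, w' (t + s) - w' t))) }.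

End GExpectation.

(* Representatives of elements of the completions L^p_G: sequences in L_ip. *)
Notation rv R d V := (nat -> C0path R d -> V).

Section Completion.
Context (R : realType) (d : nat) (E : (C0path R d -> R) -> R).

Definition EG (Z : rv R d R) : R := limn (fun n => E (Z n)).

Section Values.
Context (V : normedModType R).
Implicit Types (X Y : rv R d V).

Definition LG_cauchy (p : nat) X : Prop :=
  forall e : R, 0 < e -> exists n0 : nat, forall m n, (n0 <= m)%N -> (n0 <= n)%N ->
    E (fun w => `|X m w - X n w| ^+ p) < e.

(* L^p_G(Omega_t) and L^p_G(Omega): the elements of the metric completion are
   Cauchy sequences, identified when their distance [LG_eq] vanishes. *)
Definition LG_upto (p : nat) (t : R) : set (rv R d V) :=
  [set X | (forall n, Lip_upto t (X n)) /\ LG_cauchy p X].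

Definition LG (p : nat) : set (rv R d V) :=
  [set X | (forall n, Lip (X n)) /\ LG_cauchy p X].

Definition LG_eq (p : nat) X Y : Prop :=
  (fun n => E (fun w => `|X n w - Y n w| ^+ p)) @ \oo --> 0.

Definition LG_cvg (p : nat) (Xs : nat -> rv R d V) X : Prop :=
  (fun k => EG (fun n w => `|Xs k n w - X n w| ^+ p)) @ \oo --> 0.

End Values.

(* P is the product Y Z in L^1_G, for Z in L^2_G. If Y is in L_ip the product is
   termwise; it is extended by continuity in Y. Termwise products of two
   arbitrary Cauchy sequences need not be Cauchy, hence the iterated limit. *)
Definition LG_mul (Y Z P : rv R d R) : Prop :=
  LG 1 P /\ LG_cvg 1 (fun m n w => Y m w * Z n w) P.

Section Processes.
Context (V : normedModType R).

(* sum_k xi_k 1_[t_k, t_{k+1}) for k < m *)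
Record simple := Simple {
  sp_size : nat;
  sp_time : nat -> R;
  sp_coef : nat -> rv R d V }.

Definition is_simple (p : nat) (T : R) (eta : simple) : Prop :=
  [/\ sp_time eta 0 = 0, sp_time eta (sp_size eta) = T,
      forall k, (k < sp_size eta)%N -> sp_time eta k < sp_time eta k.+1 &
      forall k, (k < sp_size eta)%N ->
        LG_upto p (sp_time eta k) (sp_coef eta k)].

Definition sp_eval (eta : simple) (t : R) : rv R d V := fun n w =>
  \sum_(k < sp_size eta)
    (sp_time eta k <= t < sp_time eta k.+1)%R%:R *: sp_coef eta k n w.

(* M^p_G(0,T), as Cauchy sequences of simple processes *)
Definition MG (p : nat) (T : R) : set (nat -> simple) :=
  [set eta | (forall k, is_simple p T (eta k)) /\
    forall e : R, 0 < e -> exists k0 : nat, forall k l, (k0 <= k)%N -> (k0 <= l)%N ->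
      EG (fun n w => \int[lebesgue_measure]_(t in `[0, T])
        `|sp_eval (eta k) t n w - sp_eval (eta l) t n w| ^+ p) < e].

(* The simple processes eta_k converge to the process Y in \bar M^p_G(0,T).
   Elements of this completion are classes of functions of t with values in
   L^p_G(Omega_t), so they are represented by such functions. *)
Definition Mbar_cvg (p : nat) (T : R) (eta : nat -> simple) (Y : R -> rv R d V) :
    Prop :=
  let err k t := EG (fun n w => `|sp_eval (eta k) t n w - Y t n w| ^+ p) in
  [/\ forall k, is_simple p T (eta k),
      forall t : R, 0 <= t <= T -> LG_upto p t (Y t),
      forall k, measurable_fun `[0, T] (err k) &
      (fun k => \int[lebesgue_measure]_(t in `[0%R, T]) (err k t)%:E)%E
        @ \oo --> 0%E].

Definition Mbar (p : nat) (T : R) : set (R -> rv R d V) :=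
  [set Y | exists eta, Mbar_cvg p T eta Y].

End Processes.

(* Integrals over [0,t], t <= T. For eta in M^p_G(0,T) the integral is the limit
   of the elementary ones. A process Y in \bar M^p_G(0,T) is integrated through
   the canonical map \bar M^p_G -> M^p_G, which extends the identity of simple
   processes. *)

Definition dt_elem (eta : simple R) (t : R) : rv R d R := fun n w =>
  \sum_(k < sp_size eta) sp_coef eta k n w *
    (Num.min t (sp_time eta k.+1) - Num.min t (sp_time eta k)).

Definition dt_integral (T : R) (eta : nat -> simple R) (t : R) (I : rv R d R) :
    Prop :=
  [/\ MG 1 T eta, LG 1 I & LG_cvg 1 (fun k => dt_elem (eta k) t) I].

Definition dt_integral_of (T : R) (Y : R -> rv R d R) (t : R) (I : rv R d R) : Prop :=
  exists eta, Mbar_cvg 1 T eta Y /\ dt_integral T eta t I.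

Definition ito_elem (a : 'I_d) (eta : simple R) (t : R) : rv R d R := fun n w =>
  \sum_(k < sp_size eta) sp_coef eta k n w *
    (w (Num.min t (sp_time eta k.+1)) 0 a - w (Num.min t (sp_time eta k)) 0 a).

Definition ito_integral (a : 'I_d) (T : R) (eta : nat -> simple R) (t : R)
    (I : rv R d R) : Prop :=
  [/\ MG 2 T eta, LG 2 I & LG_cvg 2 (fun k => ito_elem a (eta k) t) I].

Definition ito_integral_of (a : 'I_d) (T : R) (Y : R -> rv R d R) (t : R)
    (I : rv R d R) : Prop :=
  exists eta, Mbar_cvg 2 T eta Y /\ ito_integral a T eta t I.

Definition coordB (a : 'I_d) : R -> rv R d R := fun t n w => w t 0 a.

(* Q a c t represents <B^a, B^c>_t *)
Definition is_cross_variation (Q : 'I_d -> 'I_d -> R -> rv R d R) : Prop :=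
  forall a c (t : R), 0 <= t -> LG 2 (Q a c t) /\
    exists I J : rv R d R,
      [/\ ito_integral_of c t (coordB a) t I,
          ito_integral_of a t (coordB c) t J &
          LG_eq 2 (Q a c t) (fun n w => w t 0 a * w t 0 c - I n w - J n w)].

(* Integrals against q = <B^a, B^c>. *)
Definition qv_elem (q : R -> rv R d R) (eta : simple R) (t : R) (J : rv R d R) : Prop :=
  exists P : nat -> rv R d R,
    (forall k, (k < sp_size eta)%N ->
       LG_mul (sp_coef eta k)
         (fun n w => q (Num.min t (sp_time eta k.+1)) n w -
                     q (Num.min t (sp_time eta k)) n w) (P k)) /\
    J = fun n w => \sum_(k < sp_size eta) P k n w.

Definition qv_integral (q : R -> rv R d R) (T : R) (eta : nat -> simple R) (t : R)
    (I : rv R d R) : Prop :=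
  [/\ MG 1 T eta, LG 1 I &
      exists J : nat -> rv R d R,
        (forall k, qv_elem q (eta k) t (J k)) /\ LG_cvg 1 J I].

Definition qv_integral_of (q : R -> rv R d R) (T : R) (Y : R -> rv R d R) (t : R)
    (I : rv R d R) : Prop :=
  exists eta, Mbar_cvg 1 T eta Y /\ qv_integral q T eta t I.

Section SDE.
Context (N : nat) (b : 'I_N -> 'rV[R]_N -> R)
  (h : 'I_d -> 'I_d -> 'I_N -> 'rV[R]_N -> R)
  (V : 'I_d -> 'I_N -> 'rV[R]_N -> R)
  (Q : 'I_d -> 'I_d -> R -> rv R d R) (xi : 'rV[R]_N).

Definition is_solution (X : R -> rv R d 'rV[R]_N) : Prop :=
  Mbar 2 1 X /\
  forall t : R, 0 <= t <= 1 -> forall i,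
    exists (Ib : rv R d R) (Ih : 'I_d -> 'I_d -> rv R d R) (IV : 'I_d -> rv R d R),
      [/\ dt_integral_of 1 (fun s n w => b i (X s n w)) t Ib,
          forall a c,
            qv_integral_of (Q a c) 1 (fun s n w => h a c i (X s n w)) t (Ih a c),
          forall a, ito_integral_of a 1 (fun s n w => V a i (X s n w)) t (IV a) &
          LG_eq 1 (fun n w => X t n w 0 i)
            (fun n w => xi 0 i + Ib n w + \sum_a \sum_c Ih a c n w +
                        \sum_a IV a n w)].

Definition grid (n k : nat) : R := k%:R / 2 ^+ n.

Definition is_euler (n : nat) (X : R -> rv R d 'rV[R]_N) : Prop :=
  [/\ forall t : R, 0 <= t <= 1 -> LG_upto 2 t (X t),
      LG_eq 2 (X 0) (fun _ _ => xi) &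
      forall k, (1 <= k <= 2 ^ n)%N ->
      let t0 := grid n k.-1 in
      forall t : R, t0 <= t <= grid n k -> forall i,
        exists P : 'I_d -> 'I_d -> rv R d R,
          (forall a c, LG_mul (fun m w => h a c i (X t0 m w))
                         (fun m w => Q a c t m w - Q a c t0 m w) (P a c)) /\
          LG_eq 1 (fun m w => X t m w 0 i)
            (fun m w => X t0 m w 0 i +
               \sum_a V a i (X t0 m w) * (w t 0 a - w t0 0 a) +
               b i (X t0 m w) * (t - t0) +
               \sum_a \sum_c P a c m w)].

(* E[|Y - Z|^2] for the Euclidean norm *)
Definition sqdist (Y Z : rv R d 'rV[R]_N) : R :=
  EG (fun n w => \sum_i (Y n w 0 i - Z n w 0 i) ^+ 2).

Definition sup_sqdist (Y Z : R -> rv R d 'rV[R]_N) : \bar R :=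
  ereal_sup [set (sqdist (Y t) (Z t))%:E | t in [set t : R | 0 <= t <= 1]].

End SDE.
End Completion.

(* Main.v *)
Require Import Defs.
From HB Require Import structures.
From mathcomp Require Import all_boot all_order all_algebra.
From mathcomp Require Import all_classical all_reals all_analysis.
From mathcomp Require Import measurable_realfun.
From mathcomp Require Import ring lra.

Set Implicit Arguments.
Unset Strict Implicit.
Unset Printing Implicit Defensive.

Import Order.TTheory GRing.Theory Num.Theory.
Import numFieldNormedType.Exports.

Local Open Scope classical_set_scope.
Local Open Scope ring_scope.

(** The square mean distance of two Ito processes is controlled by the integral in
   time of the square mean distances of their integrands ([represents_compare]).
   The solution [X] and the Euler scheme are both Ito processes, the integrands of
   the scheme being frozen at the left end of each cell of the dyadic grid
   ([euler_represents]). A frozen coefficient differs from the running one by at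
   most a constant times the error at the left end of the cell plus the oscillation
   of [X] within the cell, and the latter is of square mean [O(2^-n)], by the same
   stability applied to [X] at two times and the boundedness of the coefficients
   ([solution_continuity], [frozen_close]). Hence the square error at any time is at
   most [C 2^-n] plus [C 2^-n] times the sum of the square errors at the earlier grid
   points, and a discrete Gronwall inequality concludes ([euler_error]).

   Stability rests on three moments of the increments of [B] over a time [s]: mean
   zero, second moment at most [K s] and fourth moment at most [3 (K s)^2]. They are
   read off the [G]-heat equation. Caloric polynomials that depend on one coordinate
   and are convex in it solve this equation classically, and classical solutions are
   viscosity solutions: a test function that touches one of them has the same time
   derivative and an ordered Hessian, and [G] is monotone
   ([convex_profile_solution]). The first two moments and the independence of
   increments make Ito integrals contractions up to a constant ([ito_sum_L2]). With
   the fourth moment, sums of squared increments exceed [K] times the elapsed time by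
   a vanishing amount only ([square_excess_L2]), so that the cross variation moves at
   speed at most [K] ([cross_variation_speed]) and integrals against it are
   controlled like integrals against time.

   Two obstacles come from the nature of the objects. The equations hold in [L^1],
   while the error is measured in square mean; hence a weak form of square mean bound
   that survives sums and limits in [L^1] ([weakL2]), and that a Fatou argument turns
   into a genuine bound for elements of [L^2] ([weakL2_fatou]). And integrands are
   limits of simple processes only in the mean over time, while their square mean
   distance is known at each time; choosing one good time in each cell of a grid
   common to all the processes in play reduces everything to finite sums of
   expectations ([approx_cells]). *)

(** * Functions of polynomially Lipschitz growth *)

Section LocallyLipschitz.
Context (R : realType).
Implicit Types (U V W : normedModType R).

(** The weight may be taken as a power of [1 + |x| + |y|]: products of such weights
   are again of this form. *)
Lemma ClLipP U V (phi : U -> V) : ClLip phi <->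
  exists (C : R) (m : nat), 0 <= C /\
    forall x y, `|phi x - phi y| <= C * (1 + `|x| + `|y|) ^+ m * `|x - y|.
Proof.
split=> [[C [m phiP]]|[C [m [C0 phiP]]]].
- exists (`|C| * 3), m; split=> [|x y]; first by rewrite mulr_ge0.
  apply: le_trans (phiP x y) _; apply: ler_wpM2r => //.
  rewrite -mulrA; apply: le_trans (_ : `|C| * (1 + `|x| ^+ m + `|y| ^+ m) <= _).
    by apply: ler_wpM2r; rewrite ?ler_norm ?addr_ge0 ?exprn_ge0.
  apply: ler_wpM2l => //.
  have x0 := normr_ge0 x; have y0 := normr_ge0 y.
  have h1 : 1 <= (1 + `|x| + `|y|) ^+ m by apply: exprn_ege1; lra.
  have h2 : `|x| ^+ m <= (1 + `|x| + `|y|) ^+ m.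
    by apply: lerXn2r; rewrite ?nnegrE; lra.
  have h3 : `|y| ^+ m <= (1 + `|x| + `|y|) ^+ m.
    by apply: lerXn2r; rewrite ?nnegrE; lra.
  lra.
- exists (C * 3 ^+ m), m => x y; apply: le_trans (phiP x y) _.
  apply: ler_wpM2r => //; rewrite -mulrA; apply: ler_wpM2l => //.
  have x0 := normr_ge0 x; have y0 := normr_ge0 y.
  have xm := exprn_ge0 m x0; have ym := exprn_ge0 m y0.
  suff [z [z0 hz zm]] : exists z : R,
      [/\ 0 <= z, 1 + `|x| + `|y| <= 3 * z & z ^+ m <= 1 + `|x| ^+ m + `|y| ^+ m].
    apply: le_trans (_ : (3 * z) ^+ m <= _).
      by apply: lerXn2r; rewrite ?nnegrE; lra.
    by rewrite exprMn; apply: ler_wpM2l; rewrite ?exprn_ge0.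
  case: (lerP 1 `|x|) => x1; case: (lerP `|x| `|y|) => xy.
  + by exists `|y|; split; lra.
  + by exists `|x|; split; lra.
  + case: (lerP 1 `|y|) => y1; first by exists `|y|; split; lra.
    by exists 1; rewrite expr1n; split; lra.
  + by exists 1; rewrite expr1n; split; lra.
Qed.

Lemma ClLip_growth U V (phi : U -> V) : ClLip phi ->
  exists (C : R) (m : nat), 1 <= C /\ forall x, `|phi x| <= C * (1 + `|x|) ^+ m.
Proof.
move=> /ClLipP[C [m [C0 phiP]]]; exists (1 + `|phi 0| + C), m.+1.
have p0 := normr_ge0 (phi 0); split=> [|x]; first by lra.
have := phiP x 0; rewrite normr0 addr0 subr0 => hx.
have x0 := normr_ge0 x.
have h1 : 1 <= (1 + `|x|) ^+ m by apply: exprn_ege1; lra.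
have h2 : 1 <= (1 + `|x|) ^+ m.+1 by apply: exprn_ege1; lra.
have : `|phi x| <= `|phi 0| + `|phi x - phi 0|.
  by rewrite -{1}(subrK (phi 0) (phi x)) addrC; apply: ler_normD.
have : `|phi 0| <= `|phi 0| * (1 + `|x|) ^+ m.+1 by apply: ler_peMr.
have : C * (1 + `|x|) ^+ m * `|x| <= C * (1 + `|x|) ^+ m.+1.
  rewrite exprSr -mulrA; apply: ler_wpM2l => //; apply: ler_wpM2l; lra.
lra.
Qed.

Lemma ClLip_comp U V W (phi : U -> V) (psi : V -> W) :
  ClLip phi -> ClLip psi -> ClLip (psi \o phi).
Proof.
move=> phiL /ClLipP[D [k [D0 psiP]]].
have [A [p [A1 phig]]] := ClLip_growth phiL.
have [C [m [C0 phiP]]] := (iffLR (ClLipP _)) phiL.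
apply/ClLipP; exists (D * (3 * A) ^+ k * C), (p * k + m)%N.
split=> [|x y /=]; first by rewrite !mulr_ge0 ?exprn_ge0//; lra.
apply: le_trans (psiP _ _) _.
have x0 := normr_ge0 x; have y0 := normr_ge0 y.
set S := 1 + `|x| + `|y|.
have S1 : 1 <= S by rewrite /S; lra.
have Sp : 1 <= S ^+ p by apply: exprn_ege1.
have gx : `|phi x| <= A * S ^+ p.
  apply: le_trans (phig x) _; apply: ler_wpM2l; first by lra.
  by apply: lerXn2r; rewrite ?nnegrE /S; lra.
have gy : `|phi y| <= A * S ^+ p.
  apply: le_trans (phig y) _; apply: ler_wpM2l; first by lra.
  by apply: lerXn2r; rewrite ?nnegrE /S; lra.
have g : (1 + `|phi x| + `|phi y|) ^+ k <= (3 * A) ^+ k * S ^+ (p * k).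
  rewrite exprM -exprMn; apply: lerXn2r; rewrite ?nnegrE.
  - by rewrite !addr_ge0.
  - by rewrite !mulr_ge0 ?exprn_ge0//; lra.
  - have : 1 <= A * S ^+ p by apply: mulr_ege1.
    lra.
apply: le_trans (_ : D * ((3 * A) ^+ k * S ^+ (p * k)) * (C * S ^+ m * `|x - y|) <= _).
  apply: ler_pM => //; rewrite ?mulr_ge0 ?exprn_ge0 ?addr_ge0//.
  by apply: ler_wpM2l.
by rewrite exprD le_eqVlt; apply/orP; left; apply/eqP; ring.
Qed.

Lemma ClLip_lipschitz U V (phi : U -> V) (C : R) :
  (forall x y, `|phi x - phi y| <= C * `|x - y|) -> ClLip phi.
Proof.
move=> phiP; exists `|C|, 0%N => x y; apply: le_trans (phiP x y) _.
apply: ler_wpM2r => //; rewrite !expr0.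
have := ler_norm C; have := normr_ge0 C; lra.
Qed.

Lemma ClLip_cst U V (v : V) : ClLip (fun _ : U => v).
Proof. by apply: (@ClLip_lipschitz _ _ _ 0) => x y; rewrite subrr normr0 mul0r. Qed.

Lemma ClLip_pair U V W (phi : U -> V) (psi : U -> W) :
  ClLip phi -> ClLip psi -> ClLip (fun x => (phi x, psi x)).
Proof.
move=> /ClLipP[C [m [C0 phiP]]] /ClLipP[D [k [D0 psiP]]].
apply/ClLipP; exists (C + D), (m + k)%N; split=> [|x y]; first by lra.
have x0 := normr_ge0 x; have y0 := normr_ge0 y.
have le_exp (i j : nat) : (1 + `|x| + `|y|) ^+ i <= (1 + `|x| + `|y|) ^+ (i + j).
  by apply: ler_weXn2l; [lra|rewrite leq_addr].
rewrite prod_normE /= ge_max; apply/andP; split.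
- apply: le_trans (phiP x y) _; apply: ler_wpM2r => //.
  by apply: ler_pM => //; rewrite ?exprn_ge0 ?addr_ge0//; lra.
- apply: le_trans (psiP x y) _; apply: ler_wpM2r => //; rewrite addnC.
  by apply: ler_pM => //; rewrite ?exprn_ge0 ?addr_ge0//; lra.
Qed.

Lemma prod_norm_le U V (x : U * V) : `|x.1| <= `|x| /\ `|x.2| <= `|x|.
Proof. by rewrite prod_normE /= !le_max !lexx ?orbT. Qed.

Lemma ClLip_fst U V : ClLip (fun x : U * V => x.1).
Proof.
apply: (@ClLip_lipschitz _ _ _ 1) => x y; rewrite mul1r.
by have [] := prod_norm_le (x - y).
Qed.

Lemma ClLip_snd U V : ClLip (fun x : U * V => x.2).
Proof.
apply: (@ClLip_lipschitz _ _ _ 1) => x y; rewrite mul1r.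
by have [] := prod_norm_le (x - y).
Qed.

Lemma ClLip_add V : ClLip (fun x : V * V => x.1 + x.2).
Proof.
apply: (@ClLip_lipschitz _ _ _ 2) => x y.
have [h1 h2] := prod_norm_le (x - y).
rewrite opprD addrACA; apply: le_trans (ler_normD _ _) _.
by rewrite mulr_natl mulr2n; apply: lerD.
Qed.

Lemma ClLip_opp V : ClLip (fun x : V => - x).
Proof.
by apply: (@ClLip_lipschitz _ _ _ 1) => x y; rewrite mul1r -opprD normrN.
Qed.

Lemma ClLip_scale V : ClLip (fun x : R * V => x.1 *: x.2).
Proof.
apply/ClLipP; exists 1, 1%N; split=> // x y; rewrite expr1 mul1r.
have -> : x.1 *: x.2 - y.1 *: y.2 = (x.1 - y.1) *: x.2 + y.1 *: (x.2 - y.2).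
  by rewrite scalerBl scalerBr addrA subrK.
have [h1 h2] := prod_norm_le (x - y).
have [hx1 hx2] := prod_norm_le x; have [hy1 hy2] := prod_norm_le y.
apply: le_trans (ler_normD _ _) _; rewrite !normrZ.
have : `|x.1 - y.1| * `|x.2| <= `|x - y| * `|x| by apply: ler_pM.
have : `|y.1| * `|x.2 - y.2| <= `|y| * `|x - y| by apply: ler_pM.
have := normr_ge0 (x - y); lra.
Qed.

Lemma ClLip_norm V : ClLip (fun x : V => `|x| : R).
Proof.
apply: (@ClLip_lipschitz _ _ _ 1) => x y; rewrite mul1r.
exact: ler_dist_dist.
Qed.

Lemma ClLip_linear_coord (m n : nat) (i : 'I_m) (j : 'I_n) :
  ClLip (fun x : 'M[R]_(m, n) => x i j : R).
Proof.
apply: (@ClLip_lipschitz _ _ _ 1) => x y; rewrite mul1r.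
have -> : x i j - y i j = (x - y) i j by rewrite !mxE.
by rewrite [`|x - y|]/Num.Def.normr/= mx_normrE;
  apply/(le_bigmax_cond _ _ (erefl true : xpredT (i, j))).
Qed.

Lemma ClLip_fadd (U : normedModType R) (f g : U -> R) :
  ClLip f -> ClLip g -> ClLip (fun x => f x + g x).
Proof. by move=> fL gL; exact: (ClLip_comp (ClLip_pair fL gL) (@ClLip_add R)). Qed.

Lemma ClLip_fmul (U : normedModType R) (f g : U -> R) :
  ClLip f -> ClLip g -> ClLip (fun x => f x * g x).
Proof. by move=> fL gL; exact: (ClLip_comp (ClLip_pair fL gL) (@ClLip_scale R)). Qed.

Lemma ClLip_fexp (U : normedModType R) (f : U -> R) k :
  ClLip f -> ClLip (fun x => f x ^+ k).
Proof.
move=> fL; elim: k => [|k IH]; first exact: ClLip_cst.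
rewrite (_ : (fun x => f x ^+ k.+1) = (fun x => f x * f x ^+ k)); first exact: ClLip_fmul.
by apply/funext => w; rewrite exprS.
Qed.

Lemma ClLip_pow k : ClLip (fun x : R => x ^+ k).
Proof.
apply: ClLip_fexp; apply: (@ClLip_lipschitz _ _ _ 1) => x y.
by rewrite mul1r.
Qed.

End LocallyLipschitz.

(** * Cylinder variables and sublinear expectations *)

Section CylinderFunctions.
Context (R : realType) (d : nat).
Implicit Types (U V W : normedModType R) (t s : R).
Local Notation Om := (C0path R d).

Lemma Lip_upto_comp U V t (X : Om -> U) (phi : U -> V) :
  ClLip phi -> Lip_upto t X -> Lip_upto t (fun w => phi (X w)).
Proof.
move=> phiL [n [ts [psi [psiL tst ->]]]]; exists n, ts, (phi \o psi).
by split=> //; apply: ClLip_comp.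
Qed.

(** Two cylinder functions are functions of one sample, taken at the concatenation
   of their times. *)
Lemma Lip_upto_pair U V t (X : Om -> U) (Y : Om -> V) :
  Lip_upto t X -> Lip_upto t Y -> Lip_upto t (fun w => (X w, Y w)).
Proof.
move=> [n [ts [phi [phiL tst ->]]]] [m [us [psi [psiL ust ->]]]].
have uL : ClLip (@usubmx R n m d).
  apply: (@ClLip_lipschitz _ _ _ _ 1) => x y; rewrite mul1r -linearB /=.
  rewrite [leLHS]/Num.Def.normr/= mx_normrE.
  apply: bigmax_le => // -[i j] _; rewrite mxE /=.
  rewrite [leRHS]/Num.Def.normr/= mx_normrE.
  exact: (le_bigmax_cond _ _ (erefl true : xpredT (lshift m i, j))).
have dL : ClLip (@dsubmx R n m d).
  apply: (@ClLip_lipschitz _ _ _ _ 1) => x y; rewrite mul1r -linearB /=.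
  rewrite [leLHS]/Num.Def.normr/= mx_normrE.
  apply: bigmax_le => // -[i j] _; rewrite mxE /=.
  rewrite [leRHS]/Num.Def.normr/= mx_normrE.
  exact: (le_bigmax_cond _ _ (erefl true : xpredT (rshift n i, j))).
exists (n + m)%N, (fun i => match fintype.split i with inl j => ts j | inr k => us k end).
exists (fun M => (phi (usubmx M), psi (dsubmx M))); split.
- by apply: ClLip_pair; [exact: (ClLip_comp uL phiL)|exact: (ClLip_comp dL psiL)].
- by move=> i; case: (fintype.split i).
- apply/funext => w; congr (phi _, psi _); apply/matrixP => i j; rewrite !mxE.
    by rewrite (unsplitK (inl _ i)).
  by rewrite (unsplitK (inr _ i)).
Qed.

Lemma Lip_upto_mono V s t (X : Om -> V) : s <= t -> Lip_upto s X -> Lip_upto t X.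
Proof.
move=> st [n [ts [phi [phiL tst ->]]]]; exists n, ts, phi; split=> // i.
by have /andP[-> /= h] := tst i; apply: le_trans st.
Qed.

Lemma Lip_upto_Lip V t (X : Om -> V) : Lip_upto t X -> Lip X.
Proof. by exists t. Qed.

Lemma Lip_upto_cst V t (v : V) : Lip_upto t (fun _ : Om => v).
Proof.
exists 0%N, (fun _ => 0), (fun _ => v); split=> [|[]//|//]; exact: ClLip_cst.
Qed.

Lemma Lip_upto_coord t s (a : 'I_d) :
  0 <= s <= t -> Lip_upto t (fun w : Om => w s 0 a).
Proof.
move=> st; exists 1%N, (fun _ => s), (fun M => M 0 a); split=> //.
  exact: ClLip_linear_coord.
by apply/funext => w; rewrite mxE.
Qed.

Lemma Lip_upto_add V t (X Y : Om -> V) :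
  Lip_upto t X -> Lip_upto t Y -> Lip_upto t (fun w => X w + Y w).
Proof.
by move=> Xt Yt; apply: Lip_upto_comp (@ClLip_add R V) (Lip_upto_pair Xt Yt).
Qed.

Lemma Lip_upto_opp V t (X : Om -> V) :
  Lip_upto t X -> Lip_upto t (fun w => - X w).
Proof. exact: Lip_upto_comp (@ClLip_opp R V). Qed.

Lemma Lip_upto_norm V t (X : Om -> V) : Lip_upto t X -> Lip_upto t (fun w => `|X w|).
Proof. exact: Lip_upto_comp (@ClLip_norm R V). Qed.

Lemma Lip_upto_mx t m n (X : Om -> 'M[R]_(m, n)) i j :
  Lip_upto t X -> Lip_upto t (fun w => X w i j).
Proof. exact: Lip_upto_comp (@ClLip_linear_coord R m n i j). Qed.

Lemma Lip_upto_mul t (X Y : Om -> R) :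
  Lip_upto t X -> Lip_upto t Y -> Lip_upto t (fun w => X w * Y w).
Proof.
by move=> Xt Yt; apply: Lip_upto_comp (@ClLip_scale R R) (Lip_upto_pair Xt Yt).
Qed.

Lemma Lip_upto_exp t k (X : Om -> R) :
  Lip_upto t X -> Lip_upto t (fun w => X w ^+ k).
Proof.
move=> Xt; elim: k => [|k IH]; first exact: Lip_upto_cst.
rewrite (_ : (fun w => _) = (fun w => X w * X w ^+ k)); first exact: Lip_upto_mul.
by apply/funext => w; rewrite exprS.
Qed.

Lemma Lip_upto_max t (X Y : Om -> R) :
  Lip_upto t X -> Lip_upto t Y -> Lip_upto t (fun w => Num.max (X w) (Y w)).
Proof.
move=> Xt Yt; rewrite (_ : (fun w => _) =
  (fun w => 2^-1 * (X w + Y w + `|X w - Y w|))).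
  apply: Lip_upto_mul; first exact: Lip_upto_cst.
  apply: Lip_upto_add; first exact: Lip_upto_add.
  by apply: Lip_upto_norm; apply: Lip_upto_add => //; apply: Lip_upto_opp.
apply/funext => w; rewrite maxEle.
by by have [h|h] := lerP (X w) (Y w); lra.
Qed.

Lemma Lip_upto_sum V t (I : Type) (r : seq I) (P : pred I) (X : I -> Om -> V) :
  (forall i, P i -> Lip_upto t (X i)) -> Lip_upto t (fun w => \sum_(i <- r | P i) X i w).
Proof.
move=> Xt; elim: r => [|i r IH].
  have -> : (fun w => \sum_(i <- [::] | P i) X i w) = fun=> 0.
    by apply/funext => w; exact: big_nil.
  exact: Lip_upto_cst.
rewrite (_ : (fun w => \sum_(j <- i :: r | P j) X j w) =
  (fun w => if P i then X i w + \sum_(j <- r | P j) X j w else \sum_(j <- r | P j) X j w)).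
  by case: (P i) (Xt i) => /= [Xi|_]; [apply: Lip_upto_add => //; exact: Xi|exact: IH].
by apply/funext => w; exact: big_cons.
Qed.

Lemma Lip1 U V (X : Om -> U) (Y : Om -> V) :
  (forall t, Lip_upto t X -> Lip_upto t Y) -> Lip X -> Lip Y.
Proof. by move=> XY [t /XY ?]; exists t. Qed.

Lemma Lip2 U V W (X : Om -> U) (Y : Om -> V) (Z : Om -> W) :
  (forall t, Lip_upto t X -> Lip_upto t Y -> Lip_upto t Z) -> Lip X -> Lip Y -> Lip Z.
Proof.
move=> XYZ [t Xt] [s Ys]; exists (Num.max t s); apply: XYZ.
  by apply: Lip_upto_mono Xt; rewrite le_max lexx.
by apply: Lip_upto_mono Ys; rewrite le_max lexx orbT.
Qed.

Lemma Lip_comp U V (X : Om -> U) (phi : U -> V) :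
  ClLip phi -> Lip X -> Lip (fun w => phi (X w)).
Proof. by move=> phiL; apply: Lip1 => t; apply: Lip_upto_comp. Qed.

Lemma Lip_cst V (v : V) : Lip (fun _ : Om => v).
Proof. by exists 0; apply: Lip_upto_cst. Qed.

Lemma Lip_coord s (a : 'I_d) : Lip (fun w : Om => w s 0 a).
Proof.
case: (lerP 0 s) => s0; first by exists s; apply: Lip_upto_coord; rewrite s0 lexx.
rewrite (_ : (fun w => _) = fun=> 0); first exact: Lip_cst.
by apply/funext => w; rewrite (path_start w (ltW s0)) mxE.
Qed.

Lemma Lip_add V (X Y : Om -> V) : Lip X -> Lip Y -> Lip (fun w => X w + Y w).
Proof. by apply: Lip2 => t; apply: Lip_upto_add. Qed.

Lemma Lip_opp V (X : Om -> V) : Lip X -> Lip (fun w => - X w).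
Proof. by apply: Lip1 => t; apply: Lip_upto_opp. Qed.

Lemma Lip_norm V (X : Om -> V) : Lip X -> Lip (fun w => `|X w|).
Proof. by apply: Lip1 => t; apply: Lip_upto_norm. Qed.

Lemma Lip_mx m n (X : Om -> 'M[R]_(m, n)) i j : Lip X -> Lip (fun w => X w i j).
Proof. by apply: Lip1 => t; apply: Lip_upto_mx. Qed.

Lemma Lip_mul (X Y : Om -> R) : Lip X -> Lip Y -> Lip (fun w => X w * Y w).
Proof. by apply: Lip2 => t; apply: Lip_upto_mul. Qed.

Lemma Lip_exp k (X : Om -> R) : Lip X -> Lip (fun w => X w ^+ k).
Proof. by apply: Lip1 => t; apply: Lip_upto_exp. Qed.

Lemma Lip_max (X Y : Om -> R) :
  Lip X -> Lip Y -> Lip (fun w => Num.max (X w) (Y w)).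
Proof. by apply: Lip2 => t; apply: Lip_upto_max. Qed.

Lemma Lip_sum V (I : Type) (r : seq I) (P : pred I) (X : I -> Om -> V) :
  (forall i, P i -> Lip (X i)) -> Lip (fun w => \sum_(i <- r | P i) X i w).
Proof.
move=> Xt; elim: r => [|i r IH].
  have -> : (fun w => \sum_(i <- [::] | P i) X i w) = fun=> 0.
    by apply/funext => w; exact: big_nil.
  exact: Lip_cst.
rewrite (_ : (fun w => \sum_(j <- i :: r | P j) X j w) =
  (fun w => if P i then X i w + \sum_(j <- r | P j) X j w else \sum_(j <- r | P j) X j w)).
  by case: (P i) (Xt i) => /= [Xi|_]; [apply: Lip_add => //; exact: Xi|exact: IH].
by apply/funext => w; exact: big_cons.
Qed.

End CylinderFunctions.

Ltac lip_step := first
  [ assumption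
  | match goal with
    | H : Lip_upto _ _ |- Lip _ => exact: (Lip_upto_Lip H)
    | H : forall _, Lip_upto _ _ |- Lip_upto _ _ => apply: H
    | H : forall _, Lip _ |- Lip _ => apply: H
    | H : forall _ _, Lip_upto _ _ |- Lip_upto _ _ => apply: H
    | H : forall _ _, Lip _ |- Lip _ => apply: H
    end
  | exact: Lip_upto_cst | exact: Lip_cst
  | exact: Lip_coord
  | apply: Lip_upto_coord | apply: Lip_upto_add | apply: Lip_add
  | apply: Lip_upto_opp | apply: Lip_opp | apply: Lip_upto_norm | apply: Lip_norm
  | apply: Lip_upto_mul | apply: Lip_mul | apply: Lip_upto_exp | apply: Lip_exp
  | apply: Lip_upto_max | apply: Lip_max
  | apply: Lip_upto_sum => ? ? | apply: Lip_sum => ? ? ].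
Ltac lip := repeat lip_step.

Section Sublinear.
Context (R : realType) (d : nat) (G : 'M[R]_d -> R).
Context (E : (C0path R d -> R) -> R) (HE : is_Gexpectation G E).
Local Notation Om := (C0path R d).
Implicit Types (X Y Z : Om -> R) (c : R).

Lemma E_le X Y : Lip X -> Lip Y -> (forall w, X w <= Y w) -> E X <= E Y.
Proof. exact: (Gexp_mono HE). Qed.

Lemma E_cst c : E (fun=> c) = c.
Proof. exact: (Gexp_cst HE). Qed.

Lemma E_ge0 X : Lip X -> (forall w, 0 <= X w) -> 0 <= E X.
Proof. by move=> XL X0; rewrite -(E_cst 0); apply: E_le => //; lip. Qed.

Lemma E_add X Y : Lip X -> Lip Y -> E (fun w => X w + Y w) <= E X + E Y.
Proof. exact: (Gexp_subadd HE). Qed.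

Lemma E_scale c X : 0 <= c -> Lip X -> E (fun w => c * X w) = c * E X.
Proof. exact: (Gexp_poshom HE). Qed.

Lemma E_sum (I : Type) (r : seq I) (P : pred I) (X : I -> Om -> R) :
  (forall i, P i -> Lip (X i)) ->
  E (fun w => \sum_(i <- r | P i) X i w) <= \sum_(i <- r | P i) E (X i).
Proof.
move=> XL; elim: r => [|i r IH].
  rewrite big_nil (_ : (fun w => \sum_(i <- [::] | P i) X i w) = fun=> 0) ?E_cst//.
  by apply/funext => w; exact: big_nil.
rewrite big_cons (_ : (fun w => \sum_(j <- i :: r | P j) X j w) =
  (fun w => if P i then X i w + \sum_(j <- r | P j) X j w else \sum_(j <- r | P j) X j w)).
  2: by apply/funext => w; exact: big_cons.
case: (P i) (XL i) => [/(_ isT) Xi|_]; last exact: IH.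
have SL : Lip (fun w => \sum_(j <- r | P j) X j w) by apply: Lip_sum.
by apply: le_trans (E_add Xi SL) _; rewrite lerD2l.
Qed.

(** A pointwise inequality passes to the expectations only when its right-hand
   side has nonnegative coefficients, because [E] is merely sublinear. *)
Lemma E_dom2 X a Y b Z : 0 <= a -> 0 <= b -> Lip X -> Lip Y -> Lip Z ->
  (forall w, X w <= a * Y w + b * Z w) -> E X <= a * E Y + b * E Z.
Proof.
move=> a0 b0 XL YL ZL XYZ.
apply: le_trans (_ : E (fun w => a * Y w + b * Z w) <= _).
  by apply: E_le => //; lip.
by rewrite -!E_scale//; apply: E_add; lip.
Qed.

Lemma E_dom1 X a Y : 0 <= a -> Lip X -> Lip Y ->
  (forall w, X w <= a * Y w) -> E X <= a * E Y.
Proof. by move=> a0 XL YL XY; rewrite -E_scale//; apply: E_le => //; lip. Qed.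

(** Young's inequality, with a free parameter, does the work of the
   Cauchy-Schwarz inequality. *)
Lemma E_mul_le X Y (l : R) : 0 < l -> Lip X -> Lip Y ->
  E (fun w => `|X w| * `|Y w|) <= l * E (fun w => X w ^+ 2) + l^-1 * E (fun w => Y w ^+ 2).
Proof.
move=> l0 XL YL; apply: E_dom2; rewrite ?invr_ge0 ?ltW//; try by lip.
move=> w; set a := `|X w|; set b := `|Y w|.
rewrite -(@real_normK _ (X w)) ?num_real// -(@real_normK _ (Y w)) ?num_real// -/a -/b.
rewrite -subr_ge0 (_ : _ - _ = l * (a - l^-1 * b / 2) ^+ 2 + l^-1 * (b ^+ 2 * (3 / 4))).
  have b0 : 0 <= b ^+ 2 * (3 / 4) by rewrite mulr_ge0 ?sqr_ge0// divr_ge0.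
  by apply: addr_ge0; apply: mulr_ge0 => //; rewrite ?sqr_ge0 ?invr_ge0 ?(ltW l0).
by field; rewrite gt_eqF.
Qed.

Lemma E_abs_le_sqr X (e : R) : 0 < e -> Lip X ->
  E (fun w => `|X w|) <= e + e^-1 * E (fun w => X w ^+ 2).
Proof.
move=> e0 XL; have := E_mul_le e0 (Lip_cst d (1 : R)) XL.
rewrite expr1n E_cst mulr1; apply: le_trans; rewrite le_eqVlt; apply/orP; left.
by apply/eqP; congr E; apply/funext => w; rewrite normr1 mul1r.
Qed.

Lemma E_norm_sqr X : E (fun w => `|X w| ^+ 2) = E (fun w => X w ^+ 2).
Proof. by congr E; apply/funext => w; rewrite real_normK ?num_real. Qed.

End Sublinear.

(** * Nonnegative forms *)

Section PositiveSemidefinite.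
Context (R : realType) (d : nat).
Implicit Types (D H : 'M[R]_d) (x y : 'rV[R]_d).

Definition qform D x y : R := (x *m D *m y^T) 0 0.

Lemma qformDl D x y z : qform D (x + y) z = qform D x z + qform D y z.
Proof. by rewrite /qform !mulmxDl mxE. Qed.

Lemma qformDr D x y z : qform D z (x + y) = qform D z x + qform D z y.
Proof. by rewrite /qform linearD /= mulmxDr mxE. Qed.

Lemma qformZl D (c : R) x y : qform D (c *: x) y = c * qform D x y.
Proof. by rewrite /qform -!scalemxAl mxE. Qed.

Lemma qformZr D (c : R) x y : qform D x (c *: y) = c * qform D x y.
Proof. by rewrite /qform linearZ /= -!scalemxAr mxE. Qed.

Lemma qformC D x y : D^T = D -> qform D x y = qform D y x.
Proof.
move=> Dsym; have -> : qform D x y = ((x *m D *m y^T)^T) 0 0 by rewrite mxE.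
by rewrite !trmx_mul trmxK Dsym mulmxA.
Qed.

Lemma qform_delta D i j : qform D (delta_mx 0 i) (delta_mx 0 j) = D i j.
Proof. by rewrite /qform trmx_delta -rowE -colE !mxE. Qed.

Lemma qformE D x y : qform D x y = \sum_j \sum_k x 0 j * D j k * y 0 k.
Proof.
rewrite /qform mxE exchange_big; apply: eq_bigr => k _; rewrite !mxE mulr_suml.
by apply: eq_bigr => j _.
Qed.

Lemma psd_diag_ge0 D i : psd D -> 0 <= D i i.
Proof. by move=> [_ /(_ (delta_mx 0 i))]; rewrite -/(qform _ _ _) qform_delta. Qed.

(** Otherwise the form would be negative at [s e_i + e_j] for a suitable [s]. *)
Lemma psd_diag0 D i j : psd D -> D i i = 0 -> D i j = 0.
Proof.
move=> [Dsym Dpos] Di0; have h (s : R) : 0 <= s * 2 * D i j + D j j.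
  have := Dpos (s *: delta_mx 0 i + delta_mx 0 j); rewrite -/(qform _ _ _).
  rewrite !qformDl !qformDr !qformZl !qformZr (qformC (delta_mx 0 j)) //.
  by rewrite !qform_delta Di0; lra.
apply/eqP; apply: contraT => Dij0.
have := h (- (D j j + 1) / (2 * D i j)).
have -> : - (D j j + 1) / (2 * D i j) * 2 * D i j = - (D j j + 1) by field.
lra.
Qed.

(** Elimination of one diagonal entry: [D] minus the rank-one form carried by row
   [i] is still nonnegative, by completing the square in the direction [e_i]. *)
Lemma tr_psd_ge0 H D : psd D -> (forall x, 0 <= qform H x x) -> 0 <= \tr (H *m D).
Proof.
move=> + Hpos; have [n] := ubnP #|[pred i | D i i != 0]|.
elim: n D => // n IH D cardD Dpsd; have [Dsym Dpos] := Dpsd.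
have [[i Di]|] := pselect (exists i, D i i != 0); last first.
  move=> D0; suff -> : D = 0 by rewrite mulmx0 mxtrace0.
  apply/matrixP => i j; rewrite mxE; apply: psd_diag0 => //.
  by apply: contra_notP D0 => /eqP Di; exists i.
have a0 : 0 < D i i by rewrite lt_neqAle eq_sym Di psd_diag_ge0.
pose r := row i D.
pose D' := D - (D i i)^-1 *: (r^T *m r).
have D'E j k : D' j k = D j k - (D i i)^-1 * (D i j * D i k).
  by rewrite !mxE big_ord1 !mxE.
have DC j k : D j k = D k j by rewrite -{1}Dsym mxE.
have D'q x : qform D' x x = qform D x x - (D i i)^-1 * qform D x (delta_mx 0 i) ^+ 2.
  rewrite /qform /D' mulmxBr mulmxBl mxE [X in _ + X]mxE; congr (_ - _).
  rewrite -scalemxAr -scalemxAl mxE; congr (_ * _).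
  have -> : x *m (r^T *m r) *m x^T = (x *m r^T) *m (r *m x^T) by rewrite !mulmxA.
  rewrite mxE big_ord1 expr2 trmx_delta -colE !mxE.
  by congr (_ * _); apply: eq_bigr => j _; rewrite !mxE DC // mulrC.
have D'psd : psd D'.
  split=> [|x]; first by apply/matrixP => j k; rewrite mxE !D'E DC (mulrC (D i j)).
  rewrite -/(qform _ _ _) D'q; set c := qform D x (delta_mx 0 i).
  have := Dpos (x - (c / D i i) *: delta_mx 0 i); rewrite -/(qform _ _ _).
  rewrite -scaleNr !qformDl !qformDr !qformZl !qformZr (qformC (delta_mx 0 i)) //.
  rewrite qform_delta -/c.
  move=> h; apply: le_trans h _; rewrite le_eqVlt; apply/orP; left; apply/eqP.
  by field.
have -> : D = D' + (D i i)^-1 *: (r^T *m r) by rewrite subrK.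
rewrite mulmxDr mxtraceD addr_ge0//; last first.
  rewrite -scalemxAr mxtraceZ; apply: mulr_ge0; first by rewrite invr_ge0 ltW.
  rewrite mulmxA mxtrace_mulC.
  by have := Hpos r; rewrite /qform mulmxA /mxtrace big_ord1.
apply: IH => //; rewrite ltnS in cardD; apply: leq_trans cardD.
apply: proper_card; apply/fintype.properP; split.
  apply/fintype.subsetP => j; rewrite !inE; apply: contraNneq => Dj.
  by rewrite D'E Dj (DC i j) (psd_diag0 i Dpsd Dj) mul0r mulr0 subr0.
by exists i; rewrite !inE //= negbK D'E mulKf ?subrr.
Qed.

End PositiveSemidefinite.

(** * Slopes along lines *)

Section Slopes.
Context (R : realType).

Lemma mean_value_slope (g dg : R -> R) (a D e : R) :
  (forall x : R, `|x| <= `|a| -> is_derive x 1 g (dg x)) ->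
  (forall x, `|x| <= `|a| -> `|dg x - D| <= e) ->
  `|g a - g 0 - a * D| <= e * `|a|.
Proof.
move=> gd dgD.
have cont (x y : R) : -`|a| <= x -> y <= `|a| -> {within `[x, y], continuous g}.
  move=> hx hy; apply: derivable_within_continuous => z.
  rewrite in_itv /= => /andP[xz zy].
  have h : `|z| <= `|a| by rewrite ler_norml; apply/andP; split; lra.
  by have [] := gd z h.
have [a0|a0] := lerP 0 a.
- have dgi (x : R) : x \in `]0, a[ -> is_derive x 1 g (dg x).
    rewrite in_itv /= => /andP[x0 xa]; apply: gd.
    by rewrite !ger0_norm // ltW.
  have c0a : {within `[0, a], continuous g} by apply: cont; rewrite ger0_norm //; lra.
  have [c] := MVT_segment a0 dgi c0a.
  rewrite in_itv /= => /andP[c0 ca] ->.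
  have -> : dg c * (a - 0) - a * D = (dg c - D) * a by ring.
  by rewrite normrM ler_wpM2r// dgD// !ger0_norm.
- have dgi (x : R) : x \in `]a, 0[ -> is_derive x 1 g (dg x).
    rewrite in_itv /= => /andP[xa x0]; apply: gd.
    by rewrite !ltr0_norm // lerN2 ltW.
  have ca0 : {within `[a, 0], continuous g} by apply: cont; rewrite ltr0_norm //; lra.
  have [c] := MVT_segment (ltW a0) dgi ca0.
  rewrite in_itv /= => /andP[ca c0] h.
  have -> : g a - g 0 - a * D = (dg c - D) * a.
    rewrite (_ : g a - g 0 = - (g 0 - g a)); last by ring.
    by rewrite h; ring.
  by rewrite normrM ler_wpM2r// dgD// !ler0_norm ?lerN2//; lra.
Qed.

(** The directional derivative without a quotient, which makes slopes easy to add. *)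
Definition slope (U : normedModType R) (F : U -> R) (p v : U) (L : R) :=
  forall e, 0 < e -> \forall h \near (0 : R),
    `|F (h *: v + p) - F p - h * L| <= e * `|h|.

Lemma slopeP (U : normedModType R) (F : U -> R) (p v : U) (L : R) :
  slope F p v L <-> is_derive p v F L.
Proof.
split=> [sF|[dF <-]].
- have cF : (h^-1 *: ((F \o shift p) (h *: v) - F p)) @[h --> (0 : R)^'] --> L.
    apply/cvgrPdist_le => e e0; rewrite near_withinE.
    near=> h => h0; rewrite distrC /= -(ler_pM2r (_ : 0 < `|h|)) ?normr_gt0//.
    rewrite -normrM mulrBl -[_ *: _]/(_ * _) mulrAC mulVf// mul1r [L * h]mulrC.
    by near: h; exact: sF.
  by apply: DeriveDef; [apply/cvg_ex; exists L|exact: cvg_lim cF].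
- move=> e e0.
  have /cvgrPdist_le/(_ e e0) : (h^-1 *: ((F \o shift p) (h *: v) - F p))
    @[h --> (0 : R)^'] --> 'D_v F p by exact: dF.
  rewrite near_withinE; apply: filterS => h hF.
  have [->|h0] := eqVneq h 0.
    by rewrite scale0r add0r subrr mul0r subrr normr0 mulr0.
  have := hF h0; rewrite distrC /= -(ler_pM2r (_ : 0 < `|h|)) ?normr_gt0//.
  by rewrite -normrM mulrBl -[_ *: _]/(_ * _) mulrAC mulVf// mul1r mulrC [L in _ - L]mulrC mulrC.
Unshelve. all: by end_near. Qed.

Lemma line_is_derive (U : normedModType R) (F : U -> R) (q e : U) (x : R) :
  derivable F (x *: e + q) e ->
  is_derive x (1 : R) (fun y => F (y *: e + q)) ('D_e F (x *: e + q)).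
Proof.
move=> dF; apply/slopeP => eps eps0.
have /slopeP /(_ eps eps0) : is_derive (x *: e + q) e F ('D_e F (x *: e + q)) by [].
by apply: filterS => h; rewrite -[h *: 1]/(h * 1) mulr1 scalerDl addrA.
Qed.

(** A direction along which the derivative exists near the point and is
   continuous there can be added to any direction in which a slope is known:
   the increment along the new direction is controlled by the mean value
   theorem. This turns continuous partial derivatives into directional ones. *)
Lemma slope_add_dir (U : normedModType R) (F : U -> R) (p v e : U) (L c : R) :
  slope F p v L -> (\forall q \near p, derivable F q e) ->
  {for p, continuous ('D_e F)} ->
  slope F p (c *: e + v) (c * 'D_e F p + L).
Proof.
move=> sF dF cF eps eps0; set D := 'D_e F p.
pose eps1 := eps / 2 / (`|c| + 1).
have c1 : 0 < `|c| + 1 by rewrite ltr_wpDl.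
have eps1_gt0 : 0 < eps1 by rewrite !divr_gt0.
have /cvgrPdist_le/(_ _ eps1_gt0) dD := cF.
have : \forall q \near p, derivable F q e /\ `|'D_e F p - 'D_e F q| <= eps1.
  by apply: filterS2 dF dD => q.
rewrite -nbhs_nearE => /nbhs_ballP[r /= r0 rP].
pose M := `|v| + `|c| * `|e| + 1.
have M0 : 0 < M by rewrite ltr_wpDl// addr_ge0// mulr_ge0.
near=> h.
have hr : `|h| < r / M by near: h;
  apply: (@cvgr0_norm_lt _ R _ (nbhs (0 : R)) _ id); [exact: cvg_id|rewrite divr_gt0].
have hP (x : R) : `|x| <= `|h * c| ->
    derivable F (x *: e + (h *: v + p)) e /\ `|D - 'D_e F (x *: e + (h *: v + p))| <= eps1.
  move=> xh; apply: rP; rewrite -ball_normE /= addrA opprD addrCA subrr addr0 normrN.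
  apply: le_lt_trans (ler_normD _ _) _; rewrite !normrZ.
  apply: le_lt_trans (_ : `|h| * M < _); last by rewrite -ltr_pdivlMr.
  have : `|x| * `|e| <= `|h * c| * `|e| by apply: ler_wpM2r.
  by rewrite normrM /M; have := normr_ge0 h; lra.
have sFh : `|F (h *: v + p) - F p - h * L| <= eps / 2 * `|h|.
  by near: h; apply: sF; rewrite divr_gt0.
pose g x := F (x *: e + (h *: v + p)).
pose dg x := 'D_e F (x *: e + (h *: v + p)).
have g_dg (x : R) : `|x| <= `|h * c| -> is_derive x (1 : R) g (dg x).
  by move=> /hP[dFx _]; exact: line_is_derive.
have dg_D (x : R) : `|x| <= `|h * c| -> `|dg x - D| <= eps1.
  by move=> /hP[_]; rewrite distrC.
have gh := mean_value_slope g_dg dg_D.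
move: gh; rewrite /g scale0r add0r => gh.
have -> : h *: (c *: e + v) + p = (h * c) *: e + (h *: v + p).
  by rewrite scalerDr scalerA addrA.
have -> : F ((h * c) *: e + (h *: v + p)) - F p - h * (c * D + L) =
  (F ((h * c) *: e + (h *: v + p)) - F (h *: v + p) - h * c * D) +
  (F (h *: v + p) - F p - h * L) by ring.
apply: le_trans (ler_normD _ _) _.
have : eps1 * `|h * c| <= eps / 2 * `|h|.
  have <- : eps1 * (`|c| + 1) = eps / 2 by rewrite /eps1 divfK// gt_eqF.
  by rewrite normrM mulrCA [leRHS]mulrC ler_wpM2l// ler_wpM2l ?lerDl// ltW.
move: gh sFh; set t1 := `| _ |; set t2 := `| _ |; set t3 := `|h|; lra.
Unshelve. all: by end_near. Qed.

Lemma slope_sum_dir (U : normedModType R) (F : U -> R) (p : U) n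
    (e : 'I_n -> U) (c : 'I_n -> R) :
  (forall i, \forall q \near p, derivable F q (e i)) ->
  (forall i, {for p, continuous ('D_(e i) F)}) ->
  slope F p (\sum_i c i *: e i) (\sum_i c i * 'D_(e i) F p).
Proof.
move=> dF cF; elim: (index_enum _) => [|i r IH].
  rewrite !big_nil => eps eps0; near=> h.
  by rewrite scaler0 add0r subrr mulr0 subrr normr0 mulr_ge0// ltW.
by rewrite !big_cons; apply: slope_add_dir.
Unshelve. all: by end_near. Qed.

(** Only the slope of the derivative at [0] is required, so that second directional
   derivatives are computed at the point of contact alone. *)
Lemma second_derivative_test (m dm : R -> R) (A : R) :
  (forall x : R, is_derive x 1 m (dm x)) -> slope dm 0 1 A ->
  (\forall h \near (0 : R), m 0 <= m h) -> dm 0 = 0 /\ 0 <= A.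
Proof.
move=> md sA m0; have dm0 : dm 0 = 0.
  move: m0; rewrite -nbhs_nearE => /nbhs_ballP[r /= r0 rP].
  have d0 : is_derive (0 : R) (1 : R) m 0.
    apply: (@derive1_at_min _ m (- r) r 0).
    + by lra.
    + by move=> t _; have [] := md t.
    + by rewrite in_itv /=; apply/andP; split; lra.
    + move=> t; rewrite in_itv /= => /andP[t1 t2]; apply: rP.
      by rewrite -ball_normE /= sub0r normrN ltr_norml t1 t2.
  by have [_ <-] := md 0; have [_ ->] := d0.
split=> //; rewrite leNgt; apply/negP => A0.
have : \forall h \near (0 : R), m 0 <= m h /\ `|dm h - h * A| <= - A / 2 * `|h|.
  have e0 : 0 < - A / 2 by lra.
  apply: filterS2 m0 (sA _ e0) => h; rewrite -[h *: 1]/(h * 1) mulr1 addr0 dm0 subr0.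
  by [].
rewrite -nbhs_nearE => /nbhs_ballP[r /= r0 rP].
have Pr (h : R) : 0 < h -> h < r -> m 0 <= m h /\ dm h < 0.
  move=> h0 hr; have [|m0h] := rP h.
    by rewrite -ball_normE /= sub0r normrN gtr0_norm.
  rewrite (gtr0_norm h0) ler_norml => /andP[_ dmh]; split=> //.
  have : 0 < h * - A by rewrite mulr_gt0// oppr_gt0.
  lra.
have r2 : 0 < r / 2 by rewrite divr_gt0.
have [c] := MVT r2 (fun x _ => md x)
  (derivable_within_continuous (fun x _ => @ex_derive _ _ _ _ _ _ _ (md x))).
rewrite in_itv /= => /andP[c0 cr] mr.
have r2r : r / 2 < r by lra.
have [_ dmc] := Pr c c0 (lt_trans cr r2r).
have [m0r _] := Pr (r / 2) r2 r2r.
have : 0 < - dm c * (r / 2) by rewrite mulr_gt0// oppr_gt0.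
by rewrite subr0 in mr; lra.
Qed.

End Slopes.

(** * Classical solutions of the G-heat equation *)

Section SlopeCalculus.
Context (R : realType).

Lemma near_along (S T : topologicalType) (g : S -> T) (x : S) (y : T) (P : set T) :
  g z @[z --> x] --> y -> (\forall z \near y, P z) -> \forall z \near x, P (g z).
Proof. by move=> gxy Py; exact: gxy. Qed.

Lemma line_cvg (U : normedModType R) (p v : U) : h *: v + p @[h --> (0 : R)] --> p.
Proof.
have : h *: v + p @[h --> (0 : R)] --> (0 : R) *: v + p.
  by apply: cvgD; [apply: cvgZ; [exact: cvg_id|exact: cvg_cst]|exact: cvg_cst].
by rewrite scale0r add0r.
Qed.

Lemma slope_line (U : normedModType R) (F : U -> R) (p v : U) (x L : R) :
  slope F (x *: v + p) v L -> slope (fun y : R => F (y *: v + p)) x 1 L.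
Proof.
move=> sF e e0; apply: filterS (sF e e0) => h.
by rewrite -[h *: 1]/(h * 1) mulr1 scalerDl addrA.
Qed.

Lemma slope_scale_dir (U : normedModType R) (F : U -> R) (p v : U) (c L : R) :
  slope F p v L -> slope F p (c *: v) (c * L).
Proof.
move=> sF e e0; have c0 := normr_ge0 c.
have ec : 0 < e / (`|c| + 1) by rewrite divr_gt0//; lra.
have cvg0 : h * c @[h --> (0 : R)] --> (0 : R).
  by rewrite -[X in _ --> X](mul0r c); apply: cvgM; [exact: cvg_id|exact: cvg_cst].
apply: filterS (near_along cvg0 (sF _ ec)) => h /=; rewrite scalerA mulrA => /le_trans; apply.
rewrite normrM mulrCA [leRHS]mulrC ler_wpM2l// mulrC mulrA ler_pdivrMr; last by lra.
by rewrite mulrC ler_wpM2l ?ltW//; lra.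
Qed.

Lemma slope_lin (U : normedModType R) (F H : U -> R) (p v : U) (a b L M : R) :
  slope F p v L -> slope H p v M ->
  slope (fun x => a * F x + b * H x) p v (a * L + b * M).
Proof.
move=> sF sH e e0; have a0 := normr_ge0 a; have b0 := normr_ge0 b.
have e1 : 0 < e / (`|a| + `|b| + 1) by rewrite divr_gt0//; lra.
apply: filterS2 (sF _ e1) (sH _ e1) => h.
set eps := e / _; set x := F _ - _ - _; set y := H _ - _ - _ => hx hy.
have -> : a * F (h *: v + p) + b * H (h *: v + p) - (a * F p + b * H p) -
  h * (a * L + b * M) = a * x + b * y by rewrite /x /y; ring.
apply: le_trans (ler_normD _ _) _; rewrite !normrM.
have -> : e = eps * (`|a| + `|b| + 1) by rewrite /eps divfK// gt_eqF//; lra.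
have : `|a| * `|x| <= `|a| * (eps * `|h|) by rewrite ler_wpM2l.
have : `|b| * `|y| <= `|b| * (eps * `|h|) by rewrite ler_wpM2l.
have : 0 <= eps * `|h| by rewrite mulr_ge0// ltW.
lra.
Qed.

Lemma slope_sum (U : normedModType R) n (F : 'I_n -> U -> R) (p v : U) (c L : 'I_n -> R) :
  (forall i, slope (F i) p v (L i)) ->
  slope (fun x => \sum_i c i * F i x) p v (\sum_i c i * L i).
Proof.
move=> sF; elim: (index_enum _) => [|i r IH].
  rewrite big_nil => e e0; near=> h.
  by rewrite !big_nil mulr0 subrr subr0 normr0 mulr_ge0// ltW.
rewrite big_cons; have := slope_lin (c i) 1 (sF i) IH; rewrite mul1r.
congr slope; apply/funext => x.
by rewrite [RHS]big_cons mul1r.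
Unshelve. all: by end_near. Qed.

End SlopeCalculus.

Section ClassicalSolutions.
Context (R : realType) (d : nat) (Sigma : set 'M[R]_d) (a : 'I_d).
Hypotheses (Sigma_psd : Sigma `<=` @psd R d) (Sigma_ne : Sigma !=set0)
  (Sigma_bounded : bounded_set Sigma).

(** The largest variance rate of the coordinate [a], which is
   [2 G (e_a^T e_a)]. *)
Definition max_var : R := sup [set D a a | D in Sigma].

Lemma linear_image_bounded (H : 'M[R]_d) :
  has_ubound [set \tr (H *m D) | D in Sigma].
Proof.
have [M [_ /(_ (M + 1))]] := Sigma_bounded; rewrite ltrDl => /(_ ltr01) SM.
exists (\sum_i \sum_j `|H i j| * (M + 1)) => _ [D DS <-].
rewrite /mxtrace; apply: ler_sum => i _; rewrite mxE; apply: ler_sum => j _.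
apply: le_trans (ler_norm _) _; rewrite normrM ler_wpM2l//.
apply: le_trans (SM D DS); rewrite [leRHS]/Num.Def.normr/= mx_normrE.
exact: (le_bigmax_cond _ _ (erefl true : xpredT (j, i))).
Qed.

Lemma tr_delta (D : 'M[R]_d) : \tr (delta_mx a a *m D) = D a a.
Proof.
rewrite /mxtrace (bigD1 a) //= big1 ?addr0 => [|i ia].
  by rewrite mxE (bigD1 a) //= big1 ?addr0 => [|j ja]; rewrite !mxE ?eqxx ?mul1r//
    (negPf ja) andbF mul0r.
by rewrite mxE big1 // => j _; rewrite !mxE (negPf ia) mul0r.
Qed.

Lemma diag_le_max_var D : Sigma D -> D a a <= max_var.
Proof.
move=> DS; apply: ub_le_sup; last by exists D.
have [M MP] := linear_image_bounded (delta_mx a a); exists M => _ [D' D'S <-].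
by apply: MP; exists D'; rewrite // tr_delta.
Qed.

Lemma max_var_ge0 : 0 <= max_var.
Proof.
have [D DS] := Sigma_ne; apply: le_trans (diag_le_max_var DS).
exact/psd_diag_ge0/Sigma_psd.
Qed.

Lemma qform_scale_delta (c : R) v : qform (c *: delta_mx a a) v v = c * v 0 a ^+ 2.
Proof.
rewrite qformE (bigD1 a) //= [X in _ + X]big1 ?addr0 => [|j ja].
  rewrite (bigD1 a) //= [X in _ + X]big1 ?addr0 => [|j ja].
    by rewrite !mxE eqxx /=; ring.
  by rewrite !mxE (negPf ja) andbF /=; ring.
by apply: big1 => k _; rewrite !mxE (negPf ja) /=; ring.
Qed.

Lemma qform_sub (H K : 'M[R]_d) v : qform (H - K) v v = qform H v v - qform K v v.
Proof. by rewrite /qform mulmxBr mulmxBl !mxE. Qed.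

(** Monotonicity of [G]: the trace of a product of two nonnegative forms is
   nonnegative. *)
Lemma tr_le_of_qform (H K : 'M[R]_d) D : Sigma D ->
  (forall v, qform H v v <= qform K v v) -> \tr (H *m D) <= \tr (K *m D).
Proof.
move=> DS HK; rewrite -subr_ge0 -linearB /= -mulmxBl.
by apply: tr_psd_ge0 => [|v]; [exact: Sigma_psd|rewrite qform_sub subr_ge0].
Qed.

Lemma Gfun_ge (H : 'M[R]_d) (c : R) : 0 <= c ->
  (forall v : 'rV[R]_d, c * v 0 a ^+ 2 <= qform H v v) -> c * max_var / 2 <= Gfun Sigma H.
Proof.
move=> c0 cH; rewrite ler_pM2r ?invr_gt0//.
have trH D : Sigma D -> c * D a a <= sup [set \tr (H *m D) | D in Sigma].
  move=> DS; apply: le_trans (ub_le_sup (linear_image_bounded H) _); last by exists D.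
  rewrite -tr_delta -mxtraceZ scalemxAl; apply: tr_le_of_qform => // v.
  by rewrite qform_scale_delta.
have [c00|] := eqVneq c 0.
  by have [D DS] := Sigma_ne; have := trH D DS; rewrite c00 !mul0r.
move=> cn0; have cp : 0 < c by rewrite lt_neqAle eq_sym cn0.
rewrite mulrC -ler_pdivlMr//; apply: ge_sup.
  by have [D DS] := Sigma_ne; exists (D a a), D.
by move=> _ [D DS <-]; rewrite ler_pdivlMr// mulrC; exact: trH.
Qed.

Lemma Gfun_le (H : 'M[R]_d) (c : R) : 0 <= c ->
  (forall v : 'rV[R]_d, qform H v v <= c * v 0 a ^+ 2) -> Gfun Sigma H <= c * max_var / 2.
Proof.
move=> c0 cH; rewrite ler_pM2r ?invr_gt0//; apply: ge_sup.
  by have [D DS] := Sigma_ne; exists (\tr (H *m D)), D.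
move=> _ [D DS <-]; apply: le_trans (_ : c * D a a <= _).
  rewrite -tr_delta -mxtraceZ scalemxAl; apply: tr_le_of_qform => // v.
  by rewrite qform_scale_delta.
by rewrite ler_wpM2l// diag_le_max_var.
Qed.

Context (f ft fx fxx : R -> R -> R).
Hypotheses (f_t : forall t x, is_derive t (1 : R) (f ^~ x) (ft t x))
  (f_x : forall t x, is_derive x (1 : R) (f t) (fx t x))
  (f_xx : forall t x, is_derive x (1 : R) (fx t) (fxx t x)).

Let u (q : R * 'rV[R]_d) := f q.1 (q.2 0 a).

Lemma near_positive_time (p : R * 'rV[R]_d) : 0 < p.1 -> \forall q \near p, 0 < q.1.
Proof.
move=> p0; rewrite -nbhs_nearE; apply/nbhs_ballP; exists p.1 => //= q.
rewrite -ball_normE /= => qp.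
have [/= h _] := prod_norm_le (p - q); have := le_lt_trans h qp.
by move=> /(le_lt_trans (ler_norm _)); lra.
Qed.

(** At an interior minimum of [s (psi - u)] its derivative in time vanishes and its
   second derivatives in space are nonnegative; [s = 1] is the subsolution test and
   [s = -1] the supersolution test. *)
Lemma touching_derivatives psi (p : R * 'rV[R]_d) (s : R) : s != 0 ->
  C12 psi -> 0 < p.1 ->
  (\forall q \near p, s * (psi p - u p) <= s * (psi q - u q)) ->
  'D_(dir_t R d) psi p = ft p.1 (p.2 0 a) /\
  forall v : 'rV[R]_d, 0 <= s * (qform (hessian psi p) v v - fxx p.1 (p.2 0 a) * v 0 a ^+ 2).
Proof.
move=> s0 [psi1 psi2] p0 smin; split.
- pose m (h : R) := s * (psi (h *: dir_t R d + p) - f (p.1 + h) (p.2 0 a)).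
  have lp := @line_cvg R _ p (dir_t R d).
  have uE (h : R) : u (h *: dir_t R d + p) = f (p.1 + h) (p.2 0 a).
    by rewrite /u /= -[h *: 1]/(h * 1) mulr1 scaler0 add0r addrC.
  have := near_along lp smin; rewrite -nbhs_nearE => /nbhs_ballP[r /= r0 rP].
  pose r' := Num.min r p.1.
  have r'0 : 0 < r' by rewrite lt_min r0.
  have md (h : R) : 0 < p.1 + h -> slope m h 1
      (s * 'D_(dir_t R d) psi (h *: dir_t R d + p) + (- s) * ft (p.1 + h) (p.2 0 a)).
    move=> ph; have [d1 _ _] := psi1 (h *: dir_t R d + p)
      (ltac:(by rewrite /= -[h *: 1]/(h * 1) mulr1 addrC)).
    have -> : m = (fun h => s * psi (h *: dir_t R d + p) + (- s) * f (p.1 + h) (p.2 0 a)).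
      by apply/funext => y; rewrite /m; ring.
    apply: slope_lin; first by apply: slope_line; apply/slopeP.
    have := f_t (p.1 + h) (p.2 0 a) => /slopeP ff e e0.
    apply: filterS (ff e e0) => k; rewrite -[k *: 1]/(k * 1) mulr1.
    by rewrite addrCA.
  have d0 : is_derive (0 : R) (1 : R) m 0.
    apply: (@derive1_at_min _ m (- r') r' 0).
    + by lra.
    + move=> t; rewrite in_itv /= => /andP[t1 t2].
      have r'p : r' <= p.1 by rewrite ge_min lexx orbT.
      have /md /slopeP[] // : 0 < p.1 + t by lra.
    + by rewrite in_itv /=; apply/andP; split; lra.
    + move=> t; rewrite in_itv /= => /andP[t1 t2].
      have := rP t; rewrite -ball_normE /= sub0r normrN /m scale0r !add0r addr0 -uE; apply.
      rewrite ltr_norml; have : r' <= r by rewrite ge_min lexx.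
      by move=> ?; apply/andP; split; lra.
  have /slopeP[_ h1] := md 0 (ltac:(by rewrite addr0)).
  have [_ h2] := d0; move: h1; rewrite h2 scale0r add0r addr0 mulNr -mulrBr.
  by move/esym/eqP; rewrite mulf_eq0 (negPf s0) /= subr_eq0 => /eqP.
- move=> v; pose e : R * 'rV[R]_d := (0, v).
  have eE : e = \sum_i v 0 i *: dir_x R i.
    rewrite {1}/e {1}[v]row_sum_delta; elim: (index_enum _) => [|i r IH].
      by rewrite !big_nil.
    rewrite !big_cons -IH /dir_x; congr pair => /=.
    by rewrite addr0; apply/esym; exact: mulr0.
  have pos (h : R) : 0 < (h *: e + p).1 by rewrite /= scaler0 add0r.
  have s1 (h : R) : slope psi (h *: e + p) e (\sum_i v 0 i * 'D_(dir_x R i) psi (h *: e + p)).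
    rewrite {2}eE; apply: slope_sum_dir => i; last first.
      by have [_ _ /(_ i)[]] := psi1 _ (pos h).
    by apply: filterS (near_positive_time (pos h)) => q q0; have [_ _ /(_ i)[]] := psi1 _ q0.
  have s2 j : slope ('D_(dir_x R j) psi) p e
      (\sum_i v 0 i * 'D_(dir_x R i) ('D_(dir_x R j) psi) p).
    rewrite {1}eE; apply: slope_sum_dir => i; last by have [] := psi2 _ p0 i j.
    by apply: filterS (near_positive_time p0) => q q0; have [] := psi2 _ q0 i j.
  have s3 (F dF : R -> R) : (forall x : R, is_derive x 1 F (dF x)) -> forall h : R,
      slope (fun h : R => F (p.2 0 a + h * v 0 a)) h 1 (v 0 a * dF (p.2 0 a + h * v 0 a)).
    move=> FdF h.
    have /slopeP/(slope_scale_dir (v 0 a)) := FdF (p.2 0 a + h * v 0 a).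
    rewrite -[v 0 a *: 1]/(v 0 a * 1) mulr1 => sF eps eps0; apply: filterS (sF eps eps0) => k.
    by rewrite -[k *: 1]/(k * 1) mulr1 -[k *: v 0 a]/(k * v 0 a) mulrDl addrCA.
  pose m (h : R) := s * psi (h *: e + p) + (- s) * f p.1 (p.2 0 a + h * v 0 a).
  pose dm (h : R) := s * (\sum_i v 0 i * 'D_(dir_x R i) psi (h *: e + p)) +
    (- s) * (v 0 a * fx p.1 (p.2 0 a + h * v 0 a)).
  have [|||_] := @second_derivative_test _ m dm (s * (\sum_i v 0 i *
      (\sum_j v 0 j * 'D_(dir_x R j) ('D_(dir_x R i) psi) p)) +
      (- s) * (v 0 a * (v 0 a * fxx p.1 (p.2 0 a)))).
  + move=> x; apply/slopeP; apply: slope_lin; first exact: slope_line.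
    exact: (s3 (f p.1) (fx p.1)).
  + apply: slope_lin.
      apply: (@slope_sum _ _ _ (fun i (h : R) => 'D_(dir_x R i) psi (h *: e + p))).
      move=> i; apply: (@slope_line _ _ ('D_(dir_x R i) psi)).
      by rewrite scale0r add0r; exact: s2.
    have := slope_lin (v 0 a) 0 (s3 (fx p.1) (fxx p.1) (f_xx p.1) 0)
      (s3 (fx p.1) (fxx p.1) (f_xx p.1) 0).
    rewrite mul0r !addr0 mul0r addr0; congr slope.
    by apply/funext => y; rewrite mul0r addr0.
  + apply: filterS (near_along (@line_cvg R _ p e) smin) => h.
    rewrite /m /u scale0r !add0r mul0r addr0 /= scaler0 add0r !mxE.
    rewrite [h * v 0 a + _]addrC. lra.
  congr (0 <= _); rewrite mulNr -mulrBr; congr (_ * (_ - _)); last by ring.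
  rewrite qformE exchange_big /=; apply: eq_bigr => i _; rewrite mulr_sumr.
  by apply: eq_bigr => j _; rewrite mxE; ring.
Qed.

Hypotheses (u_lip : ClLip u) (f_convex : forall t x, 0 < t -> 0 <= fxx t x)
  (f_heat : forall t x, ft t x = fxx t x * max_var / 2).

(** A smooth solution depending on one coordinate, convex in it, solves the
   [G]-heat equation: [G] is monotone and on multiples [c >= 0] of a diagonal
   unit it is linear. *)
Lemma convex_profile_solution : Gheat_solution (Gfun Sigma) (fun x => u (0, x)) u.
Proof.
split=> //.
- apply: continuous_subspaceT => p.
  have [C [m [C0 uC]]] := (iffLR (ClLipP _)) u_lip.
  apply/cvgrPdist_le => e e0.
  pose M := C * (1 + `|p| + (`|p| + 1)) ^+ m + 1.
  have M0 : 0 < M by rewrite ltr_wpDl// mulr_ge0// exprn_ge0// !addr_ge0.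
  have dM : 0 < Num.min 1 (e / M) by rewrite lt_min ltr01 divr_gt0.
  apply: filterS (nbhsx_ballx p _ dM) => q.
  rewrite -ball_normE /= lt_min => /andP[pq1 pqM].
  apply: le_trans (uC p q) _.
  have q1 : `|q| <= `|p| + 1.
    have -> : q = p - (p - q) by rewrite opprB addrCA subrr addr0.
    by apply: le_trans (ler_normB _ _) _; rewrite lerD2l ltW.
  apply: le_trans (_ : M * `|p - q| <= _).
    apply: ler_wpM2r => //; apply: le_trans (_ : C * (1 + `|p| + (`|p| + 1)) ^+ m <= _).
      by apply: ler_wpM2l => //; apply: lerXn2r; rewrite ?nnegrE ?addr_ge0//; lra.
    by rewrite lerDl.
  by rewrite mulrC -ler_pdivlMr// ltW.
- move=> T; have [C [m [C1 uC]]] := ClLip_growth u_lip.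
  exists (C * ((3 + `|T|) ^+ m)), m => t x /andP[t0 tT].
  apply: le_trans (uC _) _; rewrite -mulrA; apply: ler_wpM2l; first lra.
  have TT := ler_norm T; have x0 := normr_ge0 x; have T0 := normr_ge0 T.
  have xm := exprn_ge0 m x0.
  apply: le_trans (_ : ((3 + `|T|) * Num.max 1 `|x|) ^+ m <= _).
    apply: lerXn2r; rewrite ?nnegrE ?addr_ge0// ?mulr_ge0 ?addr_ge0 ?le_max ?ler01//.
    rewrite prod_normE /= (ger0_norm t0).
    have : 1 <= Num.max 1 `|x| by rewrite le_max lexx.
    have : `|x| <= Num.max 1 `|x| by rewrite le_max lexx orbT.
    have h : `|T| <= `|T| * Num.max 1 `|x| by rewrite ler_peMr// le_max lexx.
    have : Num.max t `|x| <= t + `|x| by rewrite ge_max lerDl lerDr x0 t0.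
    lra.
  rewrite exprMn; apply: ler_wpM2l; first by apply: exprn_ge0; lra.
  by have [x1|x1] := leP 1 `|x|; rewrite ?expr1n; lra.
- move=> psi p psiC p0 hmin.
  have [|->] := @touching_derivatives psi p 1 (oner_neq0 _) psiC p0.
    by apply: filterS hmin => q; lra.
  move=> hv; rewrite subr_le0 f_heat; apply: Gfun_ge; first exact: f_convex.
  by move=> v; have := hv v; lra.
- move=> psi p psiC p0 hmin.
  have [||->] := @touching_derivatives psi p (-1) _ psiC p0.
  + by rewrite oppr_eq0 oner_neq0.
  + by apply: filterS hmin => q; lra.
  move=> hv; rewrite subr_ge0 f_heat; apply: Gfun_le; first exact: f_convex.
  by move=> v; have := hv v; lra.
Qed.

End ClassicalSolutions.

(** * Moments of the increments *)

Section IncrementMoments.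
Context (R : realType) (d : nat) (Sigma : set 'M[R]_d).
Hypotheses (Sigma_psd : Sigma `<=` @psd R d) (Sigma_ne : Sigma !=set0)
  (Sigma_bounded : bounded_set Sigma).
Context (E : (C0path R d -> R) -> R) (HE : is_Gexpectation (Gfun Sigma) E).

Lemma ClLip_space a : ClLip (fun q : R * 'rV[R]_d => q.2 0 a).
Proof. exact: (ClLip_comp (@ClLip_snd _ _ _) (@ClLip_linear_coord _ _ _ _ _)). Qed.

(** The value at [s] of a caloric polynomial is the mean of its initial value taken
   at an increment over a time [s]. One polynomial in two variables appears as
   [P t] in space and as [Q x] in time, so that the derivatives in either variable
   are formal ones. *)
Lemma increment_moment a (P Q : R -> {poly R}) (s t : R) :
  (forall t x, (P t).[x] = (Q x).[t]) ->
  ClLip (fun q : R * 'rV[R]_d => (P q.1).[q.2 0 a]) ->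
  (forall t x, 0 < t -> 0 <= (P t)^`()^`().[x]) ->
  (forall t x, (Q x)^`().[t] = (P t)^`()^`().[x] * max_var Sigma a / 2) ->
  0 <= s -> 0 <= t ->
  E (fun w => (P 0).[(w (t + s) - w t) 0 a]) = (P s).[0].
Proof.
move=> PQ PL Pconv Pheat s0 t0.
pose u (q : R * 'rV[R]_d) := (P q.1).[q.2 0 a].
have phiL : ClLip (fun x : 'rV[R]_d => u (0, x)).
  have zL : ClLip (fun _ : 'rV[R]_d => (0 : R)) by exact: ClLip_cst.
  have idL : ClLip (fun x : 'rV[R]_d => x).
    by apply: (@ClLip_lipschitz _ _ _ _ 1) => x y; rewrite mul1r.
  exact: (ClLip_comp (ClLip_pair zL idL) PL).
have [_ h] := Gexp_incr HE phiL.
have usol : Gheat_solution (Gfun Sigma) (fun x => u (0, x)) u.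
  apply: (@convex_profile_solution R d Sigma a Sigma_psd Sigma_ne Sigma_bounded
    (fun t x => (P t).[x]) (fun t x => (Q x)^`().[t]) (fun t x => (P t)^`().[x])
    (fun t x => (P t)^`()^`().[x])) => //; try by move=> t' x; exact: is_derive_poly.
  move=> t' x; have -> : (fun t => (P t).[x]) = horner (Q x).
    by apply/funext => y; rewrite PQ.
  exact: is_derive_poly.
by have := h u usol s t s0 t0; rewrite /u /= mxE.
Qed.

(** The profile [c x] is linear, so that both signs of [c] are allowed: the mean of
   an increment is certain. *)
Lemma increment_mean0 a (c s t : R) : 0 <= s -> 0 <= t ->
  E (fun w => c * (w (t + s) 0 a - w t 0 a)) = 0.
Proof.
move=> s0 t0.
have := @increment_moment a (fun _ => c *: 'X) (fun x => (c * x)%:P) s t.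
rewrite !hornerE => <- //.
- by congr E; apply/funext => w; rewrite !hornerE !mxE.
- by move=> ? ?; rewrite !hornerE.
- rewrite (_ : (fun _ => _) = (fun q : R * 'rV[R]_d => c * q.2 0 a)).
    by apply: ClLip_fmul; [exact: ClLip_cst|exact: ClLip_space].
  by apply/funext => q; rewrite !hornerE.
- by move=> ? ? _; rewrite !poly.derivE ?hornerE ?mul1r ?mulr1 ?lexx ?mulr0n ?mulr2n
    ?addr_ge0 ?ler01.
- by move=> ? ?; rewrite !poly.derivE ?hornerE; ring.
Qed.

(** The caloric polynomial [x^2 + v t] is convex in [x]. *)
Lemma increment_variance a (s t : R) : 0 <= s -> 0 <= t ->
  E (fun w => (w (t + s) 0 a - w t 0 a) ^+ 2) = max_var Sigma a * s.
Proof.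
move=> s0 t0; set v := max_var Sigma a.
have := @increment_moment a (fun t => 'X ^+ 2 + (v * t)%:P)
   (fun x => v *: 'X + (x ^+ 2)%:P) s t.
rewrite !hornerE expr0n add0r => <- //.
- by congr E; apply/funext => w; rewrite !hornerE !mxE /=; ring.
- by move=> ? ?; rewrite !hornerE addrC.
- rewrite (_ : (fun _ => _) = (fun q : R * 'rV[R]_d => q.2 0 a ^+ 2 + v * q.1)).
    apply: ClLip_fadd; first by apply: ClLip_fexp; exact: ClLip_space.
    by apply: ClLip_fmul; [exact: ClLip_cst|exact: ClLip_fst].
  by apply/funext => q; rewrite !hornerE.
- by move=> ? ? _; rewrite !poly.derivE ?hornerE ?mul1r ?mulr1 ?lexx ?mulr0n ?mulr2n
    ?addr_ge0 ?ler01.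
- move=> ? ?; rewrite !poly.derivE ?hornerE /= -/v. by field.
Qed.

(** The caloric polynomial [x^4 + 6 v t x^2 + 3 (v t)^2] is convex in [x]. *)
Lemma increment_fourth a (s t : R) : 0 <= s -> 0 <= t ->
  E (fun w => (w (t + s) 0 a - w t 0 a) ^+ 4) = 3 * (max_var Sigma a * s) ^+ 2.
Proof.
move=> s0 t0; set v := max_var Sigma a.
have v0 : 0 <= v by exact: max_var_ge0.
pose P t := 'X ^+ 4 + (6 * v * t) *: 'X ^+ 2 + (3 * (v * t) ^+ 2)%:P.
pose Q x := (3 * v ^+ 2) *: 'X ^+ 2 + (6 * v * x ^+ 2) *: 'X + (x ^+ 4)%:P.
have -> : 3 * (v * s) ^+ 2 = (P s).[0]. rewrite /P !hornerE /=; ring.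
rewrite -(@increment_moment a P Q s t) //.
- by congr E; apply/funext => w; rewrite /P !hornerE !mxE /=; ring.
- by move=> ? ?; rewrite /P /Q !hornerE /=; ring.
- rewrite (_ : (fun _ => _) = (fun q : R * 'rV[R]_d =>
    q.2 0 a ^+ 4 + 6 * v * q.1 * q.2 0 a ^+ 2 + 3 * (v * q.1) ^+ 2)).
    have xL := @ClLip_space a; have tL := @ClLip_fst R R 'rV[R]_d.
    have cL (c : R) : ClLip (fun q : R * 'rV[R]_d => c) by exact: ClLip_cst.
    apply: ClLip_fadd; first apply: ClLip_fadd.
    + exact: ClLip_fexp.
    + by apply: ClLip_fmul; [apply: ClLip_fmul|apply: ClLip_fexp].
    + by apply: ClLip_fmul => //; apply: ClLip_fexp; apply: ClLip_fmul.
  by apply/funext => q; rewrite /P !hornerE /=; ring.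
- move=> t' x t'0; rewrite /P /Q !poly.derivE ?hornerE /=.
  have h1 : 0 <= x ^+ 2 by rewrite sqr_ge0.
  have h2 : 0 <= v * t' by rewrite mulr_ge0// ltW.
  nra.
- by move=> ? ?; rewrite /P /Q !poly.derivE ?hornerE /= -/v; field.
Qed.

End IncrementMoments.

(** * Martingale sums *)

Section MartingaleEstimates.
Context (R : realType) (d : nat) (G : 'M[R]_d -> R).
Context (E : (C0path R d -> R) -> R) (HE : is_Gexpectation G E).
Context (K : R) (K0 : 0 <= K).
Hypothesis mean0 : forall a (c s t : R), 0 <= s -> 0 <= t ->
  E (fun w => c * (w (t + s) 0 a - w t 0 a)) = 0.
Hypothesis variance : forall a (s t : R), 0 <= s -> 0 <= t ->
  E (fun w => (w (t + s) 0 a - w t 0 a) ^+ 2) <= K * s.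
Hypothesis fourth : forall a (s t : R), 0 <= s -> 0 <= t ->
  E (fun w => (w (t + s) 0 a - w t 0 a) ^+ 4) <= 3 * (K * s) ^+ 2.
Local Notation Om := (C0path R d).
Local Notation dB a s t := (fun w : Om => w t 0 a - w s 0 a).

Lemma E_indep (X : Om -> R) (psi : R -> R) a (s t : R) : 0 <= s <= t ->
  Lip_upto s X -> ClLip psi ->
  E (fun w => X w * psi (w t 0 a - w s 0 a)) =
  E (fun w => E (fun w' => X w * psi (w' t 0 a - w' s 0 a))).
Proof.
move=> /andP[s0 st] [n [ts [phi [phiL tss ->]]]] psiL.
have ts0 : 0 <= t - s by rewrite subr_ge0.
have PL : ClLip (fun p : 'M[R]_(n, d) * 'rV[R]_d => phi p.1 * psi (p.2 0 a)).
  have pL := ClLip_comp (ClLip_comp (@ClLip_snd R 'M[R]_(n, d) 'rV[R]_d)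
    (@ClLip_linear_coord R 1 d 0 a)) psiL.
  have fL := ClLip_comp (@ClLip_fst R 'M[R]_(n, d) 'rV[R]_d) phiL.
  exact: (ClLip_comp (ClLip_pair fL pL) (@ClLip_scale R R)).
have := Gexp_indep HE tss s0 ts0 PL; rewrite /= subrKC.
have inc (w : Om) : (w t - w s) 0 a = w t 0 a - w s 0 a by rewrite !mxE.
move=> h; transitivity (E (fun w : Om => phi (sample ts w) * psi ((w t - w s) 0 a))).
  by congr E; apply/funext => w; rewrite inc.
rewrite h; congr E; apply/funext => w; congr E; apply/funext => w'.
by rewrite inc.
Qed.

Lemma E_indep_ge0 (X : Om -> R) (psi : R -> R) a (s t : R) : 0 <= s <= t ->
  Lip_upto s X -> (forall w, 0 <= X w) -> ClLip psi ->
  E (fun w => X w * psi (w t 0 a - w s 0 a)) =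
  E (fun w => X w * E (fun w' => psi (w' t 0 a - w' s 0 a))).
Proof.
move=> st XL X0 psiL; rewrite E_indep//; congr E; apply/funext => w.
rewrite (E_scale HE)//; apply: (Lip_comp psiL); lip.
Qed.

(** Conditionally on [X] the increment is multiplied by a constant of arbitrary
   sign, which [mean0] allows. *)
Lemma E_increment0 (X : Om -> R) a (s t : R) : 0 <= s <= t -> Lip_upto s X ->
  E (fun w => X w * (w t 0 a - w s 0 a)) = 0.
Proof.
move=> st XL; have idL : ClLip (fun x : R => x).
  by apply: (@ClLip_lipschitz _ _ _ _ 1) => x y; rewrite mul1r.
rewrite (@E_indep X id)//; transitivity (E (fun=> 0)); last exact: E_cst HE _.
move: st => /andP[s0 st]; congr E; apply/funext => w.
by have := @mean0 a (X w) (t - s) s; rewrite subrKC; apply => //; rewrite subr_ge0.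
Qed.

Lemma E_increment_sqr (X : Om -> R) a (s t : R) : 0 <= s <= t ->
  Lip_upto s X -> (forall w, 0 <= X w) ->
  E (fun w => X w * (w t 0 a - w s 0 a) ^+ 2) <= K * (t - s) * E X.
Proof.
move=> st XL X0; rewrite (@E_indep_ge0 X (fun x => x ^+ 2))//; last exact: ClLip_pow.
move: st => /andP[s0 st]; have ts0 : 0 <= t - s by rewrite subr_ge0.
have := variance a ts0 s0; rewrite subrKC => v.
rewrite -(E_scale HE) ?mulr_ge0//; last by lip.
apply: (E_le HE); try by lip.
by move=> w; rewrite mulrC ler_wpM2r.
Qed.

Lemma E_increment_drift (X : Om -> R) a (s t : R) : 0 <= s <= t ->
  Lip_upto s X -> (forall w, 0 <= X w) ->
  E (fun w => X w * ((w t 0 a - w s 0 a) ^+ 2 - K * (t - s))) <= 0.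
Proof.
move=> st XL X0; rewrite (@E_indep_ge0 X (fun x => x ^+ 2 - K * (t - s)))//; last first.
  by apply: ClLip_fadd; [exact: ClLip_pow|exact: ClLip_cst].
move: st => /andP[s0 st]; have ts0 : 0 <= t - s by rewrite subr_ge0.
have e0 : E (fun w => (w t 0 a - w s 0 a) ^+ 2 - K * (t - s)) <= 0.
  apply: le_trans (E_add HE _ _) _; try by lip.
  by have := variance a ts0 s0; rewrite subrKC (E_cst HE); lra.
rewrite -[leRHS](E_cst HE); apply: (E_le HE); try by lip.
by move=> w; rewrite mulr_ge0_le0.
Qed.

Lemma ito_sum_adapted (s : nat -> R) (c : nat -> Om -> R) a m :
  0 <= s 0%N -> (forall i, (i < m)%N -> s i <= s i.+1) ->
  (forall i, (i < m)%N -> Lip_upto (s i) (c i)) ->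
  Lip_upto (s m) (fun w => \sum_(i < m) c i w * (w (s i.+1) 0 a - w (s i) 0 a)).
Proof.
move=> s0 sS cL; have s_mono i : (i <= m)%N -> 0 <= s i <= s m.
  move=> im; apply/andP; split.
    elim: i im => [//|i IH im]; apply: le_trans (IH (ltnW im)) _; exact: sS.
  have [k km] : exists k, m = (i + k)%N by exists (m - i)%N; rewrite subnKC.
  move: im; rewrite km => _; elim: k km => [|k IH] km; first by rewrite addn0.
  have h j : (i + j < m)%N -> s i <= s (i + j.+1)%N.
    elim: j => [|j IHj] jm; rewrite addnS; first by rewrite addn0 in jm *; exact: sS.
    by apply: le_trans (sS _ jm); apply: IHj; rewrite addnS in jm; exact: ltnW.
  by apply: h; rewrite km addnS.
apply: Lip_upto_sum => i _.
have i1 := s_mono i (ltnW (ltn_ord i)); have i2 := s_mono i.+1 (ltn_ord i).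
apply: Lip_upto_mul; last by lip.
by apply: Lip_upto_mono (cL i (ltn_ord i)); have /andP[] := i1.
Qed.

(** Martingale increments are orthogonal: the cross term in the square of the
   partial sum has zero mean, by independence of the last increment. *)
Lemma ito_sum_L2 (s : nat -> R) (c : nat -> Om -> R) a m :
  0 <= s 0%N -> (forall i, (i < m)%N -> s i <= s i.+1) ->
  (forall i, (i < m)%N -> Lip_upto (s i) (c i)) ->
  E (fun w => (\sum_(i < m) c i w * (w (s i.+1) 0 a - w (s i) 0 a)) ^+ 2) <=
  K * \sum_(i < m) (s i.+1 - s i) * E (fun w => c i w ^+ 2).
Proof.
move=> s0; elim: m => [|m IH] sS cL.
  rewrite big_ord0 mulr0 (_ : (fun w => _) = fun=> 0) ?(E_cst HE)//.
  by apply/funext => w; rewrite big_ord0 expr0n.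
have sS' i : (i < m)%N -> s i <= s i.+1 by move=> im; apply: sS; exact: ltnW.
have cL' i : (i < m)%N -> Lip_upto (s i) (c i) by move=> im; apply: cL; exact: ltnW.
have := IH sS' cL'; have SL := @ito_sum_adapted s c a m s0 sS' cL'.
set S := (fun w => \sum_(i < m) c i w * (w (s i.+1) 0 a - w (s i) 0 a)) in SL * => ES.
have sm : 0 <= s m <= s m.+1.
  rewrite sS// andbT; elim: (m) sS => [//|k IHk] kS; apply: le_trans (IHk _) (kS _ _) => //.
  by move=> i ik; apply: kS; exact: ltnW.
have cmL := cL m (ltnSn m); have [sm1 sm2] := andP sm.
rewrite big_ord_recr /= mulrDr.
have -> : (fun w => (\sum_(i < m.+1) c i w * (w (s i.+1) 0 a - w (s i) 0 a)) ^+ 2) =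
  (fun w => (S w ^+ 2 + c m w ^+ 2 * (w (s m.+1) 0 a - w (s m) 0 a) ^+ 2) +
     2 * S w * c m w * (w (s m.+1) 0 a - w (s m) 0 a)).
  by apply/funext => w; rewrite big_ord_recr /= -/(S w); ring.
apply: le_trans (E_add HE _ _) _; try by lip.
have XL : Lip_upto (s m) (fun w => 2 * S w * c m w) by lip.
have /= -> := E_increment0 a sm XL.
rewrite addr0; apply: le_trans (E_add HE _ _) _; try by lip.
apply: lerD => //; rewrite mulrA.
apply: (@E_increment_sqr (fun w => c m w ^+ 2)) => //; first by lip.
by move=> w; exact: sqr_ge0.
Qed.

(** The excess of the sum of squared increments over [K] times the elapsed time:
   its positive part has small square, because each term has nonpositive
   conditional mean and variance of the order of the squared step. *)
Lemma square_excess_L2 (s : nat -> R) (beta : nat -> bool) a m :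
  0 <= s 0%N -> (forall i, (i < m)%N -> s i <= s i.+1) ->
  E (fun w => Num.max 0 (\sum_(i < m) (beta i)%:R *
      ((w (s i.+1) 0 a - w (s i) 0 a) ^+ 2 - K * (s i.+1 - s i))) ^+ 2) <=
  4 * K ^+ 2 * \sum_(i < m) (s i.+1 - s i) ^+ 2.
Proof.
move=> s0 sS.
pose S m (w : Om) := \sum_(i < m) (beta i)%:R *
  ((w (s i.+1) 0 a - w (s i) 0 a) ^+ 2 - K * (s i.+1 - s i)).
suff [] : Lip_upto (s m) (S m) /\ E (fun w => Num.max 0 (S m w) ^+ 2) <=
  4 * K ^+ 2 * \sum_(i < m) (s i.+1 - s i) ^+ 2 by [].
elim: m sS => [|m IH] sS.
  split; rewrite /S.
    by rewrite (_ : (fun w => _) = fun=> 0); [lip|apply/funext => w; rewrite big_ord0].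
  rewrite big_ord0 mulr0 (_ : (fun w => _) = fun=> 0) ?(E_cst HE)//.
  by apply/funext => w; rewrite big_ord0 maxxx expr0n.
have [|SL ES] := IH; first by move=> i im; apply: sS; exact: ltnW.
have sm : 0 <= s m <= s m.+1.
  rewrite sS// andbT; elim: (m) sS => [//|k IHk] kS; apply: le_trans (IHk _) (kS _ _) => //.
  by move=> i ik; apply: kS; exact: ltnW.
have [sm1 sm2] := andP sm; have sm3 := le_trans sm1 sm2.
pose x (w : Om) := (w (s m.+1) 0 a - w (s m) 0 a) ^+ 2 - K * (s m.+1 - s m).
have SE w : S m.+1 w = S m w + (beta m)%:R * x w by rewrite /S big_ord_recr.
have xL : Lip_upto (s m.+1) x by rewrite /x; lip; rewrite ?sm1 ?sm2 ?sm3 ?lexx.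
have SL' : Lip_upto (s m.+1) (S m) by exact: Lip_upto_mono SL.
split.
  by rewrite (_ : S m.+1 = fun w => S m w + (beta m)%:R * x w); [lip|apply/funext].
rewrite big_ord_recr /= mulrDr.
case: (beta m) SE => SE; last first.
  rewrite (_ : (fun w => _) = (fun w => Num.max 0 (S m w) ^+ 2)).
    by apply: le_trans ES _; rewrite lerDl mulr_ge0// ?sqr_ge0// mulr_ge0// sqr_ge0.
  by apply/funext => w; rewrite SE mul0r addr0.
apply: le_trans (_ : E (fun w => (Num.max 0 (S m w) ^+ 2 +
  2 * Num.max 0 (S m w) * x w) + x w ^+ 2) <= _).
  apply: (E_le HE); try by lip.
  move=> w; rewrite SE mul1r.
  have h0 : 0 <= Num.max 0 (S m w) by rewrite le_max lexx.
  have hS : S m w <= Num.max 0 (S m w) by rewrite le_max lexx orbT.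
  have -> : Num.max 0 (S m w) ^+ 2 + 2 * Num.max 0 (S m w) * x w + x w ^+ 2 =
    (Num.max 0 (S m w) + x w) ^+ 2 by ring.
  have [h|h] := leP 0 (S m w + x w); last by rewrite expr0n sqr_ge0.
  by rewrite ler_sqr ?nnegrE//; lra.
apply: le_trans (E_add HE _ _) _; try by lip.
apply: lerD.
  apply: le_trans (E_add HE _ _) _; try by lip.
  rewrite -[leRHS]addr0; apply: lerD => //.
  apply: (@E_increment_drift (fun w => 2 * Num.max 0 (S m w))) => //; first by lip.
  by move=> w; rewrite mulr_ge0// le_max lexx.
have D0 : 0 <= s m.+1 - s m by rewrite subr_ge0.
apply: le_trans (_ : E (fun w => (w (s m.+1) 0 a - w (s m) 0 a) ^+ 4 +
  (K * (s m.+1 - s m)) ^+ 2) <= _).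
  apply: (E_le HE); try by lip.
  move=> w; rewrite /x; set y := w (s m.+1) 0 a - w (s m) 0 a; set k := K * _.
  have k0 : 0 <= k by rewrite mulr_ge0.
  have : 0 <= y ^+ 2 * k by rewrite mulr_ge0// sqr_ge0.
  have -> : y ^+ 4 = y ^+ 2 * y ^+ 2 by ring.
  by rewrite sqrrB expr2 mulr2n; lra.
apply: le_trans (E_add HE _ _) _; try by lip.
have := fourth a D0 sm1; rewrite subrKC (E_cst HE) => f4.
apply: le_trans (lerD f4 (lexx _)) _.
by rewrite le_eqVlt; apply/orP; left; apply/eqP; ring.
Qed.

End MartingaleEstimates.

(** * The completions of the cylinder variables *)

Section LpCalculus.
Context (R : realType) (d : nat) (G : 'M[R]_d -> R).
Context (E : (C0path R d -> R) -> R) (HE : is_Gexpectation G E).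
Local Notation Om := (C0path R d).
Implicit Types (V W : normedModType R) (Z : nat -> Om -> R).

Lemma cauchy_real_cvg (u : nat -> R) :
  (forall e, 0 < e -> exists n0, forall m n, (n0 <= m)%N -> (n0 <= n)%N ->
    u m <= u n + e) -> cvgn u.
Proof.
move=> uC; apply/cauchy_cvgP/cauchy_exP => e e0.
have e2 : 0 < e / 2 by rewrite divr_gt0.
have [n0 n0P] := uC _ e2; exists (u n0); exists n0 => //= n /= n0n.
have h1 := n0P _ _ (leqnn n0) n0n; have h2 := n0P _ _ n0n (leqnn n0).
by rewrite -ball_normE /= ltr_norml; apply/andP; split; lra.
Qed.

Lemma lim_le_eventually (u : nat -> R) (c e : R) :
  cvgn u -> limn u <= c -> 0 < e -> \forall n \near \oo, u n <= c + e.
Proof.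
move=> cu uc e0; move/cvgrPdist_le: cu => /(_ e e0); apply: filterS => n.
by rewrite ler_norml => /andP[]; lra.
Qed.

Lemma eventually_lim_le (u : nat -> R) (c : R) :
  cvgn u -> (forall e, 0 < e -> \forall n \near \oo, u n <= c + e) -> limn u <= c.
Proof.
by move=> cu uc; apply/ler_addgt0Pr => e e0; apply: limr_le => //; exact: uc.
Qed.

Lemma E_pow_cauchy_add V p (X Y : nat -> Om -> V) :
  (forall n, Lip (X n)) -> (forall n, Lip (Y n)) ->
  LG_cauchy E p X -> LG_cauchy E p Y -> LG_cauchy E p (fun n w => X n w + Y n w).
Proof.
move=> XL YL XC YC e e0.
have p0 : 0 < 2 ^+ p.+1 :> R by rewrite exprn_gt0.
have e1 : 0 < e / 2 ^+ p.+1 by rewrite divr_gt0.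
have [nX nXP] := XC _ e1; have [nY nYP] := YC _ e1.
exists (maxn nX nY) => m n; rewrite !geq_max => /andP[mX mY] /andP[kX kY].
apply: le_lt_trans (_ : 2 ^+ p * E (fun w => `|X m w - X n w| ^+ p) +
  2 ^+ p * E (fun w => `|Y m w - Y n w| ^+ p) < _); last first.
  have := nXP _ _ mX kX; have := nYP _ _ mY kY.
  rewrite !ltr_pdivlMr// exprS !mulrA; set a := E _; set b := E _; lra.
apply: (E_dom2 HE); rewrite ?exprn_ge0//; try by lip.
move=> w; rewrite -mulrDr.
set x := `|X m w - X n w|; set y := `|Y m w - Y n w|.
have x0 : 0 <= x by exact: normr_ge0.
have y0 : 0 <= y by exact: normr_ge0.
have -> : X m w + Y m w - (X n w + Y n w) = (X m w - X n w) + (Y m w - Y n w).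
  by rewrite opprD addrACA.
apply: le_trans (_ : (2 * Num.max x y) ^+ p <= _).
  apply: lerXn2r; rewrite ?nnegrE// ?mulr_ge0// ?le_max ?x0//.
  apply: le_trans (ler_normD _ _) _; rewrite -/x -/y.
  have : x <= Num.max x y by rewrite le_max lexx.
  have : y <= Num.max x y by rewrite le_max lexx orbT.
  lra.
rewrite exprMn ler_wpM2l ?exprn_ge0//.
by have [_|_] := leP x y; rewrite ?lerDl ?lerDr exprn_ge0.
Qed.

Lemma LG_cauchy_dom V W p (c : R) (X : nat -> Om -> V) (Y : nat -> Om -> W) :
  0 <= c -> (forall n, Lip (X n)) -> (forall n, Lip (Y n)) ->
  (forall m n w, `|Y m w - Y n w| <= c * `|X m w - X n w|) ->
  LG_cauchy E p X -> LG_cauchy E p Y.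
Proof.
move=> c0 XL YL YX XC e e0.
have cp0 : 0 <= c ^+ p by rewrite exprn_ge0.
have cp : 0 < c ^+ p + 1 by rewrite ltr_wpDl.
have e1 : 0 < e / (c ^+ p + 1) by rewrite divr_gt0.
have [n0 n0P] := XC _ e1; exists n0 => m n mn0 nn0.
apply: le_lt_trans (_ : (c ^+ p + 1) * E (fun w => `|X m w - X n w| ^+ p) < _).
  apply: (E_dom1 HE); rewrite ?ltW//; try by lip.
  move=> w; apply: le_trans (_ : c ^+ p * `|X m w - X n w| ^+ p <= _).
    by rewrite -exprMn; apply: lerXn2r; rewrite ?nnegrE ?mulr_ge0//.
  by rewrite ler_wpM2r ?exprn_ge0// lerDl.
by rewrite mulrC -ltr_pdivlMr//; exact: n0P.
Qed.

Lemma LG_cauchy_cst V p (x : Om -> V) : (0 < p)%N -> LG_cauchy E p (fun=> x).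
Proof.
move=> p0 e e0; exists 0%N => m n _ _.
rewrite (_ : (fun w => _) = fun=> 0) ?(E_cst HE)//.
by apply/funext => w; rewrite subrr normr0 expr0n gtn_eqF.
Qed.

Lemma LG_cauchy21 V (X : nat -> Om -> V) : (forall n, Lip (X n)) ->
  LG_cauchy E 2 X -> LG_cauchy E 1 X.
Proof.
move=> XL XC e e0; have e4 : 0 < e / 4 by rewrite divr_gt0.
have e1 : 0 < (e / 4) ^+ 2 by rewrite exprn_gt0.
have [n0 n0P] := XC _ e1; exists n0 => m n mn0 nn0.
have h := n0P m n mn0 nn0.
have := @E_abs_le_sqr R d G E HE (fun w => `|X m w - X n w|) (e / 4) e4 (ltac:(by lip)).
rewrite (_ : (fun w => `| `|X m w - X n w| |) = (fun w => `|X m w - X n w| ^+ 1)); last first.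
  by apply/funext => w; rewrite normr_id expr1.
move=> /le_lt_trans; apply.
have : (e / 4)^-1 * E (fun w => `|X m w - X n w| ^+ 2) <= e / 4.
  by rewrite ler_pdivrMl// -expr2 ltW.
lra.
Qed.

Lemma LG_upto_Lip V p t (X : nat -> Om -> V) n : LG_upto E p t X -> Lip (X n).
Proof. by move=> [XL _]; exact: Lip_upto_Lip (XL n). Qed.

Lemma LG_upto_LG V p t (X : nat -> Om -> V) : LG_upto E p t X -> LG E p X.
Proof. by move=> [XL XC]; split=> // n; exact: Lip_upto_Lip (XL n). Qed.

Lemma LG_upto21 V t (X : nat -> Om -> V) : LG_upto E 2 t X -> LG_upto E 1 t X.
Proof.
move=> [XL XC]; split=> //; apply: LG_cauchy21 => // n.
exact: Lip_upto_Lip (XL n).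
Qed.

Lemma LG_upto_add V p t (X Y : nat -> Om -> V) : LG_upto E p t X -> LG_upto E p t Y ->
  LG_upto E p t (fun n w => X n w + Y n w).
Proof.
move=> XG YG; split=> [n|].
  by apply: Lip_upto_add; [exact: XG.1|exact: YG.1].
apply: E_pow_cauchy_add; try exact: XG.2; try exact: YG.2.
  by move=> n; exact: LG_upto_Lip XG.
by move=> n; exact: LG_upto_Lip YG.
Qed.

Lemma LG_add V p (X Y : nat -> Om -> V) : LG E p X -> LG E p Y ->
  LG E p (fun n w => X n w + Y n w).
Proof.
move=> [XL XC] [YL YC]; split=> [n|]; first by lip.
exact: E_pow_cauchy_add.
Qed.

Lemma LG_upto_lipschitz V p t (X : nat -> Om -> V) (phi : V -> R) (c : R) :
  0 <= c -> (forall x y, `|phi x - phi y| <= c * `|x - y|) ->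
  LG_upto E p t X -> LG_upto E p t (fun n w => phi (X n w)).
Proof.
move=> c0 phiP XG; have phiL := ClLip_lipschitz phiP.
split=> [n|]; first by apply: Lip_upto_comp => //; exact: XG.1.
have XL n := LG_upto_Lip n XG.
apply: (@LG_cauchy_dom _ _ p c X) => // [n|].
  exact: Lip_comp.
exact: XG.2.
Qed.

Lemma LG_upto_scale p t (c : R) Z : LG_upto E p t Z -> LG_upto E p t (fun n w => c * Z n w).
Proof.
by apply: (@LG_upto_lipschitz _ _ _ _ ( *%R c) `|c|) => // x y; rewrite -mulrBr normrM.
Qed.

Lemma LG_lipschitz V p (X : nat -> Om -> V) (phi : V -> R) (c : R) :
  0 <= c -> (forall x y, `|phi x - phi y| <= c * `|x - y|) ->
  LG E p X -> LG E p (fun n w => phi (X n w)).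
Proof.
move=> c0 phiP [XL XC]; have phiL := ClLip_lipschitz phiP.
by split=> [n|]; [exact: Lip_comp|apply: (@LG_cauchy_dom _ _ p c X) => // n; exact: Lip_comp].
Qed.

Lemma LG_scale p (c : R) Z : LG E p Z -> LG E p (fun n w => c * Z n w).
Proof.
by apply: (@LG_lipschitz _ _ _ ( *%R c) `|c|) => // x y; rewrite -mulrBr normrM.
Qed.

Lemma LG_sub p Z Y : LG E p Z -> LG E p Y -> LG E p (fun n w => Z n w - Y n w).
Proof.
move=> ZG YG; rewrite (_ : (fun n w => _) = (fun n w => Z n w + -1 * Y n w)).
  by apply: LG_add => //; exact: LG_scale.
by apply/funext => n; apply/funext => w; rewrite mulN1r.
Qed.

Lemma LG_sum p (I : Type) (r : seq I) (P : pred I) (Z : I -> nat -> Om -> R) :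
  (0 < p)%N -> (forall i, P i -> LG E p (Z i)) ->
  LG E p (fun n w => \sum_(i <- r | P i) Z i n w).
Proof.
move=> p0 ZG; elim: r => [|i r IH].
  rewrite (_ : (fun n w => _) = fun _ _ => 0).
    by split=> [n|]; [lip|exact: LG_cauchy_cst].
  by apply/funext => n; apply/funext => w; rewrite big_nil.
rewrite (_ : (fun n w => _) = (fun n w => (if P i then Z i n w else 0) +
  \sum_(j <- r | P j) Z j n w)).
  apply: LG_add => //; case: (P i) (ZG i) => [/(_ isT)//|_].
  by split=> [n|]; [lip|exact: LG_cauchy_cst].
by apply/funext => n; apply/funext => w; rewrite big_cons; case: (P i); rewrite ?add0r.
Qed.

Lemma E_abs_cvg Z : LG E 1 Z -> cvgn (fun n => E (fun w => `|Z n w| ^+ 1)).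
Proof.
move=> [ZL ZC]; apply: cauchy_real_cvg => e /ZC[n0 n0P]; exists n0 => m n mn0 nn0.
apply: le_trans (_ : E (fun w => `|Z n w| ^+ 1) + E (fun w => `|Z m w - Z n w| ^+ 1) <= _).
  apply: le_trans (E_add HE _ _); try by lip.
  apply: (E_le HE); try by lip.
  move=> w; rewrite !expr1 -{1}(subrK (Z n w) (Z m w)) addrC.
  exact: ler_normD.
by rewrite lerD2l ltW// n0P.
Qed.

(** Without a triangle inequality for the square mean, the sequence is compared
   with itself through [u_m <= (1 + l) u_n + (1 + l^-1) err] for a small [l]. *)
Lemma E_sum_sqr_cvg (I : finType) (Z : I -> nat -> Om -> R) :
  (forall i, LG E 2 (Z i)) -> cvgn (fun n => E (fun w => \sum_i Z i n w ^+ 2)).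
Proof.
move=> ZG; have ZL i n : Lip (Z i n) by exact: (ZG i).1.
set u := fun n => _.
have u0 n : 0 <= u n.
  by apply: (E_ge0 HE); [lip|move=> w; apply: sumr_ge0 => i _; exact: sqr_ge0].
have diff (l : R) m n : 0 < l -> u m <= (1 + l) * u n +
    (1 + l^-1) * E (fun w => \sum_i (Z i m w - Z i n w) ^+ 2).
  move=> l0; have li : 0 < l^-1 by rewrite invr_gt0.
  apply: (E_dom2 HE); try by lip.
  - by lra.
  - by lra.
  - move=> w; rewrite !mulr_sumr -big_split /=; apply: ler_sum => i _.
    set x := Z i m w; set y := Z i n w; rewrite -subr_ge0.
    have -> : (1 + l) * y ^+ 2 + (1 + l^-1) * (x - y) ^+ 2 - x ^+ 2 =
      l * (y - l^-1 * (x - y)) ^+ 2 by field; rewrite gt_eqF.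
    by rewrite mulr_ge0 ?sqr_ge0// ltW.
have small (e : R) : 0 < e -> exists n0, forall m n, (n0 <= m)%N -> (n0 <= n)%N ->
    E (fun w => \sum_i (Z i m w - Z i n w) ^+ 2) <= e.
  move=> e0; have c0 : 0 < #|I|%:R + 1 :> R by rewrite ltr_wpDl.
  have e1 : 0 < e / (#|I|%:R + 1) by rewrite divr_gt0.
  have /choice[N NP] : forall i, exists n0, forall m n, (n0 <= m)%N -> (n0 <= n)%N ->
      E (fun w => `|Z i m w - Z i n w| ^+ 2) < e / (#|I|%:R + 1).
    by move=> i; exact: (ZG i).2.
  exists (\max_i N i) => m n /bigmax_leqP mN /bigmax_leqP nN.
  have ZZL i : true -> Lip (fun w => (Z i m w - Z i n w) ^+ 2) by move=> _; lip.
  apply: le_trans (@E_sum _ _ _ _ HE _ (index_enum I) _ _ ZZL) _.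
  apply: le_trans (_ : \sum_(i : I) e / (#|I|%:R + 1) <= _).
    apply: ler_sum => i _; apply: ltW; have := NP i m n (mN i isT) (nN i isT).
    by congr (E _ < _); apply/funext => w; rewrite real_normK ?num_real.
  by rewrite sumr_const -[X in X <= _]mulr_natr mulrAC ler_pdivrMr// ler_wpM2l ?lerDl// ltW.
have [n1 n1P] := small 1 ltr01.
pose M := 2 * u n1 + 3.
have uM n : (n1 <= n)%N -> u n <= M.
  move=> nn1; apply: le_trans (diff 1 n n1 ltr01) _; rewrite invr1 /M.
  by have := n1P n n1 nn1 (leqnn _); lra.
have M0 : 0 < M by rewrite /M; have := u0 n1; lra.
apply: cauchy_real_cvg => e e0.
pose l := e / (2 * M); have l0 : 0 < l by rewrite divr_gt0// mulr_gt0.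
have li : 0 < 1 + l^-1 by rewrite addr_gt0// invr_gt0.
have e2 : 0 < e / 2 / (1 + l^-1) by rewrite !divr_gt0.
have [n2 n2P] := small _ e2.
exists (maxn n1 n2) => m n; rewrite !geq_max => /andP[m1 m2] /andP[k1 k2].
apply: le_trans (diff l m n l0) _; have := n2P m n m2 k2.
rewrite ler_pdivlMr// mulrC => h.
have : l * u n <= e / 2.
  have -> : e / 2 = l * M by rewrite /l; field; rewrite gt_eqF.
  by rewrite ler_wpM2l ?uM// ltW.
lra.
Qed.

Lemma E_sqr_cvg Z : LG E 2 Z -> cvgn (fun n => E (fun w => `|Z n w| ^+ 2)).
Proof.
move=> ZG.
rewrite (_ : (fun n => _) = (fun n => E (fun w => \sum_(i : unit) Z n w ^+ 2))).
  exact: (@E_sum_sqr_cvg unit (fun _ => Z) (fun _ => ZG)).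
apply/funext => n; congr E; apply/funext => w.
by rewrite (big_pred1 tt) ?real_normK ?num_real// => -[].
Qed.

Lemma E_pow_cvg p Z : (1 <= p <= 2)%N -> LG E p Z ->
  cvgn (fun n => E (fun w => `|Z n w| ^+ p)).
Proof. by case: p => [|[|[|p]]]// _; [exact: E_abs_cvg|exact: E_sqr_cvg]. Qed.

Lemma E_pow_ge0 p (z : Om -> R) : Lip z -> 0 <= E (fun w => `|z w| ^+ p).
Proof. by move=> zL; apply: (E_ge0 HE); [lip|move=> w; exact: exprn_ge0]. Qed.

Lemma LG_eq_near p (Z Y : nat -> Om -> R) (e : R) : LG_eq E p Z Y -> 0 < e ->
  \forall n \near \oo, E (fun w => `|Z n w - Y n w| ^+ p) <= e.
Proof.
move=> /cvgrPdist_le ZY e0; apply: filterS (ZY e e0) => n; rewrite sub0r normrN.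
exact: le_trans (ler_norm _).
Qed.

Lemma LG_cvg_near p (Zs : nat -> nat -> Om -> R) Z (e : R) : (1 <= p <= 2)%N ->
  (forall k, LG E p (Zs k)) -> LG E p Z -> LG_cvg E p Zs Z -> 0 < e ->
  \forall k \near \oo, \forall n \near \oo, E (fun w => `|Zs k n w - Z n w| ^+ p) <= e.
Proof.
move=> p12 ZsG ZG /cvgrPdist_le ZZ e0; have e2 : 0 < e / 2 by rewrite divr_gt0.
apply: filterS (ZZ _ e2) => k; rewrite sub0r normrN => /(le_trans (ler_norm _)) h.
have := lim_le_eventually (E_pow_cvg p12 (LG_sub (ZsG k) ZG)) h e2.
by apply: filterS => n; rewrite -splitr.
Qed.

Lemma LG1_mul (y : Om -> R) Z : Lip y -> LG E 2 Z -> LG E 1 (fun n w => y w * Z n w).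
Proof.
move=> yL [ZL ZC]; split=> [n|]; first by lip.
move=> e e0; have yy0 : 0 <= E (fun w => y w ^+ 2).
  by apply: (E_ge0 HE); [lip|move=> w; exact: sqr_ge0].
pose l := e / (2 * E (fun w => y w ^+ 2) + 2).
have l0 : 0 < l by rewrite divr_gt0//; lra.
have e1 : 0 < e / 2 * l by rewrite mulr_gt0// divr_gt0.
have [n0 n0P] := ZC _ e1; exists n0 => m n mn0 nn0.
have dL : Lip (fun w => Z m w - Z n w) by lip.
have -> : (fun w => `|y w * Z m w - y w * Z n w| ^+ 1) =
    (fun w => `|y w| * `|Z m w - Z n w|).
  by apply/funext => w; rewrite expr1 -mulrBr normrM.
apply: le_lt_trans (E_mul_le HE l0 yL dL) _.
have : l^-1 * E (fun w => (Z m w - Z n w) ^+ 2) < e / 2.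
  by rewrite -(E_norm_sqr E) ltr_pdivrMl// mulrC; exact: n0P.
have : l * E (fun w => y w ^+ 2) <= e / 2.
  have -> : e / 2 = l * (E (fun w => y w ^+ 2) + 1) by rewrite /l; field; rewrite gt_eqF//; lra.
  by rewrite ler_wpM2l// ?lerDl// ltW.
lra.
Qed.

Lemma LG_mul_near (Y D P : nat -> Om -> R) (e : R) : (forall m, Lip (Y m)) -> LG E 2 D ->
  LG_mul E Y D P -> 0 < e ->
  \forall m \near \oo, \forall n \near \oo, E (fun w => `|Y m w * D n w - P n w|) <= e.
Proof.
move=> YL DG [PG YDP] e0; apply: (@LG_cvg_near 1 (fun m n w => Y m w * D n w)) => // m.
exact: LG1_mul.
Qed.

End LpCalculus.

(** * Weak bounds on the square mean *)

Section WeakSquareBound.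
Context (R : realType) (d : nat) (G : 'M[R]_d -> R).
Context (E : (C0path R d -> R) -> R) (HE : is_Gexpectation G E).
Local Notation Om := (C0path R d).
Implicit Types (Z Y : nat -> Om -> R).

(** A part of small mean is exempt from the bound on the square mean. *)
Definition L2_close (c e : R) (z : Om -> R) := exists u v : Om -> R,
  [/\ Lip u, Lip v, forall w, `|z w| <= `|u w| + `|v w|,
      E (fun w => u w ^+ 2) <= c + e & E (fun w => `|v w|) <= e].

(** A bound on the square mean that makes sense for, and is stable under limits
   of, elements of [L^1]: integrals against the cross variation and the equations
   themselves are only known as limits in [L^1]. *)
Definition weakL2 (c : R) Z := forall e, 0 < e -> \forall n \near \oo, L2_close c e (Z n).

(** The defect of the inequality is half the double sum of
   [m_i m_j (x_i - x_j)^2]. *)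
Lemma sqr_sum_weighted (I : finType) (m x : I -> R) : (forall i, 0 <= m i) ->
  (\sum_i m i * x i) ^+ 2 <= (\sum_i m i) * \sum_i m i * x i ^+ 2.
Proof.
move=> m0; have : 0 <= \sum_i \sum_j m i * m j * (x i - x j) ^+ 2.
  by apply: sumr_ge0 => i _; apply: sumr_ge0 => j _; rewrite mulr_ge0 ?sqr_ge0// mulr_ge0.
have -> : \sum_i \sum_j m i * m j * (x i - x j) ^+ 2 =
    2 * ((\sum_i m i) * \sum_i m i * x i ^+ 2 - (\sum_i m i * x i) ^+ 2); last by lra.
have -> : (\sum_i m i) * (\sum_i m i * x i ^+ 2) = \sum_i \sum_j m i * (m j * x j ^+ 2).
  by rewrite mulr_suml; apply: eq_bigr => i _; rewrite mulr_sumr.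
have -> : (\sum_i m i * x i) ^+ 2 = \sum_i \sum_j (m i * x i) * (m j * x j).
  by rewrite expr2 mulr_suml; apply: eq_bigr => i _; rewrite mulr_sumr.
have swap : \sum_i \sum_j m i * (m j * x j ^+ 2) = \sum_i \sum_j m j * (m i * x i ^+ 2).
  by rewrite exchange_big.
rewrite mulrBr mulr_natl mulr2n {2}swap -mulNr mulr_sumr -!big_split /=.
apply: eq_bigr => i _.
by rewrite mulr_sumr -!big_split /=; apply: eq_bigr => j _; ring.
Qed.

Lemma sqr_sum_le (I : finType) (x : I -> R) :
  (\sum_i x i) ^+ 2 <= #|I|%:R * \sum_i x i ^+ 2.
Proof.
have := @sqr_sum_weighted I (fun=> 1) x (fun=> ler01).
rewrite sumr_const; under eq_bigr do rewrite mul1r.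
by under [X in _ * X]eq_bigr do rewrite mul1r.
Qed.

Lemma L2_close_sqr c e (z : Om -> R) : 0 <= e -> Lip z -> E (fun w => z w ^+ 2) <= c + e ->
  L2_close c e z.
Proof.
move=> e0 zL zc; exists z, (fun=> 0); split=> //; first by lip.
  by move=> w; rewrite normr0 addr0.
by under eq_fun do rewrite normr0; rewrite (E_cst HE).
Qed.

Lemma L2_close_sum (I : finType) (c : I -> R) e (z : I -> Om -> R) : 0 <= e ->
  (forall i, L2_close (c i) e (z i)) ->
  L2_close (#|I|%:R * \sum_i c i) ((#|I|%:R + 1) ^+ 2 * e) (fun w => \sum_i z i w).
Proof.
move=> e0 zc.
have n0 : 0 <= #|I|%:R :> R by []. set n := (#|I|%:R : R) in n0 *.
have /choice[u uP] := zc; have /choice[v vP] := uP.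
have uL i : Lip (u i) by have [] := vP i.
have vL i : Lip (v i) by have [] := vP i.
exists (fun w => \sum_i `|u i w|), (fun w => \sum_i `|v i w|); split; try by lip.
- move=> w; rewrite [X in _ <= X + _]ger0_norm ?sumr_ge0//.
  rewrite [X in _ <= _ + X]ger0_norm ?sumr_ge0// -big_split /=.
  apply: le_trans (ler_norm_sum _ _ _) _; apply: ler_sum => i _.
  by have [] := vP i.
- have ssL : Lip (fun w => \sum_i u i w ^+ 2) by lip.
  apply: le_trans (_ : n * E (fun w => \sum_i u i w ^+ 2) <= _).
    apply: (E_dom1 HE) => //; first by lip.
    move=> w; apply: le_trans (sqr_sum_le _) _; rewrite ler_wpM2l//.
    by apply: ler_sum => i _; rewrite real_normK ?num_real.
  have uuL i : true -> Lip (fun w => u i w ^+ 2) by move=> _; lip.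
  have := @E_sum _ _ _ _ HE _ (index_enum I) _ _ uuL => h.
  have : \sum_i E (fun w => u i w ^+ 2) <= \sum_i (c i + e).
    by apply: ler_sum => i _; have [] := vP i.
  rewrite big_split /= sumr_const -[e *+ _]mulr_natr -/n => h2.
  apply: le_trans (ler_wpM2l n0 (le_trans h h2)) _.
  rewrite mulrDr lerD2l mulrA [leLHS](_ : _ = n ^+ 2 * e); last by ring.
  by rewrite ler_wpM2r// lerXn2r ?nnegrE//; lra.
- have vvL i : true -> Lip (fun w => `|v i w|) by move=> _; lip.
  have := @E_sum _ _ _ _ HE _ (index_enum I) _ _ vvL => h.
  under eq_fun do rewrite ger0_norm ?sumr_ge0//.
  apply: le_trans h _; apply: le_trans (_ : \sum_(i : I) e <= _).
    by apply: ler_sum => i _; have [] := vP i.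
  rewrite sumr_const -[X in X <= _]mulr_natr mulrC -/n ler_wpM2r//.
  by rewrite expr2; nra.
Qed.

Lemma weakL2_sum (I : finType) (c : I -> R) (Z : I -> nat -> Om -> R) :
  (forall i, weakL2 (c i) (Z i)) ->
  weakL2 (#|I|%:R * \sum_i c i) (fun n w => \sum_i Z i n w).
Proof.
move=> Zc e e0; have n0 : 0 < (#|I|%:R + 1) ^+ 2 :> R by rewrite exprn_gt0// ltr_wpDl.
pose e1 := e / (#|I|%:R + 1) ^+ 2.
have e10 : 0 < e1 by rewrite divr_gt0.
have : \forall n \near \oo, forall i, L2_close (c i) e1 (Z i n).
  by apply: filter_forall => i; exact: Zc.
apply: filterS => n /(L2_close_sum (ltW e10)).
by rewrite [X in L2_close _ X _]mulrC divfK// gt_eqF.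
Qed.

(** The error of the approximation joins the part that is small in mean. *)
Lemma weakL2_lim c Z : (forall n, Lip (Z n)) ->
  (forall e, 0 < e -> exists2 Y : nat -> Om -> R, forall n, Lip (Y n) &
    \forall n \near \oo, L2_close c e (Y n) /\ E (fun w => `|Z n w - Y n w|) <= e) ->
  weakL2 c Z.
Proof.
move=> ZL ZY e e0; have e2 : 0 < e / 2 by rewrite divr_gt0.
have [Y YL] := ZY _ e2; apply: filterS => n [[u [v [uL vL zuv uc ve]]] ZYe].
exists u, (fun w => `|v w| + `|Z n w - Y n w|); split; try by lip.
- move=> w; rewrite [X in _ + X]ger0_norm ?addr_ge0//.
  by have := ler_normD (Z n w - Y n w) (Y n w); rewrite subrK; have := zuv w; lra.
- by lra.
- under eq_fun do rewrite ger0_norm ?addr_ge0//.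
  by apply: le_trans (E_add HE _ _) _; try lip; lra.
Qed.

(** Fatou property: for elements of [L^2] the weak bound is a genuine one. A
   member of the Cauchy sequence far enough is a fixed variable with all
   moments; truncating it at a high level makes the part bounded in [L^1]
   negligible. *)
Lemma weakL2_fatou c Z : 0 <= c -> LG E 2 Z -> weakL2 c Z ->
  forall e, 0 < e -> \forall n \near \oo, E (fun w => Z n w ^+ 2) <= 4 * c + e.
Proof.
move=> c0 [ZL ZC] Zc e e0; have e24 : 0 < e / 24 by rewrite divr_gt0.
have [m0 m0P] := ZC _ e24; pose z := Z m0; have zL : Lip z by exact: ZL.
have close n : (m0 <= n)%N -> E (fun w => (z w - Z n w) ^+ 2) <= e / 24.
  move=> nm0; apply: ltW; have := m0P _ _ (leqnn m0) nm0.
  by congr (E _ < _); apply/funext => w; rewrite real_normK ?num_real.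
pose A := E (fun w => `|z w| ^+ 3).
have A0 : 0 <= A by apply: (E_pow_ge0 HE).
pose rho := 48 * A / e + 1; have rho1 : 1 <= rho by rewrite lerDr divr_ge0 ?mulr_ge0// ltW.
have rho0 : 0 < rho by lra.
have e'0 : 0 < e / (24 * rho) by rewrite divr_gt0// mulr_gt0.
have rhoA : A / rho <= e / 48.
  rewrite ler_pdivrMr// mulrDr mulr1 [X in X + _](_ : _ = A); last by field; rewrite gt_eqF.
  by rewrite lerDl divr_ge0// ltW.
have e'e : e / (24 * rho) <= e / 24.
  by rewrite ler_pM2l// lef_pV2 ?posrE ?mulr_gt0//; lra.
have Ez : E (fun w => z w ^+ 2) <= 2 * c + 14 / 48 * e.
  have : \forall n \near \oo, L2_close c (e / (24 * rho)) (Z n) /\ (m0 <= n)%N.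
    by apply: filterS2 (Zc _ e'0) (nbhs_infty_ge m0).
  move=> /(@filter_ex _ _ (eventually_filter))[n [[u [v [uL vL zuv uc ve]]] nm0]].
  pose y w := z w - Z n w; have yL : Lip y by lip.
  apply: le_trans (_ : 1 * E (fun w => 2 / rho * `|z w| ^+ 3 +
      (2 * u w ^+ 2 + 2 * y w ^+ 2)) + 2 * rho * E (fun w => `|v w|) <= _).
    apply: (E_dom2 HE) => //; try by lip.
      by rewrite mulr_ge0// ltW.
    move=> w; rewrite mul1r; set x := `|z w|.
    have x0 : 0 <= x by exact: normr_ge0.
    have -> : z w ^+ 2 = x ^+ 2 by rewrite real_normK ?num_real.
    have hx : x <= `|y w| + `|u w| + `|v w|.
      rewrite -addrA; apply: le_trans (lerD (lexx _) (zuv w)).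
      by have := ler_normD (z w - Z n w) (Z n w); rewrite subrK.
    have v0 := normr_ge0 (v w); have yu0 : 0 <= `|y w| + `|u w| by rewrite addr_ge0.
    have hyu : (`|y w| + `|u w|) ^+ 2 <= 2 * u w ^+ 2 + 2 * y w ^+ 2.
      rewrite -(@real_normK _ (u w)) ?num_real// -(@real_normK _ (y w)) ?num_real//.
      rewrite -subr_ge0 (_ : _ - _ = (`|y w| - `|u w|) ^+ 2) ?sqr_ge0//; ring.
    have x3 : 0 <= 2 / rho * x ^+ 3 by rewrite mulr_ge0 ?exprn_ge0// divr_ge0// ltW.
    have rv : 0 <= rho * `|v w| by rewrite mulr_ge0// ltW.
    have [xr|xr] := leP x rho.
      have : x * x <= x * (`|y w| + `|u w| + `|v w|) by rewrite ler_wpM2l.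
      have : x * `|v w| <= rho * `|v w| by rewrite ler_wpM2r.
      have : 0 <= x ^+ 2 + (`|y w| + `|u w|) ^+ 2 - 2 * (x * (`|y w| + `|u w|)).
        rewrite (_ : _ - _ = (x - (`|y w| + `|u w|)) ^+ 2) ?sqr_ge0//; ring.
      have -> : x * (`|y w| + `|u w| + `|v w|) = x * (`|y w| + `|u w|) + x * `|v w| by ring.
      move: hyu rv x3; set q2 := (_ + _) ^+ 2; set xq := x * (_ + _).
      rewrite -[x * x]/(x ^+ 2); lra.
    have : x ^+ 2 <= 2 / rho * x ^+ 3.
      rewrite exprS mulrA ler_peMl ?sqr_ge0//.
      by rewrite mulrAC ler_pdivlMr//; lra.
    have : 0 <= (`|y w| + `|u w|) ^+ 2 by exact: sqr_ge0.
    by lra.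
  rewrite mul1r.
  have h1 : E (fun w => 2 / rho * `|z w| ^+ 3 + (2 * u w ^+ 2 + 2 * y w ^+ 2)) <=
     2 / rho * A + (2 * (c + e / (24 * rho)) + 2 * (e / 24)).
    apply: le_trans (E_add HE _ _) _; try by lip.
    apply: lerD; first by rewrite (E_scale HE)//; [rewrite divr_ge0// ltW|lip].
    apply: le_trans (E_add HE _ _) _; try by lip.
    by rewrite !(E_scale HE)//; try lip; rewrite lerD// ler_wpM2l// close.
  have h2 : 2 * rho * E (fun w => `|v w|) <= e / 12.
    apply: le_trans (ler_wpM2l _ ve) _; first by rewrite mulr_ge0// ltW.
    by rewrite le_eqVlt; apply/orP; left; apply/eqP; field; rewrite gt_eqF.
  have h3 : 2 / rho * A <= e / 24 by rewrite mulrAC -mulrA; lra.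
  lra.
near=> n; have nm0 : (m0 <= n)%N by near: n; exact: nbhs_infty_ge.
apply: le_trans (_ : 2 * E (fun w => z w ^+ 2) + 2 * E (fun w => (z w - Z n w) ^+ 2) <= _).
  apply: (E_dom2 HE) => //; try by lip.
  move=> w; have := sqr_ge0 (z w + (z w - Z n w)).
  by rewrite !expr2; lra.
have := close n nm0; lra.
Unshelve. all: by end_near. Qed.

End WeakSquareBound.

(** * Grids *)

Section Grids.
Context (R : realType).
Implicit Types (s u : nat -> R) (f : R -> R).

Definition is_grid s m := forall i, (i < m)%N -> s i < s i.+1.
Definition on_grid s m (x : R) := exists2 j, (j <= m)%N & x = s j.

Lemma grid_exists (l : seq R) (a : R) : a \in l -> exists s m,
  [/\ is_grid s m, forall x, x \in l -> on_grid s m x &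
      forall j, (j <= m)%N -> s j \in l].
Proof.
move=> al; pose t := sort <=%O (undup l).
have ts : sorted <%O t by rewrite sort_lt_sorted undup_uniq.
have tl x : (x \in t) = (x \in l) by rewrite mem_sort mem_undup.
have t0 : (0 < size t)%N by move: al; rewrite -tl; case: (t).
have lt_size j : (j <= (size t).-1)%N = (j < size t)%N by rewrite -ltnS prednK.
exists (nth a t), (size t).-1; split.
- move=> i im; rewrite (lt_sorted_ltn_nth a ts) ?inE ?ltnS//.
    by apply: ltn_trans im _; rewrite -lt_size.
  by rewrite -lt_size.
- move=> x; rewrite -tl => xt; exists (index x t); last by rewrite nth_index.
  by rewrite lt_size index_mem.
- by move=> j; rewrite lt_size => jt; rewrite -tl mem_nth.
Qed.

Lemma grid_lt s m i j : is_grid s m -> (i < j <= m)%N -> s i < s j.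
Proof.
move=> sS /andP[ij jm]; elim: j ij jm => // j IH; rewrite ltnS leq_eqVlt.
move=> /predU1P[->|ij] jm; first exact: sS.
exact: lt_trans (IH ij (ltnW jm)) (sS _ jm).
Qed.

Lemma grid_le s m i j : is_grid s m -> (i <= j <= m)%N -> s i <= s j.
Proof.
move=> sS /andP[]; rewrite leq_eqVlt => /predU1P[->//|ij] jm.
by apply/ltW/(grid_lt sS); rewrite ij.
Qed.

Lemma grid_next s m i x : is_grid s m -> (i < m)%N -> on_grid s m x ->
  s i < x -> s i.+1 <= x.
Proof.
move=> sS im [j jm ->] sij; apply: (grid_le sS); rewrite jm andbT.
rewrite ltnNge; apply/negP => ji; move: sij; apply/negP; rewrite -leNgt.
by apply: (grid_le sS); rewrite ji ltnW.
Qed.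

Lemma grid_telescope s m (a b : R) f : is_grid s m -> on_grid s m a -> on_grid s m b ->
  a <= b ->
  \sum_(i < m) (a <= s i < b)%R%:R * (f (s i.+1) - f (s i)) = f b - f a.
Proof.
move=> sS aG bG ab; pose F x := f (Num.min b (Num.max a x)).
transitivity (\sum_(0 <= i < m) (F (s i.+1) - F (s i))).
  rewrite big_mkord; apply: eq_bigr => i _; rewrite /F.
  have sii := sS i (ltn_ord i).
  have [sia|ais] := ltP (s i) a; rewrite /= ?mul0r.
    have h := grid_next sS (ltn_ord i) aG sia.
    by rewrite !max_l ?subrr// ltW.
  have [sib|bis] := ltP (s i) b; rewrite /= ?mul0r ?mul1r.
    have h := grid_next sS (ltn_ord i) bG sib.
    by rewrite !max_r ?(le_trans ais (ltW sii))// !min_r// ltW.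
  have h := le_trans bis (ltW sii).
  by rewrite !max_r ?(le_trans ab)// !min_l// subrr.
rewrite telescope_sumr// /F; have [j jm aE] := aG; have [k km bE] := bG.
have s0a : s 0%N <= a by rewrite aE; apply: (grid_le sS).
have bsm : b <= s m by rewrite bE; apply: (grid_le sS); rewrite km leqnn.
by rewrite (max_r (le_trans ab bsm)) (min_l bsm) (max_l s0a) (min_r ab).
Qed.

Definition step_fun u n (x : nat -> R) (t : R) : R :=
  \sum_(k < n) (u k <= t < u k.+1)%R%:R * x k.

(** Each increment telescopes over the cells of the finer grid, on which the step
   function is constant. *)
Lemma step_refine s m u n x f : is_grid s m ->
  (forall k, (k <= n)%N -> on_grid s m (u k)) -> (forall k, (k < n)%N -> u k <= u k.+1) ->
  \sum_(i < m) step_fun u n x (s i) * (f (s i.+1) - f (s i)) =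
  \sum_(k < n) x k * (f (u k.+1) - f (u k)).
Proof.
move=> sS uG uS; under eq_bigr do rewrite mulr_suml.
rewrite exchange_big /=; apply: eq_bigr => k _.
rewrite -(grid_telescope f sS (uG k (ltnW (ltn_ord k))) (uG _ (ltn_ord k)) (uS _ (ltn_ord k))).
by rewrite mulr_sumr; apply: eq_bigr => i _; rewrite mulrCA mulrA.
Qed.

Lemma grid_stop s m (t : R) f i : is_grid s m -> on_grid s m t -> (i < m)%N ->
  f (Num.min t (s i.+1)) - f (Num.min t (s i)) = (s i < t)%R%:R * (f (s i.+1) - f (s i)).
Proof.
move=> sS tG im; have sii := sS i im.
have [sit|tsi] := ltP (s i) t; last by rewrite min_l ?(le_trans tsi (ltW sii))// subrr mul0r.
by rewrite mul1r min_r// (grid_next sS im tG sit).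
Qed.

Lemma grid_cell_lt s m (t r : R) i : is_grid s m -> on_grid s m t -> (i < m)%N ->
  s i <= r < s i.+1 -> (r < t) = (s i < t).
Proof.
move=> sS tG im /andP[sr rs]; apply/idP/idP => [|st]; first exact: le_lt_trans sr.
by apply: lt_le_trans rs _; exact: (grid_next sS im tG st).
Qed.

Lemma step_fun_cell s m u n x (r : R) i : is_grid s m ->
  (forall k, (k <= n)%N -> on_grid s m (u k)) -> (i < m)%N -> s i <= r < s i.+1 ->
  step_fun u n x r = step_fun u n x (s i).
Proof.
move=> sS uG im ri; apply: eq_bigr => k _; congr (_%:R * _).
have h1 := grid_cell_lt sS (uG k (ltnW (ltn_ord k))) im ri.
have h2 := grid_cell_lt sS (uG k.+1 (ltn_ord k)) im ri.
by rewrite !leNgt h1 h2.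
Qed.

End Grids.

Section GridLocation.
Context (R : realType).
Implicit Types (s : nat -> R).

Lemma grid_locate s m (x : R) : is_grid s m -> s 0%N <= x < s m ->
  exists2 j, (j < m)%N & s j <= x < s j.+1.
Proof.
elim: m => [|m IH] sS /andP[s0 xm]; first by have := le_lt_trans s0 xm; rewrite ltxx.
have [xsm|smx] := ltP x (s m); last by exists m => //; rewrite smx.
have sS' : is_grid s m by move=> i im; apply: sS; exact: ltnW.
have sx : s 0%N <= x < s m by apply/andP.
by have [j jm h] := IH sS' sx; exists j => //; exact: ltnW.
Qed.

Lemma step_fun_at s m (c : nat -> R) j (x : R) : is_grid s m -> (j < m)%N ->
  s j <= x < s j.+1 -> step_fun s m c x = c j.
Proof.
move=> sS jm /andP[sx xs]; rewrite /step_fun (bigD1 (Ordinal jm)) //= sx xs mul1r.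
rewrite big1 ?addr0// => k kj; suff -> : (s k <= x < s k.+1) = false by rewrite mul0r.
apply/negP => /andP[h1 h2].
have [kj'|jk|jk] := ltngtP (k : nat) j.
- have : s k.+1 <= s j by apply: (grid_le sS); rewrite kj' ltnW.
  by move/(lt_le_trans h2)/lt_le_trans => /(_ _ sx); rewrite ltxx.
- have : s j.+1 <= s k by apply: (grid_le sS); rewrite jk ltnW.
  by move/(lt_le_trans xs)/lt_le_trans => /(_ _ h1); rewrite ltxx.
- by move/eqP: kj; apply; apply: val_inj.
Qed.

(** The point [r] is added to a regular subdivision, so that increments over
   [[r, T]] are sums over whole cells. *)
Lemma fine_grid (T r : R) (M : nat) : 0 <= r <= T -> exists s m,
  [/\ is_grid s m, s 0%N = 0, s m = T, on_grid s m r &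
      forall j, (j < m)%N -> s j.+1 - s j <= T / M.+1%:R].
Proof.
move=> /andP[r0 rT]; have T0 := le_trans r0 rT.
have M0 : 0 < M.+1%:R :> R by [].
have [L LP LB] : exists2 L : seq R, forall j, (j <= M.+1)%N -> T * j%:R / M.+1%:R \in L &
    forall x, x \in L -> 0 <= x <= T.
  exists [seq T * j%:R / M.+1%:R | j <- iota 0 M.+2] => [j jM|x /mapP[j]].
    by apply: (map_f (fun j => T * j%:R / M.+1%:R)); rewrite mem_iota.
  rewrite mem_iota add0n ltnS => /andP[_ jM] ->; rewrite divr_ge0 ?mulr_ge0//=.
  by rewrite ler_pdivrMr// ler_wpM2l// ler_nat.
pose l := [:: 0, T, r & L].
have lB x : x \in l -> 0 <= x <= T.
  rewrite !inE => /or4P[/eqP->|/eqP->|/eqP->|/LB//].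
  - by rewrite lexx.
  - by rewrite T0 lexx.
  - by rewrite r0.
have [s [m [sS sG sl]]] := @grid_exists R l 0 (mem_head _ _).
have s0 : s 0%N = 0.
  have [j jm s0] := sG 0 (mem_head _ _); apply/eqP; rewrite eq_le.
  have /andP[-> _] := lB _ (sl 0%N (leq0n m)).
  by rewrite andbT s0; apply: (grid_le sS).
have sT : s m = T.
  have [k km sT] : on_grid s m T by apply: sG; rewrite !inE eqxx orbT.
  apply/eqP; rewrite eq_le; have /andP[_ ->] := lB _ (sl m (leqnn m)).
  by rewrite {1}sT; apply: (grid_le sS); rewrite km leqnn.
exists s, m; split=> // [|j jm]; first by apply: sG; rewrite !inE eqxx !orbT.
have sj0 : 0 <= s j by rewrite -s0; apply: (grid_le sS); rewrite (ltnW jm).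
have sjT : s j < T by rewrite -sT; apply: (grid_lt sS); rewrite jm leqnn.
have Tp : 0 < T by exact: le_lt_trans sj0 sjT.
pose y := s j * M.+1%:R / T.
have y0 : 0 <= y by rewrite divr_ge0// mulr_ge0.
have /andP[ky yk] := truncn_itv y0; set k := Num.truncn y in ky yk.
have kM : (k < M.+1)%N.
  rewrite -(ltr_nat R); apply: le_lt_trans ky _.
  by rewrite ltr_pdivrMr// mulrC ltr_pM2l.
have xl : T * k.+1%:R / M.+1%:R \in l.
  by rewrite !inE LP ?orbT.
have sx : s j < T * k.+1%:R / M.+1%:R.
  by rewrite ltr_pdivlMr// -ltr_pdivrMl// mulrC.
have := grid_next sS jm (sG _ xl) sx.
have : T * k%:R / M.+1%:R <= s j by rewrite ler_pdivrMr// -ler_pdivlMl// mulrC.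
have -> : T * k.+1%:R / M.+1%:R = T * k%:R / M.+1%:R + T / M.+1%:R.
  by rewrite -mulrDl -natr1; congr (_ / _); ring.
set x := T * _ / _; set z := T / _; lra.
Qed.

End GridLocation.

Section CellChoice.
Context (R : realType).
Local Notation mu := (@lebesgue_measure R).
Local Open Scope ereal_scope.

(** A nonnegative function cannot exceed its mean everywhere on a cell. *)
Lemma cell_value_le_integral (F : R -> R) (a b del eps : R) :
  (a < b)%R -> (0 < del)%R -> measurable_fun setT F -> (forall r, 0 <= F r)%R ->
  \int[mu]_(r in `[a, b[) (F r)%:E <= eps%:E ->
  exists2 r, (a <= r < b)%R & ((b - a) * F r)%:E <= \int[mu]_(r in `[a, b[) (F r)%:E + del%:E.
Proof.
move=> ab del0 mF F0; set I := \int[mu]_(r in _) _ => Ieps.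
have I0 : 0 <= I by apply: integral_ge0 => r _; rewrite lee_fin.
have Ifin : I \is a fin_num by rewrite ge0_fin_numE//; apply: le_lt_trans Ieps (ltry _).
apply: contrapT => noR.
pose c : R := ((fine I + del) / (b - a))%R.
have ba : (0 < b - a)%R by rewrite subr_gt0.
have c0 : (0 <= c)%R.
  by apply: divr_ge0; [apply: addr_ge0; [exact: fine_ge0|exact: ltW]|exact: ltW].
have cF r : (a <= r < b)%R -> (c <= F r)%R.
  move=> rab; rewrite leNgt; apply/negP => Fc; apply: noR; exists r => //.
  rewrite -(fineK Ifin) -EFinD lee_fin mulrC -ler_pdivlMr//; exact: ltW.
have : \int[mu]_(r in `[a, b[) (cst c%:E) r <= I.
  apply: ge0_le_integral => //.
  by apply/measurable_EFinP; apply: measurable_funS mF.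
rewrite integral_cst//= lebesgue_measure_itv /= lte_fin ab -EFinB -EFinM.
by rewrite /c divfK ?gt_eqF// -{2}(fineK Ifin) lee_fin; lra.
Qed.

Lemma grid_values_le_integral (F : R -> R) (s : nat -> R) m (eps : R) :
  is_grid s m -> measurable_fun setT F -> (forall r, 0 <= F r)%R -> (0 < eps)%R ->
  \int[mu]_r (F r)%:E <= eps%:E ->
  exists2 r : nat -> R, forall i, (i < m)%N -> (s i <= r i < s i.+1)%R &
    (\sum_(i < m) (s i.+1 - s i) * F (r i) <= 2 * eps)%R.
Proof.
move=> sS mF F0 eps0 Feps.
have mFE (A : set R) : measurable_fun A (fun r : R => (F r)%:E).
  by apply/measurable_EFinP; apply: measurable_funS mF.
have sub A : measurable A -> \int[mu]_(r in A) (F r)%:E <= eps%:E.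
  move=> mA; apply: le_trans Feps.
  by apply: ge0_subset_integral => //; [exact: mFE|move=> r _; rewrite lee_fin].
pose del : R := (eps / (m%:R + 1))%R.
have m1 : (0 < m%:R + 1 :> R)%R by rewrite ltr_wpDl.
have del0 : (0 < del)%R by rewrite divr_gt0.
have /choice[r rP] : forall i, exists x, (i < m)%N ->
    (s i <= x < s i.+1)%R /\
    ((s i.+1 - s i) * F x)%:E <= \int[mu]_(r in `[s i, s i.+1[) (F r)%:E + del%:E.
  move=> i; case: (ltnP i m) => im; last by exists 0%R.
  have [x h1 h2] := cell_value_le_integral (sS i im) del0 mF F0 (sub _ (measurable_itv _)).
  by exists x.
exists r => [i /rP[]//|].
have H k : (k <= m)%N -> (\sum_(i < k) (s i.+1 - s i) * F (r i))%:E <=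
    \int[mu]_(r in `[s 0%N, s k[) (F r)%:E + (k%:R * del)%:E.
  elim: k => [|k IH] km.
    by rewrite big_ord0 mul0r adde0; apply: integral_ge0 => x _; rewrite lee_fin.
  have [_ rk] := rP k km.
  have s0k : (s 0%N <= s k)%R by apply: (grid_le sS); rewrite (ltnW km).
  have skk : (s k <= s k.+1)%R by apply/ltW/sS.
  have -> : `[s 0%N, s k.+1[%classic = `[s 0%N, s k[ `|` `[s k, s k.+1[.
    by rewrite -itv_bndbnd_setU// bnd_simp.
  rewrite ge0_integral_setU//; last 3 first.
  - exact: mFE.
  - by move=> x _; rewrite lee_fin.
  - apply/disj_setPS => x [/=]; rewrite !in_itv /= => /andP[_ h1] /andP[h2 _].
    by move: (lt_le_trans h1 h2); rewrite ltxx.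
  have -> : (k.+1%:R * del = k%:R * del + del)%R by rewrite -natr1; ring.
  rewrite big_ord_recr /= 2!EFinD addeACA.
  by apply: leeD => //; exact: IH (ltnW km).
rewrite -lee_fin; apply: le_trans (H m (leqnn m)) _.
apply: le_trans (_ : eps%:E + (m%:R * del)%:E <= _); first by apply: leeD => //; exact: sub.
rewrite -EFinD lee_fin; have : (m%:R * del <= eps)%R.
  have e : eps = (del * (m%:R + 1))%R by rewrite /del divfK// gt_eqF.
  by rewrite [leRHS]e mulrC (ler_wpM2l (ltW del0))// lerDl.
lra.
Qed.

(** The two error functions, each cut at its own time, are added, so that one point
   of the cell serves both. *)
Lemma common_cell_values (err err' : R -> R) (T T' t t' eps : R) (s : nat -> R) m :
  is_grid s m -> (0 <= s 0%N)%R -> on_grid s m t -> on_grid s m t' ->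
  (t <= T)%R -> (t' <= T')%R -> (0 < eps)%R ->
  measurable_fun `[0%R, T] err -> measurable_fun `[0%R, T'] err' ->
  (forall r, 0 <= r <= T -> 0 <= err r)%R -> (forall r, 0 <= r <= T' -> 0 <= err' r)%R ->
  \int[mu]_(r in `[0%R, T]) (err r)%:E <= eps%:E ->
  \int[mu]_(r in `[0%R, T']) (err' r)%:E <= eps%:E ->
  exists2 r : nat -> R, forall i, (i < m)%N -> (s i <= r i < s i.+1)%R &
    (\sum_(i < m) (s i.+1 - s i) * ((s i < t)%R%:R * err (r i) +
      (s i < t')%R%:R * err' (r i)) <= 4 * eps)%R.
Proof.
move=> sS s0 tG t'G tT t'T' eps0 merr merr' err0 err'0 ierr ierr'.
pose cut (e : R -> R) (x : R) : R -> R := e \_ (`[0%R, x[ : set R).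
have sub (x X : R) : (x <= X)%R -> `[0%R, x[ `<=` `[0%R, X].
  move=> xX r /=; rewrite !in_itv /= => /andP[-> /ltW] /=.
  by move/le_trans; apply.
have mcut (e : R -> R) (x X : R) : (x <= X)%R ->
    measurable_fun `[0%R, X] e -> measurable_fun setT (cut e x).
  move=> xX me; apply: (iffLR (measurable_restrictT _ (measurable_itv _))).
  exact: measurable_funS (measurable_itv _) (sub _ _ xX) me.
have cut0 (e : R -> R) (x X : R) : (x <= X)%R -> (forall r, 0 <= r <= X -> 0 <= e r)%R ->
    forall r, (0 <= cut e x r)%R.
  move=> xX e0; apply: restrict_ge0 => r /(sub x X xX) /=.
  by rewrite in_itv /=; exact: e0.
have icut (e : R -> R) (x X : R) : (x <= X)%R -> measurable_fun `[0%R, X] e ->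
    (forall r, 0 <= r <= X -> 0 <= e r)%R ->
    \int[mu]_(r in `[0%R, X]) (e r)%:E <= eps%:E -> \int[mu]_r (cut e x r)%:E <= eps%:E.
  move=> xX me e0; apply: le_trans.
  rewrite (_ : (fun r => _) = (EFin \o e) \_ `[0%R, x[); last by rewrite restrict_EFin.
  rewrite -integral_mkcond; apply: ge0_subset_integral => //.
  - exact/measurable_EFinP.
  - exact: sub.
pose F (r : R) := (cut err t r + cut err' t' r)%R.
have mF : measurable_fun setT F.
  by apply: measurable_funD; [exact: (mcut _ _ _ tT merr)|exact: (mcut _ _ _ t'T' merr')].
have F0 r : (0 <= F r)%R.
  by rewrite addr_ge0//; [exact: (cut0 _ _ _ tT err0)|exact: (cut0 _ _ _ t'T' err'0)].
have iF : \int[mu]_r (F r)%:E <= (2 * eps)%:E.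
  under eq_integral do rewrite EFinD.
  rewrite ge0_integralD//.
  - by rewrite mulr_natl mulr2n EFinD leeD//;
      [exact: (icut _ _ _ tT merr err0 ierr)|exact: (icut _ _ _ t'T' merr' err'0 ierr')].
  - by move=> r _; rewrite lee_fin; exact: (cut0 _ _ _ tT err0).
  - by apply/measurable_EFinP; exact: (mcut _ _ _ tT merr).
  - by move=> r _; rewrite lee_fin; exact: (cut0 _ _ _ t'T' err'0).
  - by apply/measurable_EFinP; exact: (mcut _ _ _ t'T' merr').
have eps2 : (0 < 2 * eps)%R by rewrite mulr_gt0.
have [r rP Fr] := grid_values_le_integral sS mF F0 eps2 iF.
exists r => //; apply: le_trans (_ : 2 * (2 * eps) <= _)%R; last by lra.
apply: le_trans Fr; apply: ler_sum => i _.
have si : (0 <= s i)%R by apply: le_trans s0 (grid_le sS _); rewrite (ltnW (ltn_ord i)).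
apply: ler_wpM2l; first by rewrite subr_ge0 ltW// sS.
have [h1 h2] := andP (rP i (ltn_ord i)).
have cutE (e : R -> R) (x : R) : on_grid s m x -> cut e x (r i) = ((s i < x)%R%:R * e (r i))%R.
  move=> xG; rewrite /cut patchE mem_setE in_itv /= (le_trans si h1) /=.
  rewrite (grid_cell_lt sS xG (ltn_ord i)) ?h1//.
  by case: ifP; rewrite ?mul1r ?mul0r.
by rewrite /F !cutE.
Qed.

End CellChoice.

(** * Simple processes on common grids *)

Section SimpleProcesses.
Context (R : realType) (d : nat) (G : 'M[R]_d -> R).
Context (E : (C0path R d -> R) -> R) (HE : is_Gexpectation G E).
Local Notation Om := (C0path R d).
Local Notation mu := (@lebesgue_measure R).
Implicit Types (eta : simple d R) (Y : R -> nat -> Om -> R).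

(** [Y 1_[0, t)]: integration over [[0, t]] is integration of the stopped process. *)
Definition stop Y (t r : R) : nat -> Om -> R := fun n w => (r < t)%R%:R * Y r n w.

Lemma sp_time_bounds p T eta k : is_simple E p T eta -> (k <= sp_size eta)%N ->
  0 <= sp_time eta k <= T.
Proof.
move=> [e0 eT eS _] ks; rewrite -{1}e0 -eT; apply/andP; split; apply: (grid_le eS).
  by [].
by rewrite ks leqnn.
Qed.

Lemma LG_upto_mono (V : normedModType R) p s t (X : nat -> Om -> V) :
  s <= t -> LG_upto E p s X -> LG_upto E p t X.
Proof. by move=> st [XL XC]; split=> // n; exact: Lip_upto_mono (XL n). Qed.

Lemma LG_upto_cst (V : normedModType R) p t (v : V) : (0 < p)%N ->
  LG_upto E p t (fun _ _ => v).
Proof. by move=> p0; split=> [n|]; [exact: Lip_upto_cst|exact: (LG_cauchy_cst HE)]. Qed.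

Lemma sp_eval_LG p T eta (r : R) : (0 < p)%N -> is_simple E p T eta ->
  LG_upto E p r (sp_eval eta r).
Proof.
move=> p0 [_ _ _ eL].
suff H (l : seq 'I_(sp_size eta)) : LG_upto E p r (fun n w => \sum_(k <- l)
    (sp_time eta k <= r < sp_time eta k.+1)%R%:R * sp_coef eta k n w) by exact: H.
elim: l => [|k l IH].
  rewrite (_ : (fun n w => _) = fun _ _ => 0); first exact: LG_upto_cst.
  by apply/funext => n; apply/funext => w; rewrite big_nil.
rewrite (_ : (fun n w => _) = (fun n w =>
   (sp_time eta k <= r < sp_time eta k.+1)%R%:R * sp_coef eta k n w +
   \sum_(k <- l) (sp_time eta k <= r < sp_time eta k.+1)%R%:R * sp_coef eta k n w)).
  apply: (LG_upto_add HE) => //.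
  have [/andP[kr _]|_] := boolP (_ <= r < _).
    by apply: (LG_upto_scale HE); apply: LG_upto_mono kr (eL k (ltn_ord k)).
  rewrite (_ : (fun n w => _) = fun _ _ => 0); first exact: LG_upto_cst.
  by apply/funext => n; apply/funext => w; rewrite mul0r.
by apply/funext => n; apply/funext => w; rewrite big_cons.
Qed.

Lemma stop_LG_upto p Y (t r : R) : (0 < p)%N -> (r < t -> LG_upto E p r (Y r)) ->
  LG_upto E p r (stop Y t r).
Proof.
move=> p0 YG; rewrite /stop; case: (r < t) YG => [/(_ isT) YG|_].
  exact: (LG_upto_scale HE).
rewrite (_ : (fun n w => _) = fun _ _ => 0); first exact: LG_upto_cst.
by apply/funext => n; apply/funext => w; rewrite mul0r.
Qed.

Lemma sp_eval_cell eta s m i (r : R) n w : is_grid s m ->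
  (forall k, (k <= sp_size eta)%N -> on_grid s m (sp_time eta k)) -> (i < m)%N ->
  s i <= r < s i.+1 -> sp_eval eta r n w = sp_eval eta (s i) n w.
Proof.
move=> sS eG im ri.
exact: (@step_fun_cell R s m (sp_time eta) (sp_size eta) (fun k => sp_coef eta k n w)).
Qed.

(** Integrals of several simple processes become sums over the same cells, whatever
   the integrator [f]. *)
Lemma elementary_sum_grid p T eta s m (t : R) (f : R -> R) (x : nat -> R) :
  is_simple E p T eta -> is_grid s m -> on_grid s m t ->
  (forall k, (k <= sp_size eta)%N -> on_grid s m (sp_time eta k)) ->
  \sum_(k < sp_size eta) x k * (f (Num.min t (sp_time eta k.+1)) - f (Num.min t (sp_time eta k))) =
  \sum_(i < m) ((s i < t)%R%:R * step_fun (sp_time eta) (sp_size eta) x (s i)) *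
    (f (s i.+1) - f (s i)).
Proof.
move=> [_ _ eS _] sS tG eG.
rewrite -(@step_refine R s m (sp_time eta) (sp_size eta) x (fun y => f (Num.min t y)))//;
  last first.
  by move=> k km; apply: ltW; exact: eS.
apply: eq_bigr => i _; rewrite (grid_stop f sS tG (ltn_ord i)).
by rewrite mulrCA mulrA.
Qed.

(** All the times in play, sorted. *)
Lemma common_grid p T T' eta eta' (t t' S : R) nu (u : nat -> R) :
  is_simple E p T eta -> is_simple E p T' eta' -> T <= S -> T' <= S ->
  0 <= t <= T -> 0 <= t' <= T' -> (forall k, (k <= nu)%N -> 0 <= u k <= S) ->
  exists s m, [/\ is_grid s m, s 0%N = 0 /\ s m = S, on_grid s m t /\ on_grid s m t' &
    [/\ forall k, (k <= sp_size eta)%N -> on_grid s m (sp_time eta k),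
      forall k, (k <= sp_size eta')%N -> on_grid s m (sp_time eta' k) &
      forall k, (k <= nu)%N -> on_grid s m (u k)]].
Proof.
move=> es es' TS T'S tT t'T' uS.
have [L LP LB] : exists2 L : (nat -> R) -> nat -> seq R,
    forall v k j, (j <= k)%N -> v j \in L v k &
    forall v k (x : R), (forall j, (j <= k)%N -> 0 <= v j <= S) -> x \in L v k ->
      0 <= x <= S.
  exists (fun v k => [seq v j | j <- iota 0 k.+1]) => v k.
    by move=> j jk; apply: map_f; rewrite mem_iota.
  by move=> x vS /mapP[j]; rewrite mem_iota => /= jk ->; exact: vS.
pose l := 0 :: S :: t :: t' :: L (sp_time eta) (sp_size eta) ++
  L (sp_time eta') (sp_size eta') ++ L u nu.
have S0 : 0 <= S by have /andP[t0 /le_trans] := tT; move=> /(_ _ TS); exact: le_trans.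
have lB x : x \in l -> 0 <= x <= S.
  rewrite !inE !mem_cat => /or4P[/eqP->|/eqP->|/eqP->|/orP[/eqP->|/or3P[]]].
  - by rewrite lexx.
  - by rewrite lexx andbT.
  - by have /andP[-> h] := tT; exact: le_trans h TS.
  - by have /andP[-> h] := t'T'; exact: le_trans h T'S.
  - apply: (LB (sp_time eta) (sp_size eta)) => j /(sp_time_bounds es) /andP[-> h].
    exact: le_trans h TS.
  - apply: (LB (sp_time eta') (sp_size eta')) => j /(sp_time_bounds es') /andP[-> h].
    exact: le_trans h T'S.
  - exact: (LB u nu).
have [s [m [sS sG sl]]] := @grid_exists R l 0 (mem_head _ _).
exists s, m; split=> //.
- have [j jm s0] := sG 0 (mem_head _ _).
  have [k km sS'] : on_grid s m S by apply: sG; rewrite !inE eqxx orbT.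
  split; apply/eqP; rewrite eq_le.
    have /andP[-> _] := lB _ (sl 0%N (leq0n m)).
    by rewrite andbT s0; apply: (grid_le sS).
  have /andP[_ ->] := lB _ (sl m (leqnn m)).
  by rewrite {1}sS'; apply: (grid_le sS); rewrite km leqnn.
- by split; apply: sG; rewrite !inE eqxx !orbT.
- by split=> k km; apply: sG; rewrite !inE !mem_cat LP ?orbT.
Qed.

Lemma EG_pow_ge0 p (Z : nat -> Om -> R) : (1 <= p <= 2)%N -> LG E p Z ->
  0 <= EG E (fun n w => `|Z n w| ^+ p).
Proof.
move=> p12 ZG; apply: limr_ge; first exact: (E_pow_cvg HE).
by near=> n; apply: (E_pow_ge0 HE); exact: ZG.1.
Unshelve. all: by end_near. Qed.

(** Convergence of simple processes is known only in the mean over time. Choosing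
   one good time in each cell of a common grid turns it into bounds on finite
   sums of expectations, and no integral over time remains. *)
Lemma approx_cells p T T' eta eta' Y Y' (t t' S eps : R) nu (u : nat -> R) :
  (1 <= p <= 2)%N -> is_simple E p T eta -> is_simple E p T' eta' ->
  (forall r : R, 0 <= r <= T -> LG_upto E p r (Y r)) ->
  (forall r : R, 0 <= r <= T' -> LG_upto E p r (Y' r)) ->
  let err r := EG E (fun n w => `|sp_eval eta r n w - Y r n w| ^+ p) in
  let err' r := EG E (fun n w => `|sp_eval eta' r n w - Y' r n w| ^+ p) in
  measurable_fun `[0%R, T] err -> measurable_fun `[0%R, T'] err' ->
  (\int[mu]_(r in `[0%R, T]) (err r)%:E <= eps%:E)%E ->
  (\int[mu]_(r in `[0%R, T']) (err' r)%:E <= eps%:E)%E ->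
  0 < eps -> T <= S -> T' <= S ->
  0 <= t <= T -> 0 <= t' <= T' -> (forall k, (k <= nu)%N -> 0 <= u k <= S) ->
  exists s m (r : nat -> R), [/\ [/\ is_grid s m, s 0%N = 0 & s m = S],
    on_grid s m t /\ on_grid s m t',
    [/\ forall k, (k <= sp_size eta)%N -> on_grid s m (sp_time eta k),
      forall k, (k <= sp_size eta')%N -> on_grid s m (sp_time eta' k) &
      forall k, (k <= nu)%N -> on_grid s m (u k)],
    forall i, (i < m)%N -> s i <= r i < s i.+1 &
    forall e, 0 < e -> \forall n \near \oo, \sum_(i < m) (s i.+1 - s i) *
      (E (fun w => `|stop (sp_eval eta) t (s i) n w - stop Y t (r i) n w| ^+ p) +
       E (fun w => `|stop (sp_eval eta') t' (s i) n w - stop Y' t' (r i) n w| ^+ p)) <=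
      4 * eps + e].
Proof.
move=> p12 es es' YG Y'G err err' merr merr' ierr ierr' eps0 TS T'S tT t'T' uS.
have p0 : (0 < p)%N by case/andP: p12.
have [s [m [sS [s0 sm] [tG t'G] [eG e'G uG]]]] := common_grid es es' TS T'S tT t'T' uS.
have AG T1 eta1 Y1 (r1 : R) : is_simple E p T1 eta1 ->
    (forall r : R, 0 <= r <= T1 -> LG_upto E p r (Y1 r)) -> 0 <= r1 <= T1 ->
    LG E p (fun n w => sp_eval eta1 r1 n w - Y1 r1 n w).
  move=> e1s Y1G r1T; apply: (LG_sub HE); apply: LG_upto_LG; last exact: Y1G.
  exact: sp_eval_LG e1s.
have err0 r : 0 <= r <= T -> 0 <= err r by move=> rT; apply: (EG_pow_ge0 p12); exact: AG es YG rT.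
have err'0 r : 0 <= r <= T' -> 0 <= err' r.
  by move=> rT; apply: (EG_pow_ge0 p12); exact: AG es' Y'G rT.
have s0' : 0 <= s 0%N by rewrite s0.
have [/andP[t0 tT1] /andP[t'0 t'T1]] := (tT, t'T').
have [r rP rsum] := common_cell_values sS s0' tG t'G tT1 t'T1 eps0 merr merr' err0 err'0 ierr ierr'.
exists s, m, r; split=> // e e0.
have term T1 eta1 Y1 t1 i e1 : is_simple E p T1 eta1 ->
    (forall r : R, 0 <= r <= T1 -> LG_upto E p r (Y1 r)) -> t1 <= T1 ->
    (forall k, (k <= sp_size eta1)%N -> on_grid s m (sp_time eta1 k)) ->
    on_grid s m t1 -> (i < m)%N -> 0 < e1 ->
    \forall n \near \oo,
      E (fun w => `|stop (sp_eval eta1) t1 (s i) n w - stop Y1 t1 (r i) n w| ^+ p) <=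
      (s i < t1)%R%:R * EG E (fun n w => `|sp_eval eta1 (r i) n w - Y1 (r i) n w| ^+ p) + e1.
  move=> e1s Y1G t1T e1G t1G im e10.
  have /andP[sr rs] := rP i im.
  have rt := grid_cell_lt sS t1G im (rP i im).
  have si0 : 0 <= s i by rewrite -s0; apply: (grid_le sS); rewrite (ltnW im).
  have [st|st] := boolP (s i < t1).
    have rT : 0 <= r i <= T1.
      rewrite (le_trans si0 sr) /=; apply: le_trans t1T; apply: ltW.
      by rewrite rt.
    have := lim_le_eventually (E_pow_cvg HE p12 (AG _ _ _ _ e1s Y1G rT)) (lexx _) e10.
    apply: filterS => n; rewrite mul1r; apply: le_trans.
    rewrite le_eqVlt; apply/orP; left; apply/eqP; congr E; apply/funext => w.
    by rewrite /stop rt st !mul1r (sp_eval_cell n w sS e1G im (rP i im)).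
  near=> n; rewrite mul0r add0r (_ : (fun w => _) = fun=> 0) ?(E_cst HE) ?ltW//.
  by apply/funext => w; rewrite /stop rt (negPf st) !mul0r subr0 normr0 expr0n gtn_eqF.
have S0 : 0 <= S by rewrite -sm -s0; apply: (grid_le sS); rewrite leqnn.
pose e1 := e / 2 / (S + 1).
have e10 : 0 < e1 by rewrite !divr_gt0// ltr_wpDl.
have : \forall n \near \oo, forall i : 'I_m,
  E (fun w => `|stop (sp_eval eta) t (s i) n w - stop Y t (r i) n w| ^+ p) +
  E (fun w => `|stop (sp_eval eta') t' (s i) n w - stop Y' t' (r i) n w| ^+ p) <=
  ((s i < t)%R%:R * err (r i) + (s i < t')%R%:R * err' (r i)) + 2 * e1.
  apply: filter_forall => i.
  have := term _ _ _ _ _ _ es YG tT1 eG tG (ltn_ord i) e10.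
  have := term _ _ _ _ _ _ es' Y'G t'T1 e'G t'G (ltn_ord i) e10.
  apply: filterS2 => n; rewrite -/(err _) -/(err' _) => h1 h2.
  by apply: le_trans (lerD h2 h1) _; lra.
apply: filterS => n H.
apply: le_trans (_ : \sum_(i < m) (s i.+1 - s i) *
  (((s i < t)%R%:R * err (r i) + (s i < t')%R%:R * err' (r i)) + 2 * e1) <= _).
  by apply: ler_sum => i _; apply: ler_wpM2l; rewrite ?H// subr_ge0 ltW// sS.
under eq_bigr do rewrite mulrDr.
rewrite big_split /= -mulr_suml.
have -> : \sum_(i < m) (s i.+1 - s i) = S.
  by rewrite -(big_mkord xpredT (fun i => s i.+1 - s i)) telescope_sumr// s0 sm subr0.
have : S * (2 * e1) <= e.
  have -> : e = (S + 1) * (2 * e1) by rewrite /e1; field; rewrite gt_eqF// ltr_wpDl.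
  by rewrite ler_wpM2r// ?lerDl// mulr_ge0// ltW.
move: rsum; lra.
Unshelve. all: by end_near. Qed.

End SimpleProcesses.

(** * Comparison of stochastic integrals *)

Section NearSums.
Context (R : realType).

Lemma near_sum_le (I : finType) (f : I -> nat -> R) (c : I -> R) :
  (forall i e, 0 < e -> \forall n \near \oo, f i n <= c i + e) ->
  forall e, 0 < e -> \forall n \near \oo, \sum_i f i n <= \sum_i c i + e.
Proof.
move=> fc e e0; have I1 : 0 < #|I|%:R + 1 :> R by rewrite ltr_wpDl.
pose e1 := e / (#|I|%:R + 1); have e10 : 0 < e1 by rewrite divr_gt0.
have : \forall n \near \oo, forall i, f i n <= c i + e1.
  by apply: filter_forall => i; exact: fc.
apply: filterS => n H; apply: le_trans (ler_sum _ (fun i _ => H i)) _.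
rewrite big_split /= lerD2l sumr_const -[X in X <= _]mulr_natr.
have -> : e = e1 * (#|I|%:R + 1) by rewrite /e1 divfK// gt_eqF.
by rewrite (ler_wpM2l (ltW e10))// lerDl.
Qed.

Lemma near2_sum_le (I : finType) (f : I -> nat -> nat -> R) :
  (forall i e, 0 < e -> \forall m \near \oo, \forall n \near \oo, f i m n <= e) ->
  forall e, 0 < e -> \forall m \near \oo, \forall n \near \oo, \sum_i f i m n <= e.
Proof.
move=> fc e e0; have I1 : 0 < #|I|%:R + 1 :> R by rewrite ltr_wpDl.
pose e1 := e / (#|I|%:R + 1); have e10 : 0 < e1 by rewrite divr_gt0.
have : \forall m \near \oo, forall i, \forall n \near \oo, f i m n <= e1.
  by apply: filter_forall => i; exact: fc.
apply: filterS => m H.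
have : \forall n \near \oo, forall i, f i m n <= e1 by exact: filter_forall.
apply: filterS => n {}H; apply: le_trans (ler_sum _ (fun i _ => H i)) _.
rewrite sumr_const -[X in X <= _]mulr_natr.
have -> : e = e1 * (#|I|%:R + 1) by rewrite /e1 divfK// gt_eqF.
by rewrite (ler_wpM2l (ltW e10))// lerDl.
Qed.

End NearSums.

Section StochasticIntegrals.
Context (R : realType) (d : nat) (G : 'M[R]_d -> R).
Context (E : (C0path R d -> R) -> R) (HE : is_Gexpectation G E).
Context (K : R) (K0 : 0 <= K).
Hypothesis mean0 : forall a (c s t : R), 0 <= s -> 0 <= t ->
  E (fun w => c * (w (t + s) 0 a - w t 0 a)) = 0.
Hypothesis variance : forall a (s t : R), 0 <= s -> 0 <= t ->
  E (fun w => (w (t + s) 0 a - w t 0 a) ^+ 2) <= K * s.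
Local Notation Om := (C0path R d).
Local Notation mu := (@lebesgue_measure R).
Implicit Types (eta : simple d R) (Y : R -> nat -> Om -> R) (q : R -> nat -> Om -> R).

Lemma E_abs_sum (I : finType) (X : I -> Om -> R) : (forall i, Lip (X i)) ->
  E (fun w => `|\sum_i X i w|) <= \sum_i E (fun w => `|X i w|).
Proof.
move=> XL; have aL i : true -> Lip (fun w => `|X i w|) by move=> _; lip.
apply: le_trans (@E_sum _ _ _ _ HE _ (index_enum I) _ _ aL).
apply: (E_le HE); try by lip.
by move=> w; exact: ler_norm_sum.
Qed.

Lemma Mbar_near p T (eta : nat -> simple d R) Y eps : Mbar_cvg E p T eta Y -> 0 < eps ->
  \forall k \near \oo, (\int[mu]_(r in `[0%R, T])
    (EG E (fun n w => `|sp_eval (eta k) r n w - Y r n w| ^+ p))%:E <= eps%:E)%E.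
Proof.
move=> [_ _ _ /fine_cvgP[fin /cvgrPdist_le ec]] eps0.
apply: filterS2 fin (ec eps eps0) => k fk; rewrite sub0r normrN => /(le_trans (ler_norm _)).
by rewrite -lee_fin fineK.
Qed.

Section Comparison.
Variables (T T' t t' S : R) (Y Y' : R -> nat -> Om -> R) (nu : nat) (u gv : nat -> R).
Hypotheses (TS : T <= S) (T'S : T' <= S) (tT : 0 <= t <= T) (t'T' : 0 <= t' <= T')
  (uS : forall k, (k <= nu)%N -> 0 <= u k <= S) (u_nd : forall k, (k < nu)%N -> u k <= u k.+1).
Hypothesis Hg : forall r, 0 <= r < S -> forall e, 0 < e -> \forall n \near \oo,
  E (fun w => (stop Y t r n w - stop Y' t' r n w) ^+ 2) <= step_fun u nu gv r + e.

Let gint := \sum_(k < nu) gv k * (u k.+1 - u k).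

Lemma cells_bound s m (r : nat -> R) : is_grid s m -> s 0%N = 0 -> s m = S ->
  (forall k, (k <= nu)%N -> on_grid s m (u k)) ->
  (forall i, (i < m)%N -> s i <= r i < s i.+1) ->
  forall e, 0 < e -> \forall n \near \oo, \sum_(i < m) (s i.+1 - s i) *
    E (fun w => (stop Y t (r i) n w - stop Y' t' (r i) n w) ^+ 2) <= gint + e.
Proof.
move=> sS s0 sm uG rP e e0.
have -> : gint = \sum_(i < m) (s i.+1 - s i) * step_fun u nu gv (s i).
  rewrite /gint -(@step_refine R s m u nu gv id)//.
  by apply: eq_bigr => i _; rewrite mulrC.
apply: near_sum_le => // i e1 e10.
have D0 : 0 < s i.+1 - s i by rewrite subr_gt0 sS.
have e2 : 0 < e1 / (s i.+1 - s i) by rewrite divr_gt0.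
have /andP[sr rs] := rP i (ltn_ord i).
have rS : 0 <= r i < S.
  apply/andP; split; first by apply: le_trans sr; rewrite -s0;
    apply: (grid_le sS); rewrite (ltnW (ltn_ord i)).
  by apply: lt_le_trans rs _; rewrite -sm; apply: (grid_le sS); rewrite ltn_ord leqnn.
apply: filterS (Hg rS e2) => n.
rewrite (step_fun_cell gv sS uG (ltn_ord i) (rP i (ltn_ord i))) => h.
apply: le_trans (ler_wpM2l (ltW D0) h) _.
by rewrite mulrDr lerD2l mulrC divfK// gt_eqF.
Qed.

Section OnePair.
Variables (p : nat) (eta eta' : simple d R) (eps : R).
Hypotheses (p12 : (1 <= p <= 2)%N) (es : is_simple E p T eta) (es' : is_simple E p T' eta')
  (YG : forall r : R, 0 <= r <= T -> LG_upto E p r (Y r))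
  (Y'G : forall r : R, 0 <= r <= T' -> LG_upto E p r (Y' r)).
Let err r := EG E (fun n w => `|sp_eval eta r n w - Y r n w| ^+ p).
Let err' r := EG E (fun n w => `|sp_eval eta' r n w - Y' r n w| ^+ p).
Hypotheses (merr : measurable_fun `[0%R, T] err) (merr' : measurable_fun `[0%R, T'] err')
  (ierr : (\int[mu]_(r in `[0%R, T]) (err r)%:E <= eps%:E)%E)
  (ierr' : (\int[mu]_(r in `[0%R, T']) (err' r)%:E <= eps%:E)%E)
  (eps0 : 0 < eps).

Lemma stopY_LG T1 Y1 t1 (r : R) : (forall r : R, 0 <= r <= T1 -> LG_upto E p r (Y1 r)) ->
  0 <= t1 <= T1 -> 0 <= r -> LG_upto E p r (stop Y1 t1 r).
Proof.
have p0 : (0 < p)%N by case/andP: p12.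
move=> Y1G /andP[_ t1T] r0; apply: (stop_LG_upto HE) => // rt; apply: Y1G.
by rewrite r0 (le_trans (ltW rt)).
Qed.

Lemma stop_eval_LG T1 eta1 t1 (r : R) : is_simple E p T1 eta1 ->
  LG_upto E p r (stop (sp_eval eta1) t1 r).
Proof.
have p0 : (0 < p)%N by case/andP: p12.
by move=> e1s; apply: (stop_LG_upto HE) => // _; exact: (sp_eval_LG HE _ p0 e1s).
Qed.

(** On a common grid the difference of the two elementary integrals is a single
   martingale sum, with coefficients [A - A'] that are split through the values
   [B - B'] of the limit processes at the chosen times. *)
Lemma ito_elem_compare a : p = 2%N -> forall e, 0 < e -> \forall n \near \oo,
  E (fun w => (ito_elem a eta t n w - ito_elem a eta' t' n w) ^+ 2) <=
  3 * K * (4 * eps + gint) + e.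
Proof.
move=> p2 e e0.
have [s [m [r [[sS s0 sm] [tG t'G] [eG e'G uG] rP happ]]]] := approx_cells HE p12 es es' YG Y'G
  merr merr' ierr ierr' eps0 TS T'S tT t'T' uS.
have K31 : 0 < 3 * K + 1 by rewrite ltr_wpDl// mulr_ge0.
have e1 : 0 < e / 2 / (3 * K + 1) by rewrite !divr_gt0.
have s_ge0 i : (i <= m)%N -> 0 <= s i by move=> im; rewrite -s0; apply: (grid_le sS).
apply: filterS2 (happ _ e1) (cells_bound sS s0 sm uG rP e1) => n H1 H2.
pose A i := stop (sp_eval eta) t (s i) n; pose A' i := stop (sp_eval eta') t' (s i) n.
pose B i := stop Y t (r i) n; pose B' i := stop Y' t' (r i) n.
have r_ge0 (i : 'I_m) : 0 <= r i.
  have /andP[h _] := rP i (ltn_ord i); apply: le_trans h; apply: s_ge0; exact: ltnW (ltn_ord i).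
have AL i : Lip_upto (s i) (A i) by exact: (stop_eval_LG t (s i) es).1.
have A'L i : Lip_upto (s i) (A' i) by exact: (stop_eval_LG t' (s i) es').1.
have BL (i : 'I_m) : Lip (B i) by exact: LG_upto_Lip (stopY_LG YG tT (r_ge0 i)).
have B'L (i : 'I_m) : Lip (B' i) by exact: LG_upto_Lip (stopY_LG Y'G t'T' (r_ge0 i)).
have -> : (fun w => (ito_elem a eta t n w - ito_elem a eta' t' n w) ^+ 2) =
    (fun w => (\sum_(i < m) (A i w - A' i w) * (w (s i.+1) 0 a - w (s i) 0 a)) ^+ 2).
  apply/funext => w; rewrite /ito_elem.
  rewrite (elementary_sum_grid (fun y => w y 0 a) (fun k => sp_coef eta k n w) es sS tG eG).
  rewrite (elementary_sum_grid (fun y => w y 0 a) (fun k => sp_coef eta' k n w) es' sS t'G e'G).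
  by rewrite -sumrB; congr (_ ^+ 2); apply: eq_bigr => i _; rewrite -mulrBl.
have s0' : 0 <= s 0%N by rewrite s0.
have s_le i : (i < m)%N -> s i <= s i.+1 by move=> im; apply/ltW/sS.
have cL i : (i < m)%N -> Lip_upto (s i) (fun w => A i w - A' i w).
  by move=> _; have := AL i; have := A'L i => ? ?; lip.
apply: le_trans (ito_sum_L2 HE K0 mean0 variance a s0' s_le cL) _.
have cE (i : 'I_m) : E (fun w => (A i w - A' i w) ^+ 2) <=
    3 * ((E (fun w => `|A i w - B i w| ^+ 2) + E (fun w => `|A' i w - B' i w| ^+ 2)) +
    E (fun w => (B i w - B' i w) ^+ 2)).
  have AL' := Lip_upto_Lip (AL i); have A'L' := Lip_upto_Lip (A'L i).
  have BLi := BL i; have B'Li := B'L i.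
  apply: le_trans (_ : E (fun w => 3 * ((`|A i w - B i w| ^+ 2 + `|A' i w - B' i w| ^+ 2) +
    (B i w - B' i w) ^+ 2)) <= _).
    apply: (E_le HE); try by lip.
    move=> w; rewrite !real_normK ?num_real//.
    set x := A i w; set y := A' i w; set z := B i w; set z' := B' i w.
    rewrite -subr_ge0 (_ : _ - _ = ((x - z) + (y - z')) ^+ 2 + ((x - z) - (z - z')) ^+ 2 +
      ((y - z') + (z - z')) ^+ 2); last by ring.
    by rewrite !addr_ge0// sqr_ge0.
  rewrite (E_scale HE)//; last by lip.
  rewrite ler_wpM2l//; apply: le_trans (E_add HE _ _) _; try by lip.
  by rewrite lerD2r; apply: (E_add HE); lip.
apply: le_trans (_ : K * \sum_(i < m) (s i.+1 - s i) * (3 *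
  ((E (fun w => `|A i w - B i w| ^+ 2) + E (fun w => `|A' i w - B' i w| ^+ 2)) +
    E (fun w => (B i w - B' i w) ^+ 2))) <= _).
  rewrite ler_wpM2l//; apply: ler_sum => i _; apply: ler_wpM2l => //.
  by rewrite subr_ge0 ltW// sS.
under eq_bigr do rewrite mulrCA mulrDr.
rewrite -mulr_sumr big_split /= mulrCA mulrA; rewrite p2 in H1.
apply: le_trans (ler_wpM2l _ (lerD H1 H2)) _; first by rewrite mulr_ge0.
set e1' := e / 2 / _; have -> : e = (3 * K + 1) * (2 * e1').
  by rewrite /e1'; field; rewrite gt_eqF.
have : 0 <= e1' by exact: ltW.
nra.
Qed.

Section QuadraticVariationIntegral.
Variables (q : R -> nat -> Om -> R) (Kq : R).
Hypotheses (Kq0 : 0 <= Kq) (qLG : forall r, 0 <= r -> LG E 2 (q r)).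
Hypothesis q_speed : forall r r', 0 <= r <= r' -> forall e, 0 < e -> \forall n \near \oo,
  E (fun w => Num.max 0 (`|q r' n w - q r n w| - Kq * (r' - r)) ^+ 2) <= e.

(** The factor [y] is fixed, hence has a finite square mean. *)
Lemma E_mul_small (y : Om -> R) (Z : nat -> Om -> R) : Lip y -> (forall n, Lip (Z n)) ->
  (forall e, 0 < e -> \forall n \near \oo, E (fun w => Z n w ^+ 2) <= e) ->
  forall e, 0 < e -> \forall n \near \oo, E (fun w => `|y w| * `|Z n w|) <= e.
Proof.
move=> yL ZL Z0 e e0; pose M := E (fun w => y w ^+ 2).
have M0 : 0 <= M by apply: (E_ge0 HE); [lip|move=> w; exact: sqr_ge0].
pose l := e / 2 / (M + 1); have l0 : 0 < l by rewrite !divr_gt0// ltr_wpDl.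
have e1 : 0 < e / 2 * l by rewrite mulr_gt0// divr_gt0.
apply: filterS (Z0 _ e1) => n Zn.
apply: le_trans (_ : l * M + l^-1 * E (fun w => Z n w ^+ 2) <= _).
  exact: (E_mul_le HE l0 yL (ZL n)).
have : l^-1 * E (fun w => Z n w ^+ 2) <= e / 2 by rewrite ler_pdivrMl// mulrC.
have : l * M <= e / 2.
  have -> : e / 2 = l * (M + 1) by rewrite /l; field; rewrite gt_eqF// ltr_wpDl.
  by rewrite (ler_wpM2l (ltW l0))// lerDl.
lra.
Qed.

(** Products [Y (q_s' - q_s)] in [L^1] are only defined as limits in [m] of
   [Y_m (q_s' - q_s)]: the index [m] of the coefficients is fixed first, large
   enough for all the finitely many limits involved. *)
Lemma qv_elem_compare (J J' : nat -> Om -> R) : p = 1%N ->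
  qv_elem E q eta t J -> qv_elem E q eta' t' J' ->
  forall e, 0 < e -> \forall n \near \oo,
    L2_close E (Kq ^+ 2 * S * gint) (4 * Kq * eps + e) (fun w => J n w - J' n w).
Proof.
move=> p1 [P [PM ->]] [P' [P'M ->]] e e0.
have [s [m [r [[sS s0 sm] [tG t'G] [eG e'G uG] rP happ]]]] := approx_cells HE p12 es es' YG Y'G
  merr merr' ierr ierr' eps0 TS T'S tT t'T' uS.
have s_ge0 i : (i <= m)%N -> 0 <= s i by move=> im; rewrite -s0; apply: (grid_le sS).
have S0 : 0 <= S by rewrite -sm; exact: s_ge0.
have D0 (i : 'I_m) : 0 <= s i.+1 - s i by rewrite subr_ge0 ltW// sS.
have sumD : \sum_(i < m) (s i.+1 - s i) = S.
  by rewrite -(big_mkord xpredT (fun i => s i.+1 - s i)) telescope_sumr// s0 sm subr0.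
pose c0 := 4 + Kq + Kq ^+ 2 * S.
have KS : 0 <= Kq ^+ 2 * S by rewrite mulr_ge0// sqr_ge0.
have c00 : 0 < c0 by have := Kq0; rewrite /c0; move: KS; set z := _ * S; lra.
pose e1 := e / c0; have e10 : 0 < e1 by rewrite divr_gt0.
have e1E : 4 * e1 + Kq * e1 + Kq ^+ 2 * S * e1 = e.
  by rewrite -!mulrDl -/c0 mulrC divfK// gt_eqF.
pose A i := stop (sp_eval eta) t (s i); pose A' i := stop (sp_eval eta') t' (s i).
pose B i := stop Y t (r i); pose B' i := stop Y' t' (r i).
pose c i n w := A i n w - A' i n w.
have r_ge0 (i : 'I_m) : 0 <= r i.
  have /andP[h _] := rP i (ltn_ord i); apply: le_trans h; apply: s_ge0.
  exact: ltnW (ltn_ord i).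
have AL i n : Lip (A i n) by exact: LG_upto_Lip (stop_eval_LG t (s i) es).
have A'L i n : Lip (A' i n) by exact: LG_upto_Lip (stop_eval_LG t' (s i) es').
have BL (i : 'I_m) n : Lip (B i n) by exact: LG_upto_Lip (stopY_LG YG tT (r_ge0 i)).
have B'L (i : 'I_m) n : Lip (B' i n) by exact: LG_upto_Lip (stopY_LG Y'G t'T' (r_ge0 i)).
have cL i n : Lip (c i n) by rewrite /c; have := AL i n; have := A'L i n => ? ?; lip.
have cC i : LG_cauchy E 1 (c i).
  have AG := LG_upto_LG (stop_eval_LG t (s i) es).
  have A'G := LG_upto_LG (stop_eval_LG t' (s i) es').
  by have [_] := LG_sub HE AG A'G; rewrite p1.
have min_ge0 (t1 x : R) : 0 <= t1 -> 0 <= x -> 0 <= Num.min t1 x.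
  by move=> ? ?; rewrite le_min; apply/andP.
have [/andP[t0 _] /andP[t'0 _]] := (tT, t'T').
(* At a fixed index [m] of the coefficients the products are in [L_ip], unlike
   their limits [P]. *)
pose prd eta1 t1 k m n w := sp_coef eta1 k m w *
  (q (Num.min t1 (sp_time eta1 k.+1)) n w - q (Num.min t1 (sp_time eta1 k)) n w).
have prdL T1 eta1 t1 (k : 'I_(sp_size eta1)) m1 n : is_simple E p T1 eta1 -> 0 <= t1 ->
    Lip (prd eta1 t1 k m1 n).
  move=> e1s t10; have [_ _ _ /(_ k (ltn_ord k)) /LG_upto_Lip ceL] := e1s.
  have /andP[x0 _] := sp_time_bounds e1s (ltnW (ltn_ord k)).
  have /andP[x1 _] := sp_time_bounds e1s (ltn_ord k).
  have h1 := (qLG (min_ge0 _ _ t10 x0)).1 n; have h2 := (qLG (min_ge0 _ _ t10 x1)).1 n.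
  by have ceLm := ceL m1; rewrite /prd; lip.
have prd_near T1 eta1 t1 (P1 : nat -> nat -> Om -> R) : is_simple E p T1 eta1 -> 0 <= t1 ->
    (forall k, (k < sp_size eta1)%N -> LG_mul E (sp_coef eta1 k)
       (fun n w => q (Num.min t1 (sp_time eta1 k.+1)) n w - q (Num.min t1 (sp_time eta1 k)) n w)
       (P1 k)) ->
    \forall m1 \near \oo, \forall n \near \oo,
      \sum_(k < sp_size eta1) E (fun w => `|prd eta1 t1 k m1 n w - P1 k n w|) <= e1.
  move=> e1s t10 P1M; apply: near2_sum_le => // k e2 e20.
  have [_ _ _ /(_ k (ltn_ord k)) /LG_upto_Lip ceL] := e1s.
  have /andP[x0 _] := sp_time_bounds e1s (ltnW (ltn_ord k)).
  have /andP[x1 _] := sp_time_bounds e1s (ltn_ord k).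
  apply: (LG_mul_near HE _ _ (P1M k (ltn_ord k))) => //.
  by apply: (LG_sub HE); apply: qLG; exact: min_ge0.
have c_near : \forall m1 \near \oo, \forall n \near \oo,
    \sum_(i < m) Kq * (s i.+1 - s i) * E (fun w => `|c i m1 w - c i n w|) <= e1.
  apply: near2_sum_le => // i e2 e20.
  have M0 : 0 <= Kq * (s i.+1 - s i) by rewrite mulr_ge0.
  have M1 : 0 < Kq * (s i.+1 - s i) + 1 by rewrite ltr_wpDl.
  have e3 : 0 < e2 / (Kq * (s i.+1 - s i) + 1) by rewrite divr_gt0.
  have [n0 n0P] := cC i _ e3; near=> m1; near=> n.
  have h : E (fun w => `|c i m1 w - c i n w| ^+ 1) < e2 / (Kq * (s i.+1 - s i) + 1).
    by apply: n0P; [near: m1|near: n]; exact: nbhs_infty_ge.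
  apply: le_trans (ler_wpM2l M0 (ltW h)) _.
  by rewrite mulrCA ler_piMr ?(ltW e20)// ler_pdivrMr// mul1r lerDl.
have [N1 _ N1P] := prd_near _ _ _ _ es t0 PM.
have [N2 _ N2P] := prd_near _ _ _ _ es' t'0 P'M.
have [N3 _ N3P] := c_near.
pose m1 := maxn N1 (maxn N2 N3).
have h1 := N1P m1 (leq_maxl _ _).
have h2 := N2P m1 (leq_trans (leq_maxl _ _) (leq_maxr _ _)).
have h3 := N3P m1 (leq_trans (leq_maxr _ _) (leq_maxr _ _)).
pose rho (i : nat) n w := Num.max 0 (`|q (s i.+1) n w - q (s i) n w| - Kq * (s i.+1 - s i)).
have qL (x : R) n : 0 <= x -> Lip (q x n) by move=> x0; exact: (qLG x0).1.
have rhoL (i : 'I_m) n : Lip (rho i n).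
  have := qL _ n (s_ge0 i.+1 (ltn_ord i)); have := qL _ n (s_ge0 i (ltnW (ltn_ord i))).
  by move=> ? ?; rewrite /rho; lip.
have rho0 i n w : 0 <= rho i n w by rewrite le_max lexx.
have h4 : \forall n \near \oo, \sum_(i < m) E (fun w => `|c i m1 w| * `|rho i n w|) <= e1.
  have H0 (i : 'I_m) e2 : 0 < e2 -> \forall n \near \oo,
      E (fun w => `|c i m1 w| * `|rho i n w|) <= 0 + e2.
    move=> e20; rewrite add0r.
    apply: (@E_mul_small (c i m1) (fun n => rho i n)) => // e3 e30.
    by apply: q_speed => //; rewrite (s_ge0 i (ltnW (ltn_ord i))) ltW// sS.
  by apply: filterS (near_sum_le H0 e10) => n; rewrite [X in _ <= X + _]big1// add0r.
near=> n.
have g1 : \sum_(k < sp_size eta) E (fun w => `|prd eta t k m1 n w - P k n w|) <= e1 by near: n.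
have g2 : \sum_(k < sp_size eta') E (fun w => `|prd eta' t' k m1 n w - P' k n w|) <= e1 by near: n.
have g3 : \sum_(i < m) Kq * (s i.+1 - s i) * E (fun w => `|c i m1 w - c i n w|) <= e1 by near: n.
have g4 : \sum_(i < m) E (fun w => `|c i m1 w| * `|rho i n w|) <= e1 by near: n.
have g5 : \sum_(i < m) (s i.+1 - s i) *
      (E (fun w => `|A i n w - B i n w| ^+ p) + E (fun w => `|A' i n w - B' i n w| ^+ p)) <=
      4 * eps + e1 by near: n; exact: happ.
have g6 : \sum_(i < m) (s i.+1 - s i) * E (fun w => (B i n w - B' i n w) ^+ 2) <= gint + e1.
  by near: n; exact: (cells_bound sS s0 sm uG rP e10).
have PL (k : 'I_(sp_size eta)) : Lip (P k n) by have [[+ _] _] := PM k (ltn_ord k).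
have P'L (k : 'I_(sp_size eta')) : Lip (P' k n) by have [[+ _] _] := P'M k (ltn_ord k).
have pL (k : 'I_(sp_size eta)) := prdL _ _ _ k m1 n es t0.
have p'L (k : 'I_(sp_size eta')) := prdL _ _ _ k m1 n es' t'0.
pose u1 w := Kq * \sum_(i < m) (s i.+1 - s i) * `|B i n w - B' i n w|.
pose v1 w := \sum_(k < sp_size eta) `|prd eta t k m1 n w - P k n w|.
pose v2 w := \sum_(k < sp_size eta') `|prd eta' t' k m1 n w - P' k n w|.
pose v3 w := \sum_(i < m) Kq * (s i.+1 - s i) * `|c i m1 w - c i n w|.
pose v4 w := \sum_(i < m) `|c i m1 w| * `|rho i n w|.
pose v5 w := Kq * \sum_(i < m) (s i.+1 - s i) * (`|A i n w - B i n w| + `|A' i n w - B' i n w|).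
have dL1 (k : 'I_(sp_size eta)) : Lip (fun w => `|prd eta t k m1 n w - P k n w|).
  by have := pL k; have := PL k => ? ?; lip.
have dL2 (k : 'I_(sp_size eta')) : Lip (fun w => `|prd eta' t' k m1 n w - P' k n w|).
  by have := p'L k; have := P'L k => ? ?; lip.
have ABL (i : 'I_m) : [/\ Lip (A i n), Lip (A' i n), Lip (B i n) & Lip (B' i n)].
  by split; [exact: AL|exact: A'L|exact: BL|exact: B'L].
have uL : Lip u1.
  by rewrite /u1; apply: Lip_mul; [lip|apply: Lip_sum => i _; have [? ? ? ?] := ABL i; lip].
have v1L : Lip v1 by apply: Lip_sum => k _; exact: dL1.
have v2L : Lip v2 by apply: Lip_sum => k _; exact: dL2.
have v3t (i : 'I_m) : Lip (fun w => Kq * (s i.+1 - s i) * `|c i m1 w - c i n w|).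
  by have := cL i m1; have := cL i n => ? ?; lip.
have v3L : Lip v3 by apply: Lip_sum => i _; exact: v3t.
have v4t (i : 'I_m) : Lip (fun w => `|c i m1 w| * `|rho i n w|).
  by have := cL i m1; have := rhoL i n => ? ?; lip.
have v4L : Lip v4 by apply: Lip_sum => i _; exact: v4t.
have v5t (i : 'I_m) : Lip (fun w => (s i.+1 - s i) *
    (`|A i n w - B i n w| + `|A' i n w - B' i n w|)).
  by have [? ? ? ?] := ABL i; lip.
have v5L : Lip v5 by rewrite /v5; apply: Lip_mul; [lip|apply: Lip_sum => i _; exact: v5t].
have v1_0 w : 0 <= v1 w by exact: sumr_ge0.
have v2_0 w : 0 <= v2 w by exact: sumr_ge0.
have v3_0 w : 0 <= v3 w by apply: sumr_ge0 => i _; rewrite !mulr_ge0.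
have v4_0 w : 0 <= v4 w by apply: sumr_ge0 => i _; rewrite mulr_ge0.
have v5_0 w : 0 <= v5 w.
  by apply: mulr_ge0 => //; apply: sumr_ge0 => i _; apply: mulr_ge0 => //; exact: addr_ge0.
have u1_0 w : 0 <= u1 w.
  by apply: mulr_ge0 => //; apply: sumr_ge0 => i _; rewrite mulr_ge0.
exists u1, (fun w => v1 w + v2 w + v3 w + v4 w + v5 w); split; try by lip.
- move=> w; rewrite [X in _ <= X + _]ger0_norm// [X in _ <= _ + X]ger0_norm ?addr_ge0//.
  pose dq i := q (s i.+1) n w - q (s i) n w.
  have key : \sum_(k < sp_size eta) prd eta t k m1 n w -
      \sum_(k < sp_size eta') prd eta' t' k m1 n w = \sum_(i < m) c i m1 w * dq i.
    rewrite /prd (elementary_sum_grid (fun y => q y n w) (fun k => sp_coef eta k m1 w) es sS tG eG).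
    rewrite (elementary_sum_grid (fun y => q y n w) (fun k => sp_coef eta' k m1 w) es' sS t'G e'G).
    by rewrite -sumrB; apply: eq_bigr => i _; rewrite -mulrBl.
  have -> : \sum_(k < sp_size eta) P k n w - \sum_(k < sp_size eta') P' k n w =
     \sum_(i < m) c i m1 w * dq i +
     (\sum_(k < sp_size eta') (prd eta' t' k m1 n w - P' k n w) -
      \sum_(k < sp_size eta) (prd eta t k m1 n w - P k n w)).
    by rewrite -key !sumrB; ring.
  have n1 : `|\sum_(k < sp_size eta) (prd eta t k m1 n w - P k n w)| <= v1 w.
    exact: ler_norm_sum.
  have n2 : `|\sum_(k < sp_size eta') (prd eta' t' k m1 n w - P' k n w)| <= v2 w.
    exact: ler_norm_sum.
  have n3 : `|\sum_(i < m) c i m1 w * dq i| <= v3 w + v4 w + v5 w + u1 w.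
    apply: le_trans (ler_norm_sum _ _ _) _.
    rewrite /v3 /v4 /v5 /u1 !mulr_sumr -!big_split /=; apply: ler_sum => i _.
    rewrite normrM; have dqi : `|dq i| <= Kq * (s i.+1 - s i) + rho i n w.
      by rewrite -lerBlDl /rho le_max lexx orbT.
    rewrite (ger0_norm (rho0 i n w)).
    set cm := `|c i m1 w|; set dc := `|c i m1 w - c i n w|.
    set a := `|A i n w - B i n w|; set a' := `|A' i n w - B' i n w|.
    set b := `|B i n w - B' i n w|.
    have cmb : cm <= dc + (a + a' + b).
      apply: le_trans (_ : dc + `|c i n w| <= _).
        by have := ler_normD (c i m1 w - c i n w) (c i n w); rewrite subrK.
      rewrite lerD2l (_ : c i n w = (A i n w - B i n w) - (A' i n w - B' i n w) +
        (B i n w - B' i n w)); last by rewrite /c; ring.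
      apply: le_trans (ler_normD _ _) _; rewrite lerD2r; exact: ler_normB.
    have KD : 0 <= Kq * (s i.+1 - s i) by rewrite mulr_ge0.
    have i1 : cm * `|dq i| <= cm * (Kq * (s i.+1 - s i) + rho i n w).
      by apply: ler_wpM2l => //; exact: normr_ge0.
    have i2 : Kq * (s i.+1 - s i) * cm <= Kq * (s i.+1 - s i) * (dc + (a + a' + b)).
      exact: ler_wpM2l.
    apply: le_trans i1 _; rewrite mulrDr [cm * (_ * _)]mulrC.
    apply: le_trans (lerD i2 (lexx _)) _.
    by rewrite le_eqVlt; apply/orP; left; apply/eqP; ring.
  have := ler_normD (\sum_(i < m) c i m1 w * dq i)
    (\sum_(k < sp_size eta') (prd eta' t' k m1 n w - P' k n w) -
      \sum_(k < sp_size eta) (prd eta t k m1 n w - P k n w)).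
  have := ler_normB (\sum_(k < sp_size eta') (prd eta' t' k m1 n w - P' k n w))
    (\sum_(k < sp_size eta) (prd eta t k m1 n w - P k n w)).
  lra.
- pose sq (i : 'I_m) w := (s i.+1 - s i) * (B i n w - B' i n w) ^+ 2.
  have sqL i : true -> Lip (sq i) by move=> _; have [? ? ? ?] := ABL i; rewrite /sq; lip.
  have SL : Lip (fun w => \sum_(i < m) sq i w) by apply: Lip_sum => i _; exact: sqL.
  apply: le_trans (_ : Kq ^+ 2 * S * E (fun w => \sum_(i < m) sq i w) <= _).
    apply: (E_dom1 HE) => //; first by lip.
    move=> w; rewrite /u1 exprMn -[leRHS]mulrA; apply: ler_wpM2l; first exact: sqr_ge0.
    have := @sqr_sum_weighted R 'I_m (fun i => s i.+1 - s i) (fun i => `|B i n w - B' i n w|) D0.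
    rewrite sumD => /le_trans; apply; rewrite ler_wpM2l//.
    by apply: ler_sum => i _; rewrite real_normK ?num_real.
  have h7 : E (fun w => \sum_(i < m) sq i w) <= gint + e1.
    apply: le_trans (@E_sum _ _ _ _ HE _ (index_enum 'I_m) _ _ sqL) _.
    apply: le_trans g6; apply: ler_sum => i _.
    by rewrite /sq (E_scale HE)//; have [? ? ? ?] := ABL i; lip.
  apply: le_trans (ler_wpM2l KS h7) _; rewrite mulrDr lerD2l.
  have := e1E; have : 0 <= Kq * e1 by rewrite mulr_ge0// ltW.
  have : 0 <= 4 * Kq * eps by rewrite !mulr_ge0// ltW.
  have := e10; set z := Kq ^+ 2 * S * e1; lra.
- under eq_fun do rewrite ger0_norm ?addr_ge0//.
  have E1 : E v1 <= e1.
    apply: le_trans g1; apply: (@E_sum _ _ _ _ HE _ (index_enum _) xpredT) => k _; exact: dL1.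
  have E2 : E v2 <= e1.
    apply: le_trans g2; apply: (@E_sum _ _ _ _ HE _ (index_enum _) xpredT) => k _; exact: dL2.
  have E3 : E v3 <= e1.
    apply: le_trans (@E_sum _ _ _ _ HE _ (index_enum _) xpredT _ (fun i _ => v3t i)) _.
    apply: le_trans g3; apply: ler_sum => i _; rewrite (E_scale HE) ?mulr_ge0//.
    by have := cL i m1; have := cL i n => ? ?; lip.
  have E4 : E v4 <= e1.
    apply: le_trans g4; apply: (@E_sum _ _ _ _ HE _ (index_enum _) xpredT) => k _; exact: v4t.
  have E5 : E v5 <= Kq * (4 * eps + e1).
    rewrite /v5 (E_scale HE)//; last by apply: Lip_sum => i _; exact: v5t.
    rewrite ler_wpM2l//.
    apply: le_trans (@E_sum _ _ _ _ HE _ (index_enum _) xpredT _ (fun i _ => v5t i)) _.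
    apply: le_trans g5; apply: ler_sum => i _; have [? ? ? ?] := ABL i.
    rewrite (E_scale HE)//; last by lip.
    rewrite ler_wpM2l// p1; apply: (E_add HE); lip.
  apply: le_trans (E_add HE _ _) _; try by lip.
  have F4 : E (fun w => v1 w + v2 w + v3 w + v4 w) <= 4 * e1.
    apply: le_trans (E_add HE _ _) _; try by lip.
    have F3 : E (fun w => v1 w + v2 w + v3 w) <= 3 * e1.
      apply: le_trans (E_add HE _ _) _; try by lip.
      have : E (fun w => v1 w + v2 w) <= E v1 + E v2 by apply: (E_add HE).
      lra.
    lra.
  have : 0 <= Kq ^+ 2 * S * e1 by rewrite mulr_ge0// ltW.
  have := e1E; move: E5; rewrite mulrDr; set z := Kq ^+ 2 * S * e1; lra.
Unshelve. all: by end_near. Qed.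

End QuadraticVariationIntegral.

End OnePair.

Lemma ito_elem_LG T1 a eta1 (t1 : R) : is_simple E 2 T1 eta1 -> 0 <= t1 ->
  LG E 2 (ito_elem a eta1 t1).
Proof.
move=> e1s t10; apply: (LG_sum HE) => // k _.
have [_ _ /(_ k (ltn_ord k)) tk /(_ k (ltn_ord k)) [ckL ckC]] := e1s.
have /andP[x0 _] := sp_time_bounds e1s (ltnW (ltn_ord k)).
have [tt|tt] := leP t1 (sp_time eta1 k).
  rewrite (_ : (fun n w => _) = fun _ _ => 0).
    by split=> [n|]; [exact: Lip_cst|exact: (LG_cauchy_cst HE)].
  apply/funext => n; apply/funext => w.
  by rewrite min_l ?subrr ?mulr0// (le_trans tt (ltW tk)).
set x := sp_time eta1 k in x0 tt *; set y := Num.min _ _.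
have xy : 0 <= x <= y by rewrite x0 /y le_min (ltW tt) (ltW tk).
split=> [n|e e0]; first by have := Lip_upto_Lip (ckL n) => ?; lip.
have M1 : 0 < K * (y - x) + 1 by rewrite ltr_wpDl// mulr_ge0// subr_ge0; case/andP: xy.
have e1 : 0 < e / (K * (y - x) + 1) by rewrite divr_gt0.
have [n0 n0P] := ckC _ e1; exists n0 => m n mn0 nn0.
have h := n0P m n mn0 nn0.
have ckm := ckL m; have ckn := ckL n.
pose X w := `|sp_coef eta1 k m w - sp_coef eta1 k n w| ^+ 2.
have XL : Lip_upto x X by rewrite /X; lip.
have X0 w : 0 <= X w by exact: exprn_ge0.
have -> : (fun w => `|sp_coef eta1 k m w * (w y 0 a - w x 0 a) -
    sp_coef eta1 k n w * (w y 0 a - w x 0 a)| ^+ 2) =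
  (fun w => X w * (w y 0 a - w x 0 a) ^+ 2).
  apply/funext => w; rewrite -mulrBl normrM exprMn; congr (_ * _).
  by rewrite real_normK ?num_real.
apply: le_lt_trans (E_increment_sqr HE K0 variance a xy XL X0) _.
have EX0 : 0 <= E X by apply: (E_ge0 HE) => //; exact: Lip_upto_Lip XL.
apply: le_lt_trans (_ : (K * (y - x) + 1) * E X < _).
  by rewrite ler_wpM2r// lerDl.
by rewrite mulrC -ltr_pdivlMr.
Qed.

Lemma sub_near (Z Z' W W' : nat -> Om -> R) e : (forall n, Lip (Z n)) ->
  (forall n, Lip (Z' n)) -> (forall n, Lip (W n)) -> (forall n, Lip (W' n)) ->
  (\forall n \near \oo, E (fun w => `|Z n w - W n w|) <= e / 2) ->
  (\forall n \near \oo, E (fun w => `|Z' n w - W' n w|) <= e / 2) ->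
  \forall n \near \oo, E (fun w => `|(W n w - W' n w) - (Z n w - Z' n w)|) <= e.
Proof.
move=> ZL Z'L WL W'L; apply: filterS2 => n h h'.
apply: le_trans (_ : E (fun w => `|Z n w - W n w| + `|Z' n w - W' n w|) <= _).
  apply: (E_le HE); try by lip.
  move=> w; rewrite (_ : _ - _ = (Z' n w - W' n w) - (Z n w - W n w)); last by ring.
  by rewrite [leRHS]addrC; exact: ler_normB.
by apply: le_trans (E_add HE _ _) _; try lip; lra.
Qed.

Lemma L1_of_L2_near (Z W : nat -> Om -> R) e : (forall n, Lip (Z n)) ->
  (forall n, Lip (W n)) -> 0 < e ->
  (\forall n \near \oo, E (fun w => `|Z n w - W n w| ^+ 2) <= (e / 2) ^+ 2) ->
  \forall n \near \oo, E (fun w => `|Z n w - W n w|) <= e.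
Proof.
move=> ZL WL e0; apply: filterS => n h; have e2 : 0 < e / 2 by rewrite divr_gt0.
have XL : Lip (fun w => Z n w - W n w) by lip.
apply: le_trans (E_abs_le_sqr HE e2 XL) _.
have : (e / 2)^-1 * E (fun w => (Z n w - W n w) ^+ 2) <= e / 2.
  rewrite ler_pdivrMl// -expr2; apply: le_trans h.
  by apply: (E_le HE); try lip; move=> w; rewrite real_normK ?num_real.
lra.
Qed.

(** Ito isometry for limits: the distance of two integrals is controlled by that of
   the integrands. The factor [3] comes from the splitting into three errors, two
   of which vanish in the limit. *)
Lemma ito_compare a (etas etas' : nat -> simple d R) (I I' : nat -> Om -> R) :
  Mbar_cvg E 2 T etas Y -> Mbar_cvg E 2 T' etas' Y' -> LG E 2 I -> LG E 2 I' ->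
  LG_cvg E 2 (fun k => ito_elem a (etas k) t) I ->
  LG_cvg E 2 (fun k => ito_elem a (etas' k) t') I' ->
  weakL2 E (3 * K * gint) (fun n w => I n w - I' n w).
Proof.
move=> M M' IG I'G cI cI'; have [es YG em _] := M; have [es' Y'G em' _] := M'.
have [/andP[t0 _] /andP[t'0 _]] := (tT, t'T').
have IkG k := ito_elem_LG a (es k) t0; have I'kG k := ito_elem_LG a (es' k) t'0.
have IL := IG.1; have I'L := I'G.1.
have IkL k n := (IkG k).1 n; have I'kL k n := (I'kG k).1 n.
apply: (weakL2_lim HE) => [n|e e0]; first by lip.
pose eps := e / (24 * K + 1); have K1 : 0 < 24 * K + 1 by rewrite ltr_wpDl// mulr_ge0.
have eps0 : 0 < eps by rewrite divr_gt0.
have e2 : 0 < e / 2 by rewrite divr_gt0.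
have e3 : 0 < (e / 2 / 2) ^+ 2 by rewrite exprn_gt0// divr_gt0.
have [k1 _ k1P] := Mbar_near M eps0; have [k2 _ k2P] := Mbar_near M' eps0.
have [k3 _ k3P] := LG_cvg_near HE (isT : (1 <= 2 <= 2)%N) IkG IG cI e3.
have [k4 _ k4P] := LG_cvg_near HE (isT : (1 <= 2 <= 2)%N) I'kG I'G cI' e3.
pose k := maxn (maxn k1 k2) (maxn k3 k4).
have kk1 : (k1 <= k)%N by rewrite /k !leq_max leqnn.
have kk2 : (k2 <= k)%N by rewrite /k !leq_max leqnn orbT.
have kk3 : (k3 <= k)%N by rewrite /k !leq_max leqnn !orbT.
have kk4 : (k4 <= k)%N by rewrite /k !leq_max leqnn !orbT.
exists (fun n w => ito_elem a (etas k) t n w - ito_elem a (etas' k) t' n w).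
  by move=> n; have := IkL k n; have := I'kL k n => ? ?; lip.
have c1 := L1_of_L2_near (IkL k) IL e2 (k3P k kk3).
have c2 := L1_of_L2_near (I'kL k) I'L e2 (k4P k kk4).
have c3 := sub_near (IkL k) (I'kL k) IL I'L c1 c2.
have c4 := ito_elem_compare (isT : (1 <= 2 <= 2)%N) (es k) (es' k) YG Y'G (em k) (em' k)
  (k1P k kk1) (k2P k kk2) eps0 a (erefl _) e2.
apply: filterS2 c3 c4 => n d3 d4; split=> //.
apply: (L2_close_sqr HE); rewrite ?(ltW e0)//.
  by have := IkL k n; have := I'kL k n => ? ?; lip.
apply: le_trans d4 _; rewrite mulrDr.
have : 3 * K * (4 * eps) <= e / 2.
  have -> : e / 2 = (24 * K + 1) * eps / 2 by rewrite /eps; field; rewrite gt_eqF.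
  by have := eps0; nra.
lra.
Qed.

(** The analogue for integrators that move at bounded speed [Kq]; the Cauchy-Schwarz
   inequality in time gives the factor [S]. *)
Lemma qv_compare q Kq (etas etas' : nat -> simple d R) (J J' : nat -> nat -> Om -> R)
    (I I' : nat -> Om -> R) :
  0 <= Kq -> (forall r, 0 <= r -> LG E 2 (q r)) ->
  (forall r r', 0 <= r <= r' -> forall e, 0 < e -> \forall n \near \oo,
    E (fun w => Num.max 0 (`|q r' n w - q r n w| - Kq * (r' - r)) ^+ 2) <= e) ->
  Mbar_cvg E 1 T etas Y -> Mbar_cvg E 1 T' etas' Y' -> LG E 1 I -> LG E 1 I' ->
  (forall k, qv_elem E q (etas k) t (J k)) -> (forall k, qv_elem E q (etas' k) t' (J' k)) ->
  LG_cvg E 1 J I -> LG_cvg E 1 J' I' ->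
  weakL2 E (Kq ^+ 2 * S * gint) (fun n w => I n w - I' n w).
Proof.
move=> Kq0 qLG q_speed M M' IG I'G JE J'E cI cI'.
have [es YG em _] := M; have [es' Y'G em' _] := M'.
have qvG eta1 t1 J1 : qv_elem E q eta1 t1 J1 -> LG E 1 J1.
  by move=> [P [PM ->]]; apply: (LG_sum HE) => // k _; have [] := PM k (ltn_ord k).
have JkG k := qvG _ _ _ (JE k); have J'kG k := qvG _ _ _ (J'E k).
have IL := IG.1; have I'L := I'G.1.
have JkL k n := (JkG k).1 n; have J'kL k n := (J'kG k).1 n.
apply: (weakL2_lim HE) => [n|e e0]; first by lip.
pose eps := e / (8 * Kq + 1); have K1 : 0 < 8 * Kq + 1 by rewrite ltr_wpDl// mulr_ge0.
have eps0 : 0 < eps by rewrite divr_gt0.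
have e2 : 0 < e / 2 by rewrite divr_gt0.
have [k1 _ k1P] := Mbar_near M eps0; have [k2 _ k2P] := Mbar_near M' eps0.
have [k3 _ k3P] := LG_cvg_near HE (isT : (1 <= 1 <= 2)%N) JkG IG cI e2.
have [k4 _ k4P] := LG_cvg_near HE (isT : (1 <= 1 <= 2)%N) J'kG I'G cI' e2.
pose k := maxn (maxn k1 k2) (maxn k3 k4).
have kk1 : (k1 <= k)%N by rewrite /k !leq_max leqnn.
have kk2 : (k2 <= k)%N by rewrite /k !leq_max leqnn orbT.
have kk3 : (k3 <= k)%N by rewrite /k !leq_max leqnn !orbT.
have kk4 : (k4 <= k)%N by rewrite /k !leq_max leqnn !orbT.
exists (fun n w => J k n w - J' k n w).
  by move=> n; have := JkL k n; have := J'kL k n => ? ?; lip.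
have c3 := sub_near (JkL k) (J'kL k) IL I'L (k3P k kk3) (k4P k kk4).
have c4 := qv_elem_compare (isT : (1 <= 1 <= 2)%N) (es k) (es' k) YG Y'G (em k) (em' k)
  (k1P k kk1) (k2P k kk2) eps0 Kq0 qLG q_speed (erefl _) (JE k) (J'E k) e2.
apply: filterS2 c3 c4 => n d3 [u1 [v1 [uL vL uv uc vc]]]; split=> //.
have : 4 * Kq * eps <= e / 2.
  have -> : e / 2 = (8 * Kq + 1) * eps / 2 by rewrite /eps; field; rewrite gt_eqF.
  by have := eps0; nra.
by move=> h; exists u1, v1; split=> //; lra.
Qed.

End Comparison.
End StochasticIntegrals.

(** * The speed of the cross variation *)

Section CrossVariation.
Context (R : realType) (d : nat) (G : 'M[R]_d -> R).
Context (E : (C0path R d -> R) -> R) (HE : is_Gexpectation G E).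
Context (K : R) (K0 : 0 <= K).
Hypothesis mean0 : forall a (c s t : R), 0 <= s -> 0 <= t ->
  E (fun w => c * (w (t + s) 0 a - w t 0 a)) = 0.
Hypothesis variance : forall a (s t : R), 0 <= s -> 0 <= t ->
  E (fun w => (w (t + s) 0 a - w t 0 a) ^+ 2) <= K * s.
Hypothesis fourth : forall a (s t : R), 0 <= s -> 0 <= t ->
  E (fun w => (w (t + s) 0 a - w t 0 a) ^+ 4) <= 3 * (K * s) ^+ 2.
Local Notation Om := (C0path R d).
Local Notation mu := (@lebesgue_measure R).

Lemma EG_zero p (Z : nat -> Om -> R) : (0 < p)%N ->
  EG E (fun n w => `|Z n w - Z n w| ^+ p) = 0.
Proof.
move=> p0; rewrite /EG (_ : (fun n => _) = fun=> 0); first exact: lim_cst.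
apply/funext => n; rewrite -[RHS](E_cst HE); congr E; apply/funext => w.
by rewrite subrr normr0 expr0n gtn_eqF.
Qed.

Lemma Mbar_const p T (zeta : simple d R) : (0 < p)%N -> is_simple E p T zeta ->
  Mbar_cvg E p T (fun=> zeta) (sp_eval zeta).
Proof.
move=> p0 zs.
have err0 : (fun t => EG E (fun n w => `|sp_eval zeta t n w - sp_eval zeta t n w| ^+ p)) = cst 0.
  by apply/funext => t; rewrite EG_zero.
split=> //.
- by move=> t _; exact: (sp_eval_LG HE _ p0 zs).
- by move=> k; rewrite err0; exact: measurable_cst.
- rewrite (_ : (fun k => _) = cst 0%E); first exact: cvg_cst.
  apply/funext => k; rewrite -[RHS](integral0 mu `[0%R, T]).
  by apply: eq_integral => t _; rewrite EG_zero.
Qed.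

Lemma LG_cvg_const p (Z : nat -> Om -> R) : (0 < p)%N -> LG_cvg E p (fun=> Z) Z.
Proof.
move=> p0; rewrite /LG_cvg (_ : (fun k => _) = cst 0); first exact: cvg_cst.
by apply/funext => k; rewrite EG_zero.
Qed.

Definition sampled_path (s : nat -> R) (m : nat) (a : 'I_d) : simple d R :=
  Simple m s (fun j n w => w (s j) 0 a).

Lemma sampled_path_simple s m a : is_grid s m -> s 0%N = 0 ->
  is_simple E 2 (s m) (sampled_path s m a).
Proof.
move=> sS s0; split=> // k km; split=> [n /=|].
  by apply: Lip_upto_coord; rewrite lexx andbT -s0; apply: (grid_le sS); rewrite (ltnW km).
exact: (LG_cauchy_cst HE).
Qed.

Lemma E_sqr_add (X Y : Om -> R) : Lip X -> Lip Y ->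
  E (fun w => (X w + Y w) ^+ 2) <= 2 * E (fun w => X w ^+ 2) + 2 * E (fun w => Y w ^+ 2).
Proof.
move=> XL YL; apply: (E_dom2 HE) => //; try by lip.
move=> w; rewrite -subr_ge0 (_ : _ - _ = (X w - Y w) ^+ 2) ?sqr_ge0//; ring.
Qed.

(** Within a cell the path has moved by a square mean of at most [K delta], so that
   the integral of the path is close to that of its sampling. *)
Lemma ito_sampled_near s m a c r (I : nat -> Om -> R) (T delta : R) :
  is_grid s m -> s 0%N = 0 -> s m = T -> 0 <= r <= T ->
  (forall j, (j < m)%N -> s j.+1 - s j <= delta) -> 0 <= delta ->
  ito_integral_of E c r (coordB a) r I ->
  forall e, 0 < e -> \forall n \near \oo,
    E (fun w => (I n w - ito_elem c (sampled_path s m a) r n w) ^+ 2) <=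
      12 * K ^+ 2 * delta * T + e.
Proof.
move=> sS s0 sm rT sd delta0 [eta [M [_ IG cI]]] e e0.
have [r0 rT1] := andP rT; have T0 := le_trans r0 rT1.
have zs := sampled_path_simple a sS s0; rewrite sm in zs.
have zM := Mbar_const (isT : (0 < 2)%N) zs.
have zG := ito_elem_LG HE K0 variance c zs r0.
have rr : 0 <= r <= r by rewrite r0 lexx.
pose u (k : nat) : R := if k is 0 then 0 else T.
have uS k : (k <= 1)%N -> 0 <= u k <= T by case: k => [|k] _ /=; rewrite ?lexx ?T0.
have u_nd k : (k < 1)%N -> u k <= u k.+1 by case: k.
have step x : 0 <= x < T -> step_fun u 1 (fun=> K * delta) x = K * delta.
  by move=> xT; rewrite /step_fun big_ord1 /= xT mul1r.
have Hg x : 0 <= x < T -> forall e, 0 < e -> \forall n \near \oo,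
    E (fun w => (stop (coordB a) r x n w - stop (sp_eval (sampled_path s m a)) r x n w) ^+ 2) <=
    step_fun u 1 (fun=> K * delta) x + e.
  move=> xT e1 e10; rewrite step//; near=> n.
  have Kd : 0 <= K * delta by rewrite mulr_ge0.
  rewrite /stop; case: (x < r); last first.
    rewrite (_ : (fun w => _) = fun=> 0) ?(E_cst HE) ?addr_ge0 ?(ltW e10)//.
    by apply/funext => w; rewrite !mul0r subrr expr0n.
  have [j jm /andP[sx xs]] : exists2 j, (j < m)%N & s j <= x < s j.+1.
    by apply: grid_locate => //; rewrite s0 sm.
  have sj0 : 0 <= s j by rewrite -s0; apply: (grid_le sS); rewrite (ltnW jm).
  have xj0 : 0 <= x - s j by rewrite subr_ge0.
  have := variance a xj0 sj0; rewrite subrKC => v.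
  apply: le_trans (_ : K * (x - s j) <= _).
    apply: le_trans v; rewrite le_eqVlt; apply/orP; left; apply/eqP; congr E.
    apply/funext => w; rewrite !mul1r /coordB; congr ((_ - _) ^+ 2).
    rewrite -[LHS]/(step_fun s m (fun k => w (s k) 0 a) x).
    by rewrite (step_fun_at _ sS jm) ?sx.
  apply: le_trans (_ : K * delta <= _); last by rewrite lerDl ltW.
  by rewrite ler_wpM2l//; have := sd j jm; lra.
have weak := ito_compare HE K0 mean0 variance rT1 (lexx T) rr rT uS u_nd Hg M zM IG zG cI
  (LG_cvg_const _ (isT : (0 < 2)%N)).
have c0 : 0 <= 3 * K * \sum_(k < 1) K * delta * (u k.+1 - u k).
  by rewrite big_ord1 /= subr0 !mulr_ge0.
apply: filterS (weakL2_fatou HE c0 (LG_sub HE IG zG) weak e0) => n /le_trans; apply.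
rewrite big_ord1 /= subr0 lerD2r le_eqVlt; apply/orP; left; apply/eqP; ring.
Unshelve. all: by end_near. Qed.

Variable Q : 'I_d -> 'I_d -> R -> nat -> Om -> R.
Hypothesis QV : is_cross_variation E Q.

(** The cross variation moves at speed at most [K]: its increments are limits of
   sums of products of increments of the paths, which are dominated by the sums
   of squared increments, and these exceed [K] times the elapsed time by a
   quantity that vanishes with the mesh. *)
Lemma cross_variation_speed a c (r T : R) : 0 <= r <= T -> forall e, 0 < e ->
  \forall n \near \oo,
    E (fun w => Num.max 0 (`|Q a c T n w - Q a c r n w| - K * (T - r)) ^+ 2) <= e.
Proof.
move=> rT e e0; have [r0 rT1] := andP rT; have T0 := le_trans r0 rT1.
pose X := 32 * 32 * K ^+ 2 * T ^+ 2 * 2 / e.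
have X0 : 0 <= X.
  by apply: divr_ge0; [do 4?apply: mulr_ge0 => //; exact: sqr_ge0|exact: ltW].
pose M := Num.bound X; have XM : X < M%:R by exact: archi_boundP.
have M0 : 0 < M.+1%:R :> R by [].
have XM1 : 32 * 32 * K ^+ 2 * (T / M.+1%:R) * T <= e / 2.
  rewrite (_ : 32 * 32 * K ^+ 2 * (T / M.+1%:R) * T = (e / 2 * X) / M.+1%:R); last first.
    by rewrite /X; field; rewrite (gt_eqF M0) gt_eqF.
  rewrite ler_pdivrMr// ler_wpM2l ?divr_ge0 ?(ltW e0)//.
  by apply: le_trans (ltW XM) _; rewrite ler_nat.
have [s [m [sS s0 sm rG sd]]] := fine_grid M rT.
set delta := T / M.+1%:R in XM1 sd.
have delta0 : 0 <= delta by rewrite divr_ge0.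
have TT : 0 <= T <= T by rewrite T0 lexx.
have [QTG [I [J [II JJ QTE]]]] := QV a c T0.
have [QrG [I' [J' [II' JJ' QrE]]]] := QV a c r0.
have e1 : 0 < e / 20 / 20 by rewrite !divr_gt0.
have n1 := ito_sampled_near sS s0 sm TT sd delta0 II e1.
have n2 := ito_sampled_near sS s0 sm TT sd delta0 JJ e1.
have n3 := ito_sampled_near sS s0 sm rT sd delta0 II' e1.
have n4 := ito_sampled_near sS s0 sm rT sd delta0 JJ' e1.
have n5 := LG_eq_near QTE e1; have n6 := LG_eq_near QrE e1.
have zs b := sampled_path_simple b sS s0; rewrite sm in zs.
near=> n.
set tau := 12 * K ^+ 2 * delta * T + e / 20 / 20.
have h1 : E (fun w => (I n w - ito_elem c (sampled_path s m a) T n w) ^+ 2) <= tau by near: n.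
have h2 : E (fun w => (J n w - ito_elem a (sampled_path s m c) T n w) ^+ 2) <= tau by near: n.
have h3 : E (fun w => (I' n w - ito_elem c (sampled_path s m a) r n w) ^+ 2) <= tau by near: n.
have h4 : E (fun w => (J' n w - ito_elem a (sampled_path s m c) r n w) ^+ 2) <= tau by near: n.
have KdT : 0 <= K ^+ 2 * delta * T by rewrite !mulr_ge0// sqr_ge0.
have tau_ge : e / 20 / 20 <= tau.
  rewrite /tau (_ : 12 * K ^+ 2 * delta * T = 12 * (K ^+ 2 * delta * T)); last by ring.
  by rewrite lerDr mulr_ge0.
have h5 : E (fun w => (Q a c T n w - (w T 0 a * w T 0 c - I n w - J n w)) ^+ 2) <= tau.
  rewrite -(E_norm_sqr E); by apply: le_trans tau_ge; near: n.
have h6 : E (fun w => (Q a c r n w - (w r 0 a * w r 0 c - I' n w - J' n w)) ^+ 2) <= tau.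
  rewrite -(E_norm_sqr E); by apply: le_trans tau_ge; near: n.
have IL : Lip (I n) by have [? [_ [_ [+ _] _]]] := II; apply.
have JL : Lip (J n) by have [? [_ [_ [+ _] _]]] := JJ; apply.
have I'L : Lip (I' n) by have [? [_ [_ [+ _] _]]] := II'; apply.
have J'L : Lip (J' n) by have [? [_ [_ [+ _] _]]] := JJ'; apply.
have QTL : Lip (Q a c T n) by exact: QTG.1.
have QrL : Lip (Q a c r n) by exact: QrG.1.
have zL b b' (t : R) : 0 <= t -> Lip (ito_elem b' (sampled_path s m b) t n).
  by move=> t0; exact: (ito_elem_LG HE K0 variance b' (zs b) t0).1.
have z1 := zL a c T T0; have z2 := zL c a T T0.
have z3 := zL a c r r0; have z4 := zL c a r r0.
pose beta j := r <= s j.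
pose P (b : 'I_d) (w : Om) : R := Num.max 0 (\sum_(j < m) (beta j)%:R *
  ((w (s j.+1) 0 b - w (s j) 0 b) ^+ 2 - K * (s j.+1 - s j))).
pose err (w : Om) : R := (Q a c T n w - (w T 0 a * w T 0 c - I n w - J n w))
  + - (Q a c r n w - (w r 0 a * w r 0 c - I' n w - J' n w))
  + ((- (I n w - ito_elem c (sampled_path s m a) T n w) +
      (I' n w - ito_elem c (sampled_path s m a) r n w)) +
     (- (J n w - ito_elem a (sampled_path s m c) T n w) +
      (J' n w - ito_elem a (sampled_path s m c) r n w))).
have PL b : Lip (P b) by rewrite /P; lip.
have errL : Lip err by rewrite /err; lip.
have mesh : \sum_(j < m) (s j.+1 - s j) ^+ 2 <= delta * T.
  apply: le_trans (_ : \sum_(j < m) delta * (s j.+1 - s j) <= _).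
    apply: ler_sum => j _; rewrite expr2 ler_wpM2r ?sd//.
    by rewrite subr_ge0 ltW// sS.
  by rewrite -mulr_sumr -(big_mkord xpredT (fun i => s i.+1 - s i)) telescope_sumr// s0 sm subr0.
have P2 b : E (fun w => P b w ^+ 2) <= 4 * K ^+ 2 * (delta * T).
  have s0' : 0 <= s 0%N by rewrite s0.
  have s_le i : (i < m)%N -> s i <= s i.+1 by move=> im; apply/ltW/sS.
  apply: le_trans (square_excess_L2 HE K0 variance fourth beta b s0' s_le) _.
  by rewrite ler_wpM2l// mulr_ge0// sqr_ge0.
have sqrN (x : Om -> R) : E (fun w => (- x w) ^+ 2) = E (fun w => x w ^+ 2).
  by congr E; apply/funext => w; rewrite sqrrN.
have err2 : E (fun w => err w ^+ 2) <= 40 * tau.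
  apply: le_trans (E_sqr_add _ _) _; try by lip.
  set x1 := E _; set x2 := E _.
  have g1 : x1 <= 4 * tau.
    apply: le_trans (E_sqr_add _ _) _; try by lip.
    by rewrite sqrN; lra.
  have g2 : x2 <= 16 * tau.
    apply: le_trans (E_sqr_add _ _) _; try by lip.
    set y1 := E _; set y2 := E _.
    have g3 : y1 <= 4 * tau.
      apply: le_trans (E_sqr_add _ _) _; try by lip.
      by rewrite sqrN; lra.
    have g4 : y2 <= 4 * tau.
      apply: le_trans (E_sqr_add _ _) _; try by lip.
      by rewrite sqrN; lra.
    lra.
  lra.
have key (w : Om) : Num.max 0 (`|Q a c T n w - Q a c r n w| - K * (T - r)) <=
    (P a w + P c w) / 2 + `|err w|.
  pose dB b j := w (s j.+1) 0 b - w (s j) 0 b.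
  have TG : on_grid s m T by exists m => //; rewrite sm.
  have late (f : R -> R) : \sum_(j < m) (beta j)%:R * (f (s j.+1) - f (s j)) = f T - f r.
    rewrite -(grid_telescope f sS rG TG rT1); apply: eq_bigr => j _.
    congr (_%:R * _); rewrite /beta; case: (r <= s j) => //=.
    by rewrite -sm (grid_lt sS)// ltn_ord leqnn.
  have itoE b b' : ito_elem b' (sampled_path s m b) T n w - ito_elem b' (sampled_path s m b) r n w =
      \sum_(j < m) (beta j)%:R * (w (s j) 0 b * dB b' j).
    rewrite /ito_elem /= -sumrB; apply: eq_bigr => j _.
    rewrite (grid_stop (fun x => w x 0 b') sS TG (ltn_ord j)).
    rewrite (grid_stop (fun x => w x 0 b') sS rG (ltn_ord j)) -/(dB b' j) /beta.
    have -> : s j < T by rewrite -sm (grid_lt sS)// ltn_ord leqnn.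
    by case: (leP r (s j)) => _ /=; rewrite ?mul1r ?mul0r ?mulr0 ?subr0 ?subrr.
  have QE : Q a c T n w - Q a c r n w =
      \sum_(j < m) (beta j)%:R * (dB a j * dB c j) + err w.
    have -> : \sum_(j < m) (beta j)%:R * (dB a j * dB c j) =
        (w T 0 a * w T 0 c - w r 0 a * w r 0 c) -
        (ito_elem c (sampled_path s m a) T n w - ito_elem c (sampled_path s m a) r n w) -
        (ito_elem a (sampled_path s m c) T n w - ito_elem a (sampled_path s m c) r n w).
      rewrite !itoE -(late (fun x => w x 0 a * w x 0 c)) -!sumrB.
      by apply: eq_bigr => j _; rewrite /dB; ring.
    by rewrite /err; ring.
  have S1 : `|\sum_(j < m) (beta j)%:R * (dB a j * dB c j)| <=
      \sum_(j < m) (beta j)%:R * ((dB a j ^+ 2 + dB c j ^+ 2) / 2).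
    apply: le_trans (ler_norm_sum _ _ _) _; apply: ler_sum => j _.
    rewrite normrM ger0_norm// ler_wpM2l// ler_norml.
    have := sqr_ge0 (dB a j + dB c j); have := sqr_ge0 (dB a j - dB c j).
    by rewrite !expr2 => ? ?; apply/andP; split; lra.
  have S2 : \sum_(j < m) (beta j)%:R * ((dB a j ^+ 2 + dB c j ^+ 2) / 2) =
      (\sum_(j < m) (beta j)%:R * (dB a j ^+ 2 - K * (s j.+1 - s j)) +
       \sum_(j < m) (beta j)%:R * (dB c j ^+ 2 - K * (s j.+1 - s j))) / 2 + K * (T - r).
    rewrite -(late id) mulr_sumr -big_split /= mulr_suml -big_split /=.
    by apply: eq_bigr => j _; field.
  have Pa : \sum_(j < m) (beta j)%:R * (dB a j ^+ 2 - K * (s j.+1 - s j)) <= P a w.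
    by rewrite /P le_max lexx orbT.
  have Pc : \sum_(j < m) (beta j)%:R * (dB c j ^+ 2 - K * (s j.+1 - s j)) <= P c w.
    by rewrite /P le_max lexx orbT.
  have Pa0 : 0 <= P a w by rewrite /P le_max lexx.
  have Pc0 : 0 <= P c w by rewrite /P le_max lexx.
  have er0 := normr_ge0 (err w).
  rewrite ge_max; apply/andP; split; first by lra.
  have := ler_normD (\sum_(j < m) (beta j)%:R * (dB a j * dB c j)) (err w).
  rewrite -QE; lra.
apply: le_trans (_ : E (fun w => (P a w + P c w) ^+ 2 / 2 + 2 * err w ^+ 2) <= _).
  apply: (E_le HE); try by lip.
  move=> w; have kw := key w.
  apply: le_trans (_ : ((P a w + P c w) / 2 + `|err w|) ^+ 2 <= _).
    by apply: lerXn2r; rewrite ?nnegrE// ?le_max ?lexx//; apply: le_trans kw; rewrite le_max lexx.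
  rewrite -(@real_normK _ (err w)) ?num_real//; set x := P a w + P c w; set y := `|err w|.
  rewrite -subr_ge0 (_ : _ - _ = (x / 2 - y) ^+ 2) ?sqr_ge0//; by field.
apply: le_trans (E_add HE _ _) _; try by lip.
rewrite (E_scale HE)//; last by lip.
have PP : E (fun w => (P a w + P c w) ^+ 2 / 2) <= 8 * K ^+ 2 * (delta * T).
  rewrite (_ : (fun w => _) = (fun w => 2^-1 * (P a w + P c w) ^+ 2)); last first.
    by apply/funext => w; rewrite mulrC.
  rewrite (E_scale HE)//; last by have := PL a; have := PL c => ? ?; lip.
  have := E_sqr_add (PL a) (PL c); have := P2 a; have := P2 c.
  set x := E (fun w => P a w ^+ 2); set y := E (fun w => P c w ^+ 2); set z := E _.
  by set k := delta * T; lra.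
have := err2; rewrite /tau; lra.
Unshelve. all: by end_near. Qed.

End CrossVariation.

(** * Stability of Ito processes *)

Section ItoProcesses.
Context (R : realType) (d : nat) (G : 'M[R]_d -> R).
Context (E : (C0path R d -> R) -> R) (HE : is_Gexpectation G E).
Context (K : R) (K0 : 0 <= K).
Hypothesis mean0 : forall a (c s t : R), 0 <= s -> 0 <= t ->
  E (fun w => c * (w (t + s) 0 a - w t 0 a)) = 0.
Hypothesis variance : forall a (s t : R), 0 <= s -> 0 <= t ->
  E (fun w => (w (t + s) 0 a - w t 0 a) ^+ 2) <= K * s.
Local Notation Om := (C0path R d).
Local Notation mu := (@lebesgue_measure R).
Context (Q : 'I_d -> 'I_d -> R -> nat -> Om -> R).
Hypothesis Q_LG : forall a c r, 0 <= r -> LG E 2 (Q a c r).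
Hypothesis Q_speed : forall a c (r T : R), 0 <= r <= T -> forall e, 0 < e ->
  \forall n \near \oo,
    E (fun w => Num.max 0 (`|Q a c T n w - Q a c r n w| - K * (T - r)) ^+ 2) <= e.

(** An integral of [Y], known through the elementary integrals of some approximation
   of [Y]; the solution and the Euler scheme are integrals in this common sense. *)
Definition ito_limit a (Y : R -> nat -> Om -> R) (t : R) (I : nat -> Om -> R) :=
  exists etas, [/\ Mbar_cvg E 2 1 etas Y, LG E 2 I &
    LG_cvg E 2 (fun k => ito_elem a (etas k) t) I].

Definition qv_limit q (Y : R -> nat -> Om -> R) (t : R) (I : nat -> Om -> R) :=
  exists etas J, [/\ Mbar_cvg E 1 1 etas Y, LG E 1 I,
    forall k, qv_elem E q (etas k) t (J k) & LG_cvg E 1 J I].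

(** Time itself as an integrator, of speed [1]: the Lebesgue integral needs no
   separate treatment. *)
Definition clock (t : R) : nat -> Om -> R := fun _ _ => t.

(** The integral form of an Ito process at time [t]. The equality holds in [L^1]
   only, although [X] is in [L^2]. *)
Definition represents (x0 : R) (Yb : R -> nat -> Om -> R)
    (Yh : 'I_d -> 'I_d -> R -> nat -> Om -> R) (YV : 'I_d -> R -> nat -> Om -> R)
    (t : R) (X : nat -> Om -> R) :=
  LG E 2 X /\ exists Ib Ih IV, [/\ qv_limit clock Yb t Ib,
    forall a c, qv_limit (Q a c) (Yh a c) t (Ih a c),
    forall a, ito_limit a (YV a) t (IV a) &
    forall e, 0 < e -> \forall n \near \oo, E (fun w => `|X n w -
      (x0 + Ib n w + \sum_a \sum_c Ih a c n w + \sum_a IV a n w)|) <= e].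

Lemma clock_LG r : LG E 2 (clock r).
Proof. by split=> [n|]; [exact: Lip_cst|exact: (LG_cauchy_cst HE)]. Qed.

Lemma clock_speed (r r' : R) : 0 <= r <= r' -> forall e, 0 < e -> \forall n \near \oo,
  E (fun w => Num.max 0 (`|clock r' n w - clock r n w| - 1 * (r' - r)) ^+ 2) <= e.
Proof.
move=> /andP[_ rr] e e0; near=> n; rewrite (_ : (fun w => _) = fun=> 0).
  by rewrite (E_cst HE) ltW.
apply/funext => w; rewrite /clock ger0_norm ?subr_ge0// mul1r subrr maxxx.
by rewrite expr0n.
Unshelve. all: by end_near. Qed.

Lemma weakL2_add c c' (Z Z' : nat -> Om -> R) : weakL2 E c Z -> weakL2 E c' Z' ->
  weakL2 E (2 * (c + c')) (fun n w => Z n w + Z' n w).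
Proof.
move=> Zc Zc'; have H (b : bool) : weakL2 E (if b then c else c') (if b then Z else Z').
  by case: b.
have := weakL2_sum HE H; rewrite card_bool big_bool /=.
by congr weakL2; apply/funext => n; apply/funext => w; rewrite big_bool.
Qed.

(** The outer factor [4] is the price of passing from the weak square bound to a
   genuine one; the others come from the number of integrals that are added. *)
Definition stability_const : R :=
  4 * (2 * (2 * (1 + d%:R ^+ 2 * (d%:R ^+ 2 * K ^+ 2)) + d%:R ^+ 2 * (3 * K))).

Lemma stability_const_ge0 : 0 <= stability_const.
Proof.
rewrite /stability_const; have h : 0 <= d%:R ^+ 2 :> R by exact: sqr_ge0.
have k : 0 <= K ^+ 2 by exact: sqr_ge0.
have h1 : 0 <= d%:R ^+ 2 * (d%:R ^+ 2 * K ^+ 2) by rewrite !mulr_ge0.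
have h2 : 0 <= d%:R ^+ 2 * (3 * K) by rewrite !mulr_ge0.
by lra.
Qed.

(** Stability of Ito processes. The integrals are compared one by one in the weak
   sense, the equations carry the comparison over to [X - X'] in [L^1], and the
   Fatou property makes it strong. *)
Lemma represents_compare x0 Yb Yb' Yh Yh' YV YV' (t t' : R) X X' nu (u gv : nat -> R) :
  represents x0 Yb Yh YV t X -> represents x0 Yb' Yh' YV' t' X' ->
  0 <= t <= 1 -> 0 <= t' <= 1 ->
  (forall k, (k <= nu)%N -> 0 <= u k <= 1) -> (forall k, (k < nu)%N -> u k <= u k.+1) ->
  (forall k, (k < nu)%N -> 0 <= gv k) ->
  let close Y Y' := forall r, 0 <= r < 1 -> forall e, 0 < e -> \forall n \near \oo,
    E (fun w => (stop Y t r n w - stop Y' t' r n w) ^+ 2) <= step_fun u nu gv r + e in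
  close Yb Yb' -> (forall a c, close (Yh a c) (Yh' a c)) ->
  (forall a, close (YV a) (YV' a)) ->
  forall e, 0 < e -> \forall n \near \oo, E (fun w => (X n w - X' n w) ^+ 2) <=
    stability_const * (\sum_(k < nu) gv k * (u k.+1 - u k)) + e.
Proof.
move=> [XG [Ib [Ih [IV [[eb [Jb [Mb IbG Jb1 Jb2]]] hh hV Xeq]]]]].
move=> [X'G [Ib' [Ih' [IV' [[eb' [Jb' [Mb' Ib'G Jb1' Jb2']]] hh' hV' X'eq]]]]].
move=> tT t'T' uS u_nd gv0 close cb ch cV.
set g := \sum_(k < nu) _.
have g0 : 0 <= g.
  apply: sumr_ge0 => k _; apply: mulr_ge0; first exact: gv0.
  by rewrite subr_ge0; exact: u_nd.
have lex1 : (1 : R) <= 1 by [].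
have wb : weakL2 E g (fun n w => Ib n w - Ib' n w).
  have := qv_compare HE lex1 lex1 tT t'T' uS u_nd cb ler01 (fun r _ => clock_LG r)
    clock_speed Mb Mb' IbG Ib'G Jb1 Jb1' Jb2 Jb2'.
  by rewrite expr1n !mul1r.
have wh a c : weakL2 E (K ^+ 2 * g) (fun n w => Ih a c n w - Ih' a c n w).
  have [e1 [J1 [M1 G1 E1 C1]]] := hh a c; have [e2 [J2 [M2 G2 E2 C2]]] := hh' a c.
  have := qv_compare HE lex1 lex1 tT t'T' uS u_nd (ch a c) K0 (Q_LG a c)
    (Q_speed a c) M1 M2 G1 G2 E1 E2 C1 C2.
  by rewrite mulr1.
have wV a : weakL2 E (3 * K * g) (fun n w => IV a n w - IV' a n w).
  have [e1 [M1 G1 C1]] := hV a; have [e2 [M2 G2 C2]] := hV' a.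
  exact: (ito_compare HE K0 mean0 variance lex1 lex1 tT t'T' uS u_nd (cV a) M1 M2 G1 G2 C1 C2).
have wh' a : weakL2 E (d%:R ^+ 2 * (K ^+ 2 * g)) (fun n w => \sum_c (Ih a c n w - Ih' a c n w)).
  have := weakL2_sum HE (wh a).
  by rewrite sumr_const card_ord -[X in _ * X]mulr_natl mulrA -expr2.
have wh2 : weakL2 E (d%:R ^+ 2 * (d%:R ^+ 2 * (K ^+ 2 * g)))
    (fun n w => \sum_a \sum_c (Ih a c n w - Ih' a c n w)).
  have := weakL2_sum HE wh'.
  by rewrite sumr_const card_ord -[X in _ * X]mulr_natl mulrA -expr2.
have wV2 : weakL2 E (d%:R ^+ 2 * (3 * K * g)) (fun n w => \sum_a (IV a n w - IV' a n w)).
  have := weakL2_sum HE wV.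
  by rewrite sumr_const card_ord -[X in _ * X]mulr_natl mulrA -expr2.
have wA := weakL2_add (weakL2_add wb wh2) wV2.
set c := 2 * _ in wA.
have c0 : 0 <= c.
  have k : 0 <= K ^+ 2 by exact: sqr_ge0.
  have h : 0 <= d%:R ^+ 2 :> R by exact: sqr_ge0.
  by rewrite /c !(mulr_ge0, addr_ge0).
have -> : stability_const * g = 4 * c by rewrite /c /stability_const; ring.
have XL := XG.1; have X'L := X'G.1.
have IbL := IbG.1; have Ib'L := Ib'G.1.
have IhL a b n : Lip (Ih a b n) by have [? [? [_ [+ _] _ _]]] := hh a b; apply.
have Ih'L a b n : Lip (Ih' a b n) by have [? [? [_ [+ _] _ _]]] := hh' a b; apply.
have IVL a n : Lip (IV a n) by have [? [_ [+ _] _]] := hV a; apply.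
have IV'L a n : Lip (IV' a n) by have [? [_ [+ _] _]] := hV' a; apply.
have SL n : Lip (fun w => \sum_a \sum_c (Ih a c n w - Ih' a c n w)).
  apply: Lip_sum => a _; apply: Lip_sum => b _.
  by have := IhL a b n; have := Ih'L a b n => ? ?; lip.
have SVL n : Lip (fun w => \sum_a (IV a n w - IV' a n w)).
  by apply: Lip_sum => a _; have := IVL a n; have := IV'L a n => ? ?; lip.
apply: (weakL2_fatou HE c0 (LG_sub HE XG X'G)).
apply: (weakL2_lim HE) => [n|e e0]; first by lip.
exists (fun n w => Ib n w - Ib' n w + \sum_a \sum_c (Ih a c n w - Ih' a c n w) +
  \sum_a (IV a n w - IV' a n w)).
  by move=> n; have := SL n; have := SVL n => ? ?; lip.
have e2 : 0 < e / 2 by rewrite divr_gt0.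
have hS n : Lip (fun w => x0 + Ib n w + \sum_a \sum_c Ih a c n w + \sum_a IV a n w).
  apply: Lip_add; [apply: Lip_add; [lip|]|].
    by apply: Lip_sum => a _; apply: Lip_sum => b _; exact: IhL.
  by apply: Lip_sum => a _; exact: IVL.
have hS' n : Lip (fun w => x0 + Ib' n w + \sum_a \sum_c Ih' a c n w + \sum_a IV' a n w).
  apply: Lip_add; [apply: Lip_add; [lip|]|].
    by apply: Lip_sum => a _; apply: Lip_sum => b _; exact: Ih'L.
  by apply: Lip_sum => a _; exact: IV'L.
suff hX : \forall n \near \oo, E (fun w => `|X n w - X' n w - (Ib n w - Ib' n w +
    \sum_a \sum_c (Ih a c n w - Ih' a c n w) + \sum_a (IV a n w - IV' a n w))|) <= e.
  by apply: filterS2 (wA e e0) hX => n h1 h2.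
apply: filterS2 (Xeq _ e2) (X'eq _ e2) => n h1 h2.
apply: le_trans (_ : E (fun w =>
   `|X n w - (x0 + Ib n w + \sum_a \sum_c Ih a c n w + \sum_a IV a n w)| +
   `|X' n w - (x0 + Ib' n w + \sum_a \sum_c Ih' a c n w + \sum_a IV' a n w)|) <= _).
  have S1 := SL n; have S2 := SVL n; have S3 := hS n; have S4 := hS' n.
  apply: (E_le HE); [by lip|by lip|].
  move=> w; apply: le_trans (ler_normB _ _).
  rewrite le_eqVlt; apply/orP; left; apply/eqP; congr `|_|.
  under eq_bigr do rewrite sumrB.
  by rewrite !sumrB; ring.
have S3 := hS n; have S4 := hS' n.
by apply: le_trans (E_add HE _ _) _; [lip|lip|lra].
Qed.

(** Density in the completion: the members of a Cauchy sequence converge to the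
   element that it represents. *)
Lemma LG_self p (Z : nat -> Om -> R) : (1 <= p <= 2)%N -> LG E p Z ->
  LG_cvg E p (fun m _ => Z m) Z.
Proof.
move=> p12 ZG; have p0 : (0 < p)%N by case/andP: p12.
have dG m : LG E p (fun n w => Z m w - Z n w).
  apply: (LG_sub HE) => //; split=> [n|]; first exact: ZG.1.
  exact: (LG_cauchy_cst HE).
apply/cvgrPdist_le => e e0; have [n0 n0P] := ZG.2 e e0.
near=> m; have mn0 : (n0 <= m)%N by near: m; exact: nbhs_infty_ge.
rewrite sub0r normrN ger0_norm; last exact: (EG_pow_ge0 HE p12 (dG m)).
apply: limr_le; first exact: (E_pow_cvg HE p12 (dG m)).
near=> n; apply/ltW/n0P => //; near: n; exact: nbhs_infty_ge.
Unshelve. all: by end_near. Qed.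

Lemma dt_elem_qv eta (t : R) : is_simple E 1 1 eta ->
  qv_elem E clock eta t (dt_elem eta t).
Proof.
move=> [_ _ _ eL]; exists (fun k n w => sp_coef eta k n w *
  (Num.min t (sp_time eta k.+1) - Num.min t (sp_time eta k))); split=> // k km.
have cG := LG_upto_LG (eL k km).
set x := _ - _; have PE : (fun n w => sp_coef eta k n w * x) = (fun n w => x * sp_coef eta k n w).
  by apply/funext => n; apply/funext => w; rewrite mulrC.
have PG : LG E 1 (fun n w => sp_coef eta k n w * x) by rewrite PE; exact: (LG_scale HE).
split=> //; exact: LG_self PG.
Qed.

Lemma dt_integral_qv_limit Y (t : R) I : dt_integral_of E 1 Y t I -> qv_limit clock Y t I.
Proof.
move=> [eta [M [_ IG cI]]]; exists eta, (fun k => dt_elem (eta k) t); split=> // k.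
by apply: dt_elem_qv; have [] := M.
Qed.

End ItoProcesses.

(** * The solution and the Euler scheme as Ito processes *)

Section EulerScheme.
Context (R : realType) (d N : nat) (G : 'M[R]_d -> R).
Context (E : (C0path R d -> R) -> R) (HE : is_Gexpectation G E).
Context (K : R) (K0 : 0 <= K).
Hypothesis mean0 : forall a (c s t : R), 0 <= s -> 0 <= t ->
  E (fun w => c * (w (t + s) 0 a - w t 0 a)) = 0.
Hypothesis variance : forall a (s t : R), 0 <= s -> 0 <= t ->
  E (fun w => (w (t + s) 0 a - w t 0 a) ^+ 2) <= K * s.
Local Notation Om := (C0path R d).
Local Notation mu := (@lebesgue_measure R).
Context (Q : 'I_d -> 'I_d -> R -> nat -> Om -> R).
Hypothesis Q_LG : forall a c r, 0 <= r -> LG E 2 (Q a c r).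
Hypothesis Q_speed : forall a c (r T : R), 0 <= r <= T -> forall e, 0 < e ->
  \forall n \near \oo,
    E (fun w => Num.max 0 (`|Q a c T n w - Q a c r n w| - K * (T - r)) ^+ 2) <= e.
Context (b : 'I_N -> 'rV[R]_N -> R) (h : 'I_d -> 'I_d -> 'I_N -> 'rV[R]_N -> R)
  (V : 'I_d -> 'I_N -> 'rV[R]_N -> R) (xi : 'rV[R]_N).
Context (L : R) (L0 : 0 <= L).
Definition regular_coef (F : 'rV[R]_N -> R) :=
  (forall x, `|F x| <= L) /\ (forall x y, `|F x - F y| <= L * `|x - y|).
Hypotheses (b_reg : forall i, regular_coef (b i))
  (h_reg : forall a c i, regular_coef (h a c i))
  (V_reg : forall a i, regular_coef (V a i)).
Implicit Types (X : R -> nat -> Om -> 'rV[R]_N) (F : 'rV[R]_N -> R).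

Lemma coord_le (x y : 'rV[R]_N) i : `|x 0 i - y 0 i| <= 1 * `|x - y|.
Proof.
rewrite mul1r (_ : x 0 i - y 0 i = (x - y) 0 i); last by rewrite !mxE.
rewrite [`|x - y|]/Num.Def.normr/= mx_normrE.
exact: (le_bigmax_cond _ _ (erefl true : xpredT (0, i))).
Qed.

Lemma coord_LG p t (x : nat -> Om -> 'rV[R]_N) i : LG_upto E p t x ->
  LG_upto E p t (fun n w => x n w 0 i).
Proof. exact: (LG_upto_lipschitz HE ler01 (fun x y => coord_le x y i)). Qed.

Lemma coef_LG p t F (x : nat -> Om -> 'rV[R]_N) : regular_coef F -> LG_upto E p t x ->
  LG_upto E p t (fun n w => F (x n w)).
Proof. by move=> [_ FL]; exact: (LG_upto_lipschitz HE L0 FL). Qed.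

Lemma solution_LG X t : is_solution E b h V Q xi X -> 0 <= t <= 1 -> LG_upto E 2 t (X t).
Proof. by move=> [[eta [_ XG _ _]] _] /XG. Qed.

Lemma solution_represents X t i : is_solution E b h V Q xi X -> 0 <= t <= 1 ->
  represents E Q (xi 0 i) (fun s n w => b i (X s n w)) (fun a c s n w => h a c i (X s n w))
    (fun a s n w => V a i (X s n w)) t (fun n w => X t n w 0 i).
Proof.
move=> Xsol tT; have XG := solution_LG Xsol tT.
have [_ /(_ t tT i)[Ib [Ih [IV [hb hh hV Xeq]]]]] := Xsol.
split; first by apply: LG_upto_LG; exact: coord_LG XG.
exists Ib, Ih, IV; split.
- exact: (dt_integral_qv_limit HE hb).
- move=> a c; have [eta [M [_ IG [J [JE cJ]]]]] := hh a c.
  by exists eta, J.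
- move=> a; have [eta [M [_ IG cI]]] := hV a.
  by exists eta.
- by move=> e e0; exact: LG_eq_near Xeq e0.
Qed.

Section Euler.
Variables (n : nat) (X : R -> nat -> Om -> 'rV[R]_N).
Hypothesis Xe : is_euler E b h V Q xi n X.

Lemma euler_LG t : 0 <= t <= 1 -> LG_upto E 2 t (X t).
Proof. by case: Xe => XG _ _; exact: XG. Qed.

Lemma grid0 : grid R n 0 = 0. Proof. by rewrite /grid mul0r. Qed.

Lemma grid1 : grid R n (2 ^ n) = 1.
Proof. by rewrite /grid natrX divff// expf_neq0// pnatr_eq0. Qed.

Lemma gridS k : grid R n k.+1 = grid R n k + 2 ^- n.
Proof. by rewrite /grid -natr1 mulrDl mul1r. Qed.

Lemma grid_is_grid m : is_grid (grid R n) m.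
Proof. by move=> k _; rewrite gridS ltrDl invr_gt0 exprn_gt0. Qed.

Lemma grid_bounds k : (k <= 2 ^ n)%N -> 0 <= grid R n k <= 1.
Proof.
move=> kn; rewrite -{1}grid0 -grid1; apply/andP; split.
  by apply: (grid_le (@grid_is_grid (2 ^ n))); rewrite leq0n.
by apply: (grid_le (@grid_is_grid (2 ^ n))); rewrite kn leqnn.
Qed.

Definition frozen F : simple d R :=
  Simple (2 ^ n) (grid R n) (fun j m w => F (X (grid R n j) m w)).

Lemma frozen_simple F : regular_coef F -> is_simple E 2 1 (frozen F).
Proof.
move=> Fr; split=> [|||k kn /=]; [exact: grid0|exact: grid1|exact: grid_is_grid|].
by apply: coef_LG => //; apply: euler_LG; apply: grid_bounds; exact: ltnW.
Qed.

Lemma frozen_simple1 F : regular_coef F -> is_simple E 1 1 (frozen F).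
Proof.
move=> Fr; have [h1 h2 h3 h4] := frozen_simple Fr; split=> // k kn.
exact: (LG_upto21 HE (h4 k kn)).
Qed.

(** What is left of the Euler identity on the cell [j], stopped at [t], when [P]
   stands for the integrals against the cross variation. *)
Definition cell_defect (t : R) i (P : 'I_d -> 'I_d -> nat -> Om -> R) j m (w : Om) : R :=
  (X (Num.min t (grid R n j.+1)) m w 0 i - X (Num.min t (grid R n j)) m w 0 i) -
  (b i (X (grid R n j) m w) * (Num.min t (grid R n j.+1) - Num.min t (grid R n j)) +
   \sum_a \sum_c P a c m w +
   \sum_a V a i (X (grid R n j) m w) *
     (w (Num.min t (grid R n j.+1)) 0 a - w (Num.min t (grid R n j)) 0 a)).

Lemma euler_cell t i j : 0 <= t <= 1 -> (j < 2 ^ n)%N ->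
  exists P : 'I_d -> 'I_d -> nat -> Om -> R,
    (forall a c, LG_mul E (fun m w => h a c i (X (grid R n j) m w))
      (fun m w => Q a c (Num.min t (grid R n j.+1)) m w - Q a c (Num.min t (grid R n j)) m w)
      (P a c)) /\
    forall e, 0 < e -> \forall m \near \oo, E (fun w => `|cell_defect t i P j m w|) <= e.
Proof.
move=> tT jn; have [t0 t1] := andP tT.
have gj : grid R n j < grid R n j.+1 by exact: (@grid_is_grid j.+1).
have [tg|gt] := leP t (grid R n j).
  rewrite (min_l (le_trans tg (ltW gj))); exists (fun _ _ _ _ => 0); split.
    move=> a c; split.
      by split=> [m|]; [exact: Lip_cst|exact: (LG_cauchy_cst HE)].
    rewrite (_ : (fun m => _) = (fun m => fun _ _ => 0)); first exact: (LG_cvg_const HE).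
    apply/funext => m; apply/funext => k; apply/funext => w.
    by rewrite subrr mulr0.
  move=> e e0; near=> m; rewrite (_ : (fun w => _) = fun=> 0) ?(E_cst HE) ?ltW//.
  apply/funext => w; rewrite /cell_defect (min_l tg) (min_l (le_trans tg (ltW gj))).
  rewrite !subrr mulr0 !add0r.
  have -> : \sum_(a < d) \sum_(c < d) (0 : R) = 0 by apply: big1 => a _; exact: big1.
  by rewrite add0r big1 ?oppr0 ?normr0// => a _; rewrite subrr mulr0.
have st : grid R n j <= Num.min t (grid R n j.+1) <= grid R n j.+1.
  by rewrite le_min (ltW gt) (ltW gj) ge_min lexx orbT.
have [_ _ /(_ j.+1)] := Xe; rewrite /= jn => /(_ isT _ st i)[P [PM PE]].
exists P; split=> // e e0.
apply: filterS (LG_eq_near PE e0) => m; apply: le_trans.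
rewrite le_eqVlt; apply/orP; left; apply/eqP; congr E; apply/funext => w.
by rewrite expr1 /cell_defect (min_r (ltW gt)); congr `|_|; ring.
Unshelve. all: by end_near. Qed.

(** The Euler scheme is the Ito process with the frozen coefficients: the identities
   on the cells, stopped at [t], are added up. *)
Lemma euler_represents t i : 0 <= t <= 1 ->
  represents E Q (xi 0 i) (sp_eval (frozen (b i)))
    (fun a c => sp_eval (frozen (h a c i))) (fun a => sp_eval (frozen (V a i))) t
    (fun m w => X t m w 0 i).
Proof.
move=> tT; have [t0 t1] := andP tT.
split; first by apply: LG_upto_LG; exact/coord_LG/euler_LG.
have /choice[P PP] : forall j, exists P : 'I_d -> 'I_d -> nat -> Om -> R,
  (j < 2 ^ n)%N -> (forall a c, LG_mul E (fun m w => h a c i (X (grid R n j) m w))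
      (fun m w => Q a c (Num.min t (grid R n j.+1)) m w - Q a c (Num.min t (grid R n j)) m w)
      (P a c)) /\
    forall e, 0 < e -> \forall m \near \oo, E (fun w => `|cell_defect t i P j m w|) <= e.
  move=> j; have [jn|jn] := ltnP j (2 ^ n); last by exists (fun _ _ _ _ => 0).
  by have [P hP] := euler_cell i tT jn; exists P.
have bs1 := frozen_simple1 (b_reg i).
have dG : LG E 1 (dt_elem (frozen (b i)) t).
  have [Pd [PdM ->]] := dt_elem_qv HE t bs1.
  by apply: (LG_sum HE) => // k _; have [] := PdM k (ltn_ord k).
exists (dt_elem (frozen (b i)) t), (fun a c m w => \sum_(j < 2 ^ n) P j a c m w),
  (fun a => ito_elem a (frozen (V a i)) t); split.
- exists (fun=> frozen (b i)), (fun=> dt_elem (frozen (b i)) t); split=> //.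
  + exact: (Mbar_const HE).
  + by move=> _; exact: (dt_elem_qv HE).
  + exact: (LG_cvg_const HE).
- move=> a c; exists (fun=> frozen (h a c i)), (fun=> fun m w => \sum_(j < 2 ^ n) P j a c m w).
  split.
  + by apply: (Mbar_const HE) => //; exact: frozen_simple1.
  + by apply: (LG_sum HE) => // j _; have [/(_ a c)[]] := PP j (ltn_ord j).
  + move=> _; exists (fun j => P j a c); split=> // j jn.
    by have [/(_ a c)] := PP j jn.
  + exact: (LG_cvg_const HE).
- move=> a; exists (fun=> frozen (V a i)).
  have Vs := frozen_simple (V_reg a i); split; first exact: (Mbar_const HE).
    exact: (ito_elem_LG HE K0 variance a Vs t0).
  exact: (LG_cvg_const HE).
move=> e e0; have e2 : 0 < e / 2 by rewrite divr_gt0.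
have X0near : \forall m \near \oo, E (fun w => `|X 0 m w 0 i - xi 0 i|) <= e / 2.
  have [_ X0 _] := Xe; have e4 : 0 < e / 2 / 2 by rewrite !divr_gt0.
  have e16 : 0 < (e / 2 / 2) ^+ 2 by rewrite exprn_gt0.
  have XG0 : LG_upto E 2 0 (X 0) by apply: euler_LG; rewrite lexx ler01.
  have XL m := LG_upto_Lip m XG0.
  move: X0 => /cvgrPdist_le/(_ _ e16).
  apply: filterS => m; rewrite sub0r normrN => /(le_trans (ler_norm _)) X0m.
  have xL : Lip (fun w => X 0 m w 0 i - xi 0 i).
    by apply: Lip_add; [apply: Lip_mx|]; lip; exact: XL.
  have nL : Lip (fun w => X 0 m w - xi) by apply: Lip_add; [exact: XL|exact: Lip_cst].
  apply: le_trans (E_abs_le_sqr HE e4 xL) _.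
  have : (e / 2 / 2)^-1 * E (fun w => (X 0 m w 0 i - xi 0 i) ^+ 2) <= e / 2 / 2.
    rewrite ler_pdivrMl// -expr2; apply: le_trans X0m.
    apply: (E_le HE); [by lip|by lip|] => w.
    have := coord_le (X 0 m w) xi i; rewrite mul1r => cl.
    by rewrite -(@real_normK _ (_ - _)) ?num_real//; apply: lerXn2r; rewrite ?nnegrE.
  lra.
have cell_near : \forall m \near \oo,
    \sum_(j < 2 ^ n) E (fun w => `|cell_defect t i (P j) j m w|) <= e / 2.
  have H0 (j : 'I_(2 ^ n)) e1 : 0 < e1 -> \forall m \near \oo,
      E (fun w => `|cell_defect t i (P j) j m w|) <= 0 + e1.
    by move=> e10; rewrite add0r; have [_ ] := PP j (ltn_ord j); apply.
  by apply: filterS (near_sum_le H0 e2) => m; rewrite [X in _ <= X + _]big1// add0r.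
apply: filterS2 X0near cell_near => m h1 h2.
have XL s : 0 <= s <= 1 -> Lip (fun w => X s m w 0 i).
  by move=> sT; apply: Lip_mx; exact: LG_upto_Lip (euler_LG sT).
have mT j : (j <= 2 ^ n)%N -> 0 <= Num.min t (grid R n j) <= 1.
  move=> jn; have /andP[g0 g1] := grid_bounds jn.
  by rewrite le_min t0 g0 ge_min t1.
have PL (j : 'I_(2 ^ n)) a c : Lip (P j a c m).
  by have [/(_ a c)[[+ _] _] _] := PP j (ltn_ord j); apply.
have coefL F (j : 'I_(2 ^ n)) : regular_coef F -> Lip (fun w => F (X (grid R n j) m w)).
  move=> Fr; apply: LG_upto_Lip (coef_LG Fr (euler_LG _)).
  by apply: grid_bounds; exact: ltnW.
have DL (j : 'I_(2 ^ n)) : Lip (fun w => cell_defect t i (P j) j m w).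
  have x1 := XL _ (mT _ (ltn_ord j)); have x2 := XL _ (mT _ (ltnW (ltn_ord j))).
  have bL := coefL _ j (b_reg i).
  rewrite /cell_defect.
  apply: Lip_add; [by lip|apply: Lip_opp; apply: Lip_add; [apply: Lip_add|]].
  - by lip.
  - by apply: Lip_sum => a _; apply: Lip_sum => c _; exact: PL.
  - by apply: Lip_sum => a _; have := coefL _ j (V_reg a i) => ?; lip.
have x0L := XL 0 (ltac:(by rewrite lexx ler01)).
apply: le_trans (_ : E (fun w => `|X 0 m w 0 i - xi 0 i|) +
  E (fun w => `|\sum_(j < 2 ^ n) cell_defect t i (P j) j m w|) <= _); last first.
  by have := E_abs_sum HE DL; move: h1 h2; lra.
have SDL : Lip (fun w => \sum_(j < 2 ^ n) cell_defect t i (P j) j m w).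
  by apply: Lip_sum => j _; exact: DL.
apply: le_trans (E_add HE _ _); [|by lip|by lip].
apply: (E_le HE).
- apply: Lip_norm; apply: Lip_add; first by apply: XL; exact: tT.
  apply: Lip_opp; apply: Lip_add; [apply: Lip_add; [apply: Lip_add; [lip|exact: dG.1]|]|].
    by apply: Lip_sum => a _; apply: Lip_sum => c _; apply: Lip_sum => j _; exact: PL.
  apply: Lip_sum => a _; exact: (ito_elem_LG HE K0 variance a (frozen_simple (V_reg a i)) t0).1.
- by lip.
move=> w; apply: le_trans (ler_normD _ _).
rewrite le_eqVlt; apply/orP; left; apply/eqP; congr `|_|.
rewrite /cell_defect sumrB -(big_mkord xpredT (fun j => X (Num.min t (grid R n j.+1)) m w 0 i -
  X (Num.min t (grid R n j)) m w 0 i)) telescope_sumr//.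
rewrite grid0 grid1 (min_l t1) (min_r t0) !big_split /=.
have -> : \sum_a \sum_c \sum_(j < 2 ^ n) P j a c m w = \sum_(j < 2 ^ n) \sum_a \sum_c P j a c m w.
  rewrite [RHS]exchange_big; apply: eq_bigr => a _ /=.
  by rewrite [RHS]exchange_big.
have -> : \sum_a ito_elem a (frozen (V a i)) t m w = \sum_(j < 2 ^ n) \sum_a
   V a i (X (grid R n j) m w) *
     (w (Num.min t (grid R n j.+1)) 0 a - w (Num.min t (grid R n j)) 0 a).
  by rewrite exchange_big.
rewrite -[dt_elem _ _ _ _]/(\sum_(j < 2 ^ n) b i (X (grid R n j) m w) *
  (Num.min t (grid R n j.+1) - Num.min t (grid R n j))).
by ring.
Qed.

End Euler.
End EulerScheme.

(** * The error of the Euler scheme *)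

Section ErrorEstimate.
Context (R : realType) (d N : nat) (G : 'M[R]_d -> R).
Context (E : (C0path R d -> R) -> R) (HE : is_Gexpectation G E).
Context (K : R) (K0 : 0 <= K).
Hypothesis mean0 : forall a (c s t : R), 0 <= s -> 0 <= t ->
  E (fun w => c * (w (t + s) 0 a - w t 0 a)) = 0.
Hypothesis variance : forall a (s t : R), 0 <= s -> 0 <= t ->
  E (fun w => (w (t + s) 0 a - w t 0 a) ^+ 2) <= K * s.
Local Notation Om := (C0path R d).
Context (Q : 'I_d -> 'I_d -> R -> nat -> Om -> R).
Hypothesis Q_LG : forall a c r, 0 <= r -> LG E 2 (Q a c r).
Hypothesis Q_speed : forall a c (r T : R), 0 <= r <= T -> forall e, 0 < e ->
  \forall n \near \oo,
    E (fun w => Num.max 0 (`|Q a c T n w - Q a c r n w| - K * (T - r)) ^+ 2) <= e.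
Context (b : 'I_N -> 'rV[R]_N -> R) (h : 'I_d -> 'I_d -> 'I_N -> 'rV[R]_N -> R)
  (V : 'I_d -> 'I_N -> 'rV[R]_N -> R) (xi : 'rV[R]_N).
Context (L : R) (L0 : 0 <= L).
Hypotheses (b_reg : forall i, regular_coef L (b i))
  (h_reg : forall a c i, regular_coef L (h a c i))
  (V_reg : forall a i, regular_coef L (V a i)).
Implicit Types (F : 'rV[R]_N -> R).

Lemma step_fun_ge0 (u : nat -> R) n (x : nat -> R) (r : R) :
  (forall k, (k < n)%N -> 0 <= x k) -> 0 <= step_fun u n x r.
Proof. by move=> x0; apply: sumr_ge0 => k _; rewrite mulr_ge0 ?x0. Qed.

Lemma mx_norm_sqr_le (v : 'rV[R]_N) : `|v| ^+ 2 <= \sum_i v 0 i ^+ 2.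
Proof.
have S0 : 0 <= \sum_i v 0 i ^+ 2 by apply: sumr_ge0 => i _; exact: sqr_ge0.
rewrite -(sqr_sqrtr S0); apply: lerXn2r; rewrite ?nnegrE ?sqrtr_ge0//.
rewrite [leLHS]/Num.Def.normr/= mx_normrE; apply: bigmax_le; first exact: sqrtr_ge0.
move=> [i j] _; rewrite ord1 /= -[leLHS]ger0_norm// -sqrtr_sqr ler_wsqrtr//.
by rewrite (bigD1 j) //= real_normK ?num_real// lerDl; apply: sumr_ge0 => k _; exact: sqr_ge0.
Qed.

Section Solution.
Variable X : R -> nat -> Om -> 'rV[R]_N.
Hypothesis Xsol : is_solution E b h V Q xi X.

Let XG t (tT : 0 <= t <= 1) : LG_upto E 2 t (X t) := solution_LG Xsol tT.

(** The solution at time [t0] is the Ito process whose coefficients are stopped at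
   [t0], so that stability applies to one process at two times. *)
Lemma solution_continuity t0 t i : 0 <= t0 <= t -> t <= 1 -> forall e, 0 < e ->
  \forall n \near \oo, E (fun w => (X t n w 0 i - X t0 n w 0 i) ^+ 2) <=
    stability_const d K * (L ^+ 2 * (t - t0)) + e.
Proof.
move=> /andP[t00 tt] t1; have tT : 0 <= t <= 1 by rewrite (le_trans t00 tt).
have tT0 : 0 <= t0 <= 1 by rewrite t00 (le_trans tt).
pose u (k : nat) : R := if k is 0 then t0 else t.
have uS k : (k <= 1)%N -> 0 <= u k <= 1 by case: k.
have u_nd k : (k < 1)%N -> u k <= u k.+1 by case: k.
have g0 k : (k < 1)%N -> 0 <= (fun _ : nat => L ^+ 2) k by move=> _; exact: sqr_ge0.
have close F : regular_coef L F -> forall r, 0 <= r < 1 -> forall e, 0 < e ->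
    \forall n \near \oo, E (fun w => (stop (fun s n w => F (X s n w)) t r n w -
      stop (fun s n w => F (X s n w)) t0 r n w) ^+ 2) <= step_fun u 1 (fun=> L ^+ 2) r + e.
  move=> Fr r /andP[r0 r1] e e0; near=> n.
  have st0 : 0 <= step_fun u 1 (fun=> L ^+ 2) r by apply: step_fun_ge0.
  have zero (Z : Om -> R) : (forall w, Z w = 0) -> E Z <= step_fun u 1 (fun=> L ^+ 2) r + e.
    move=> Z0; rewrite (_ : Z = fun=> 0); last exact/funext.
    by rewrite (E_cst HE) addr_ge0// ltW.
  have [rt0|t0r] := ltP r t0.
    apply: zero => w; rewrite /stop rt0 (lt_le_trans rt0 tt) subrr.
    by rewrite expr0n.
  have [rt|tr] := ltP r t; last first.
    by apply: zero => w; rewrite /stop !ltNge tr t0r /= !mul0r subrr expr0n.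
  have FL : Lip (fun w => F (X r n w)).
    apply: LG_upto_Lip (coef_LG HE L0 Fr (XG _)).
    by rewrite r0 ltW.
  have -> : step_fun u 1 (fun=> L ^+ 2) r = L ^+ 2.
    by rewrite /step_fun big_ord1 /= t0r rt mul1r.
  apply: le_trans (_ : E (fun=> L ^+ 2) <= _); last first.
    by rewrite (E_cst HE) lerDl ltW.
  rewrite /stop rt ltNge t0r /=; apply: (E_le HE); [by lip|by lip|].
  move=> w; rewrite mul1r mul0r subr0 -(@real_normK _ (F _)) ?num_real//.
  by apply: lerXn2r; rewrite ?nnegrE//; exact: (Fr.1).
have := represents_compare HE K0 mean0 variance Q_LG Q_speed
  (solution_represents HE i Xsol tT) (solution_represents HE i Xsol tT0) tT tT0 uS u_nd g0
  (close _ (b_reg i)) (fun a c => close _ (h_reg a c i)) (fun a => close _ (V_reg a i)).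
by rewrite big_ord1.
Unshelve. all: by end_near. Qed.

Section Euler.
Variables (n : nat) (Xn : R -> nat -> Om -> 'rV[R]_N).
Hypothesis Xe : is_euler E b h V Q xi n Xn.

Let XnG t (tT : 0 <= t <= 1) : LG_upto E 2 t (Xn t) := euler_LG Xe tT.

Lemma sqdist_cvg t : 0 <= t <= 1 ->
  cvgn (fun m => E (fun w => \sum_i (Xn t m w 0 i - X t m w 0 i) ^+ 2)).
Proof.
move=> tT; apply: (E_sum_sqr_cvg HE (Z := fun i m w => Xn t m w 0 i - X t m w 0 i)) => i.
by apply: (LG_sub HE); apply: LG_upto_LG; apply: (coord_LG HE); [exact: XnG|exact: XG].
Qed.

Lemma sqdist_Lip t m : 0 <= t <= 1 ->
  Lip (fun w => \sum_i (Xn t m w 0 i - X t m w 0 i) ^+ 2).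
Proof.
move=> tT; apply: Lip_sum => i _; apply: Lip_exp; apply: Lip_add; last apply: Lip_opp.
  by apply: Lip_mx; exact: LG_upto_Lip (XnG tT).
by apply: Lip_mx; exact: LG_upto_Lip (XG tT).
Qed.

Lemma sqdist_ge0 t : 0 <= t <= 1 -> 0 <= sqdist E (Xn t) (X t).
Proof.
move=> tT; apply: limr_ge; first exact: sqdist_cvg.
near=> m; apply: (E_ge0 HE); first exact: sqdist_Lip.
by move=> w; apply: sumr_ge0 => i _; exact: sqr_ge0.
Unshelve. all: by end_near. Qed.

Let q := N%:R * stability_const d K * L ^+ 2.
(** Both constants of the one-step inequality: [2 q^2] multiplies the mesh through
   the oscillation of the solution, [2 q] the earlier errors. *)
Definition rate_const : R := 2 * q * (1 + q).
Let D : R := 2 ^- n.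

Lemma q_ge0 : 0 <= q.
Proof.
apply: mulr_ge0 (sqr_ge0 _); apply: mulr_ge0; first exact: ler0n.
exact: stability_const_ge0.
Qed.

Lemma rate_const_ge0 : 0 <= rate_const.
Proof.
have q0 := q_ge0; apply: mulr_ge0; first exact: mulr_ge0.
exact: addr_ge0.
Qed.

(** The frozen coefficient differs from the running one by the error at the left
   end of the cell, plus the oscillation of the solution within the cell. *)
Lemma frozen_close F t k r : regular_coef L F -> (k <= 2 ^ n)%N -> t <= grid R n k ->
  0 <= r < 1 -> forall e, 0 < e -> \forall m \near \oo,
    E (fun w => (stop (sp_eval (frozen n Xn F)) t r m w -
                 stop (fun s m w => F (X s m w)) t r m w) ^+ 2) <=
    step_fun (grid R n) k
      (fun j => 2 * L ^+ 2 * (q * D + sqdist E (Xn (grid R n j)) (X (grid R n j)))) r + e.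
Proof.
move=> Fr kn tk /andP[r0 r1] e e0; have q0 := q_ge0.
have D0 : 0 < D by rewrite invr_gt0 exprn_gt0.
have L2 : 0 <= L ^+ 2 by exact: sqr_ge0.
have [rt|tr] := ltP r t; last first.
  near=> m; rewrite (_ : (fun w => _) = fun=> 0).
    rewrite (E_cst HE) addr_ge0 ?(ltW e0)//; apply: step_fun_ge0 => j jk.
    apply: mulr_ge0; first exact: mulr_ge0.
    apply: addr_ge0; first by apply: mulr_ge0 q0 (ltW D0).
    by apply/sqdist_ge0/grid_bounds; exact: leq_trans (ltnW jk) kn.
  by apply/funext => w; rewrite /stop ltNge tr /= !mul0r subrr expr0n.
have [j jk jr] : exists2 j, (j < k)%N & grid R n j <= r < grid R n j.+1.
  apply: grid_locate; first exact: grid_is_grid.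
  by rewrite grid0 r0 (lt_le_trans rt tk).
have jn : (j < 2 ^ n)%N by exact: leq_trans jk kn.
rewrite (step_fun_at _ (@grid_is_grid _ n k) jk jr).
set g := grid R n j; have /andP[g0 g1] : 0 <= g <= 1 by apply: grid_bounds; exact: ltnW.
have gT : 0 <= g <= 1 by rewrite g0.
have rT : 0 <= r <= 1 by rewrite r0 ltW.
have /andP[gr rg] := jr.
have grT : 0 <= g <= r by rewrite g0.
have rgD : r - g <= D by move: rg; rewrite gridS -/g -/D; lra.
set a := sqdist _ _ _.
pose e1 := e / (4 * L ^+ 2 + 1).
have L21 : 0 < 4 * L ^+ 2 + 1 by rewrite ltr_wpDl// mulr_ge0.
have e10 : 0 < e1 by rewrite divr_gt0.
have near1 := lim_le_eventually (sqdist_cvg gT) (lexx a) e10.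
have near2 := near_sum_le (fun i e2 (e20 : 0 < e2) => solution_continuity i grT (ltW r1) e20) e10.
apply: filterS2 near1 near2 => m h1 h2.
have FnL : Lip (fun w => F (Xn g m w)) by exact: LG_upto_Lip (coef_LG HE L0 Fr (XnG gT)).
have FL : Lip (fun w => F (X r m w)) by exact: LG_upto_Lip (coef_LG HE L0 Fr (XG rT)).
have xL (s : R) i : 0 <= s <= 1 -> Lip (fun w => X s m w 0 i).
  by move=> sT; apply: Lip_mx; exact: LG_upto_Lip (XG sT).
have oL i : true -> Lip (fun w => (X r m w 0 i - X g m w 0 i) ^+ 2).
  by move=> _; have := xL r i rT; have := xL g i gT => ? ?; lip.
have sdL := sqdist_Lip m gT.
have soL : Lip (fun w => \sum_i (X r m w 0 i - X g m w 0 i) ^+ 2).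
  by apply: Lip_sum => i _; exact: oL.
have h3 : E (fun w => \sum_i (X r m w 0 i - X g m w 0 i) ^+ 2) <= q * D + e1.
  apply: le_trans (@E_sum _ _ _ _ HE _ (index_enum _) xpredT _ oL) _.
  apply: le_trans h2 _; rewrite lerD2r sumr_const card_ord -[X in X <= _]mulr_natl.
  have -> : q * D = N%:R * (stability_const d K * (L ^+ 2 * D)) by rewrite /q; ring.
  apply: ler_wpM2l; first exact: ler0n.
  apply: ler_wpM2l; first exact: stability_const_ge0.
  exact: ler_wpM2l.
apply: le_trans (_ : 2 * L ^+ 2 * E (fun w => \sum_i (Xn g m w 0 i - X g m w 0 i) ^+ 2) +
  2 * L ^+ 2 * E (fun w => \sum_i (X r m w 0 i - X g m w 0 i) ^+ 2) <= _).
  rewrite /stop rt; apply: (E_dom2 HE) => //; rewrite ?mulr_ge0//.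
    rewrite (_ : (fun w => _) = (fun w => (F (Xn g m w) - F (X r m w)) ^+ 2)); first by lip.
    apply/funext => w; rewrite !mul1r; congr ((_ - _) ^+ 2).
    rewrite -[LHS]/(step_fun (grid R n) (2 ^ n) (fun k => F (Xn (grid R n k) m w)) r).
    by rewrite (step_fun_at _ (@grid_is_grid _ n _) jn jr).
  move=> w; rewrite !mul1r.
  have -> : sp_eval (frozen n Xn F) r m w = F (Xn g m w).
    rewrite -[LHS]/(step_fun (grid R n) (2 ^ n) (fun k => F (Xn (grid R n k) m w)) r).
    by rewrite (step_fun_at _ (@grid_is_grid _ n _) jn jr).
  set x := Xn g m w; set y := X r m w; set z := X g m w.
  apply: le_trans (_ : L ^+ 2 * \sum_i (x 0 i - y 0 i) ^+ 2 <= _).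
    rewrite -(@real_normK _ (_ - _)) ?num_real//.
    apply: le_trans (_ : (L * `|x - y|) ^+ 2 <= _).
      by apply: lerXn2r; rewrite ?nnegrE ?mulr_ge0//; exact: Fr.2.
    rewrite exprMn ler_wpM2l//; apply: le_trans (mx_norm_sqr_le _) _.
    by apply: ler_sum => i _; rewrite !mxE.
  set S1 := \sum_i (x 0 i - z 0 i) ^+ 2; set S2 := \sum_i (y 0 i - z 0 i) ^+ 2.
  have -> : 2 * L ^+ 2 * S1 + 2 * L ^+ 2 * S2 = L ^+ 2 * (2 * S1 + 2 * S2) by ring.
  apply: ler_wpM2l => //; rewrite /S1 /S2 !mulr_sumr -big_split /=.
  apply: ler_sum => i _; rewrite -subr_ge0.
  rewrite (_ : _ - _ = ((x 0 i - z 0 i) + (y 0 i - z 0 i)) ^+ 2) ?sqr_ge0//; ring.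
have LL : 0 <= 2 * L ^+ 2 by rewrite mulr_ge0.
apply: le_trans (lerD (ler_wpM2l LL h1) (ler_wpM2l LL h3)) _.
have eE : e = 4 * L ^+ 2 * e1 + e1.
  by rewrite /e1; field; rewrite gt_eqF.
rewrite [in leRHS]eE -subr_ge0.
rewrite (_ : _ - _ = e1); first exact: ltW.
ring.
Unshelve. all: by end_near. Qed.

(** Stability with the bound of [frozen_close], integrated over the cells before
   [t]. *)
Lemma euler_error_step t k : 0 <= t <= 1 -> (k <= 2 ^ n)%N -> t <= grid R n k ->
  sqdist E (Xn t) (X t) <= rate_const * D +
    rate_const * D * \sum_(j < k) sqdist E (Xn (grid R n j)) (X (grid R n j)).
Proof.
move=> tT kn tk; have q0 := q_ge0.
have D0 : 0 < D by rewrite invr_gt0 exprn_gt0.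
have L2 : 0 <= L ^+ 2 by exact: sqr_ge0.
pose a j := sqdist E (Xn (grid R n j)) (X (grid R n j)).
have a0 j : (j < k)%N -> 0 <= a j.
  by move=> jk; apply: sqdist_ge0; apply: grid_bounds; exact: leq_trans (ltnW jk) kn.
pose gv j := 2 * L ^+ 2 * (q * D + a j).
have gv0 j : (j < k)%N -> 0 <= gv j.
  by move=> jk; rewrite !mulr_ge0// addr_ge0 ?a0// mulr_ge0// ltW.
have uS j : (j <= k)%N -> 0 <= grid R n j <= 1.
  by move=> jk; apply: grid_bounds; exact: leq_trans jk kn.
have u_nd j : (j < k)%N -> grid R n j <= grid R n j.+1.
  by move=> jk; apply/ltW/(@grid_is_grid _ n k).
have close F (Fr : regular_coef L F) r (rT : 0 <= r < 1) := frozen_close Fr kn tk rT.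
have coord_near i := represents_compare HE K0 mean0 variance Q_LG Q_speed
  (euler_represents HE K0 variance L0 b_reg h_reg V_reg Xe i tT)
  (solution_represents HE i Xsol tT) tT tT uS u_nd gv0
  (close _ (b_reg i)) (fun a c => close _ (h_reg a c i)) (fun a => close _ (V_reg a i)).
set gint := \sum_(j < k) _ in coord_near.
have -> : sqdist E (Xn t) (X t) =
  limn (fun m => E (fun w => \sum_i (Xn t m w 0 i - X t m w 0 i) ^+ 2)) by [].
apply: le_trans (_ : N%:R * (stability_const d K * gint) <= _).
  apply: eventually_lim_le => [|e e0]; first exact: sqdist_cvg.
  have := near_sum_le coord_near e0; apply: filterS => m.
  rewrite sumr_const card_ord -[X in _ <= X + _]mulr_natl; apply: le_trans.
  have sL i : true -> Lip (fun w => (Xn t m w 0 i - X t m w 0 i) ^+ 2).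
    move=> _; apply: Lip_exp; apply: Lip_add; last apply: Lip_opp.
      by apply: Lip_mx; exact: LG_upto_Lip (XnG tT).
    by apply: Lip_mx; exact: LG_upto_Lip (XG tT).
  exact: (@E_sum _ _ _ _ HE _ (index_enum _) xpredT _ sL).
have gintE : gint = 2 * L ^+ 2 * (q * D * (k%:R * D) + D * \sum_(j < k) a j).
  rewrite /gint (eq_bigr (fun j : 'I_k => 2 * L ^+ 2 * (q * D * D + D * a j))); last first.
    move=> j _; have -> : grid R n j.+1 - grid R n j = D.
      by rewrite gridS addrAC subrr add0r.
    by rewrite /gv; ring.
  rewrite -mulr_sumr big_split /= sumr_const card_ord -mulr_sumr.
  by rewrite -[_ *+ k]mulr_natl; congr (_ * (_ + _)); ring.
have kD : k%:R * D <= 1.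
  by rewrite /D -[k%:R * _]/(grid R n k); have /andP[] := uS k (leqnn k).
have S0 : 0 <= \sum_(j < k) a j by apply: sumr_ge0 => j _; exact: a0.
have -> : N%:R * (stability_const d K * gint) =
    2 * q * (q * D * (k%:R * D)) + 2 * q * (D * \sum_(j < k) a j).
  by rewrite gintE /q; ring.
rewrite -/(a _) /rate_const -[\sum_(j < k) sqdist _ _ _]/(\sum_(j < k) a j).
set s := \sum_(j < k) _ in S0 *.
have h1 : q * D * (k%:R * D) <= q * D * 1 by exact: ler_wpM2l (mulr_ge0 q0 (ltW D0)) _ _ kD.
have h2 : 2 * q * (q * D * (k%:R * D)) <= 2 * q * (q * D * 1).
  by apply: ler_wpM2l h1; exact: mulr_ge0.
have h3 : 0 <= q * (D * s) := mulr_ge0 q0 (mulr_ge0 (ltW D0) S0).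
have h4 : 0 <= q * (q * (D * s)) := mulr_ge0 q0 h3.
have h5 : 0 <= q * D := mulr_ge0 q0 (ltW D0).
have -> : 2 * q * (1 + q) * D + 2 * q * (1 + q) * D * s = 2 * (q * D) + 2 * q * (q * D * 1) +
  2 * q * (D * s) + 2 * (q * (q * (D * s))) by ring.
lra.
Qed.

Lemma discrete_gronwall (a : nat -> R) (c : R) m : 0 <= c ->
  (forall k, (k <= m)%N -> a k <= c + c * \sum_(j < k) a j) ->
  forall k, (k <= m)%N -> c + c * \sum_(j < k) a j <= c * (1 + c) ^+ k.
Proof.
move=> c0 ac; elim=> [|k IH] km; first by rewrite big_ord0 mulr0 addr0 expr0 mulr1.
have IHk := IH (ltnW km); rewrite big_ord_recr /= exprSr mulrDr addrA mulrA.
have h1 := ac k (ltnW km).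
have h2 : c * a k <= c * (c + c * \sum_(j < k) a j) by rewrite ler_wpM2l.
have h3 : (c + c * \sum_(j < k) a j) * (1 + c) <= c * (1 + c) ^+ k * (1 + c).
  by rewrite ler_wpM2r// addr_ge0.
lra.
Qed.

(** There are [2^n] steps of size [2^-n], and [(1 + c 2^-n)^(2^n) <= exp c]. *)
Lemma euler_error t : 0 <= t <= 1 ->
  sqdist E (Xn t) (X t) <= rate_const * expR rate_const * D.
Proof.
move=> tT; have r0 := rate_const_ge0; have D0 : 0 < D by rewrite invr_gt0 exprn_gt0.
have c0 : 0 <= rate_const * D by rewrite mulr_ge0// ltW.
have t1 : t <= grid R n (2 ^ n) by rewrite grid1; case/andP: tT.
apply: le_trans (euler_error_step tT (leqnn _) t1) _.
have step k : (k <= 2 ^ n)%N -> sqdist E (Xn (grid R n k)) (X (grid R n k)) <=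
    rate_const * D + rate_const * D *
      \sum_(j < k) sqdist E (Xn (grid R n j)) (X (grid R n j)).
  by move=> kn; apply: euler_error_step => //; exact: grid_bounds.
apply: le_trans (discrete_gronwall
  (a := fun j => sqdist E (Xn (grid R n j)) (X (grid R n j))) c0 step (leqnn _)) _.
rewrite [rate_const * expR _ * D]mulrAC; apply: ler_wpM2l => //.
apply: le_trans (_ : expR (rate_const * D) ^+ (2 ^ n) <= _).
  by apply: lerXn2r; rewrite ?nnegrE ?expR_ge0 ?addr_ge0// expR_ge1Dx.
by rewrite -expRM_natr natrX /D -mulrA mulVf ?mulr1// expf_neq0.
Qed.

End Euler.
End Solution.
End ErrorEstimate.

(** * The rate of convergence *)

Lemma regular_coef_near (R : realType) N (F : 'rV[R]_N -> R) :
  bounded_fun F -> lipschitz F -> \forall L \near +oo, regular_coef L F.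
Proof.
move=> Fb Fl; near=> L.
have h1 : \forall x \near globally setT, `|F x| <= L by near: L; exact: Fb.
have h2 : \forall x \near globally (setT `*` setT), `|F x.1 - F x.2| <= L * `|x.1 - x.2|.
  by near: L; exact: Fl.
by split=> [x|x y]; [exact: h1|exact: (h2 (x, y))].
Unshelve. all: by end_near. Qed.

(** A bound and a Lipschitz constant may be enlarged, so that one constant serves
   all the coefficients. *)
Lemma common_regularity (R : realType) (d N : nat) (b : 'I_N -> 'rV[R]_N -> R)
    (h : 'I_d -> 'I_d -> 'I_N -> 'rV[R]_N -> R) (V : 'I_d -> 'I_N -> 'rV[R]_N -> R) :
  (forall i, \forall L \near +oo, regular_coef L (b i)) ->
  (forall a c i, \forall L \near +oo, regular_coef L (h a c i)) ->
  (forall a i, \forall L \near +oo, regular_coef L (V a i)) ->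
  exists L, [/\ 0 <= L, forall i, regular_coef L (b i),
    forall a c i, regular_coef L (h a c i) & forall a i, regular_coef L (V a i)].
Proof.
move=> nb nh nV.
have nb' : \forall L \near +oo, forall i, regular_coef L (b i) by exact: filter_forall.
have nh' : \forall L \near +oo, forall a c i, regular_coef L (h a c i).
  apply: (@filter_forall _ _ (fun a L => forall c i, regular_coef L (h a c i))) => a.
  apply: (@filter_forall _ _ (fun c L => forall i, regular_coef L (h a c i))) => c.
  exact: filter_forall.
have nV' : \forall L \near +oo, forall a i, regular_coef L (V a i).
  apply: (@filter_forall _ _ (fun a L => forall i, regular_coef L (V a i))) => a.
  exact: filter_forall.
suff : \forall L \near +oo, [/\ 0 <= L, forall i, regular_coef L (b i),
    forall a c i, regular_coef L (h a c i) & forall a i, regular_coef L (V a i)].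
  exact: filter_ex.
near=> L; split; near: L => //; exact: nbhs_pinfty_ge.
Unshelve. all: by end_near. Qed.

Theorem theorem3p2 (R : realType) (d N : nat) (hd : (0 < d)%N) (hN : (0 < N)%N)
  (Sigma : set 'M[R]_d)
  (Sigma_psd : Sigma `<=` @psd R d) (Sigma_ne : Sigma !=set0)
  (Sigma_bounded : bounded_set Sigma) (Sigma_closed : closed Sigma)
  (Sigma_convex : convex_set Sigma)
  (b : 'I_N -> 'rV[R]_N -> R)
  (h : 'I_d -> 'I_d -> 'I_N -> 'rV[R]_N -> R)
  (V : 'I_d -> 'I_N -> 'rV[R]_N -> R)
  (b_bounded : forall i, bounded_fun (b i))
  (b_lipschitz : forall i, lipschitz (b i))
  (h_bounded : forall a c i, bounded_fun (h a c i))
  (h_lipschitz : forall a c i, lipschitz (h a c i))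
  (V_bounded : forall a i, bounded_fun (V a i))
  (V_lipschitz : forall a i, lipschitz (V a i)) :
  exists C : R, 0 < C /\
  forall (E : (C0path R d -> R) -> R), is_Gexpectation (Gfun Sigma) E ->
  forall (Q : 'I_d -> 'I_d -> R -> rv R d R), is_cross_variation E Q ->
  forall (xi : 'rV[R]_N) (X : R -> rv R d 'rV[R]_N), is_solution E b h V Q xi X ->
  forall (Xn : nat -> R -> rv R d 'rV[R]_N),
  (forall n, (1 <= n)%N -> is_euler E b h V Q xi n (Xn n)) ->
  (forall n, (1 <= n)%N -> (sup_sqdist E (Xn n) X <= (C * 2 ^- n)%:E)%E) /\
  (fun n => sup_sqdist E (Xn n) X) @ \oo --> 0%E.
Proof.
have [L [L0 b_reg h_reg V_reg]] := common_regularity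
  (fun i => regular_coef_near (b_bounded i) (b_lipschitz i))
  (fun a c i => regular_coef_near (h_bounded a c i) (h_lipschitz a c i))
  (fun a i => regular_coef_near (V_bounded a i) (V_lipschitz a i)).
have v0 a : 0 <= max_var Sigma a by exact: max_var_ge0.
pose K : R := \sum_a max_var Sigma a.
have K0 : 0 <= K by apply: sumr_ge0 => a _.
have vK a : max_var Sigma a <= K.
  by rewrite /K (bigD1 a) //= lerDl; apply: sumr_ge0 => c _.
pose c0 : R := rate_const d N K L.
have c00 : 0 <= c0 by exact: rate_const_ge0.
exists (c0 * expR c0 + 1); split; first by rewrite ltr_wpDl// mulr_ge0// expR_ge0.
move=> E HE Q QV xi X Xsol Xn Xe.
have mean0 := increment_mean0 Sigma_psd Sigma_ne Sigma_bounded HE.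
have variance a (s t : R) : 0 <= s -> 0 <= t ->
    E (fun w => (w (t + s) 0 a - w t 0 a) ^+ 2) <= K * s.
  move=> s0 t0; rewrite (increment_variance Sigma_psd Sigma_ne Sigma_bounded HE)//.
  exact: ler_wpM2r.
have fourth a (s t : R) : 0 <= s -> 0 <= t ->
    E (fun w => (w (t + s) 0 a - w t 0 a) ^+ 4) <= 3 * (K * s) ^+ 2.
  move=> s0 t0; rewrite (increment_fourth Sigma_psd Sigma_ne Sigma_bounded HE)//.
  apply: ler_wpM2l => //; apply: lerXn2r; rewrite ?nnegrE ?mulr_ge0//.
  exact: ler_wpM2r.
have Q_LG a c (r : R) : 0 <= r -> LG E 2 (Q a c r) by move=> r0; have [] := QV a c r r0.
have Q_speed a c (r T : R) (rT : 0 <= r <= T) e (e0 : 0 < e) :=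
  cross_variation_speed HE K0 mean0 variance fourth QV a c rT e0.
have bound n : (1 <= n)%N ->
    (sup_sqdist E (Xn n) X <= ((c0 * expR c0 + 1) * 2 ^- n)%:E)%E.
  move=> n1; apply: ge_ereal_sup => _ [t tT <-]; rewrite lee_fin.
  have D0 : 0 <= 2 ^- n :> R by rewrite invr_ge0 exprn_ge0.
  apply: le_trans (euler_error HE K0 mean0 variance Q_LG Q_speed L0 b_reg h_reg V_reg
    Xsol (Xe n n1) tT) _.
  by rewrite ler_wpM2r// lerDl.
split=> //; apply: (@squeeze_cvge _ _ _ _ (fun=> 0%E) _
  (fun n => ((c0 * expR c0 + 1) * 2 ^- n)%:E)).
- near=> n; have n1 : (1 <= n)%N by near: n; exact: nbhs_infty_ge.
  rewrite bound// andbT; have t0 : 0 <= (0 : R) <= 1 by rewrite lexx ler01.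
  apply: le_trans (_ : (sqdist E (Xn n 0) (X 0))%:E <= _)%E.
    rewrite lee_fin; exact: (sqdist_ge0 HE Xsol (Xe n n1) t0).
  by apply: ereal_sup_ubound; exists 0.
- exact: cvg_cst.
- apply: cvg_EFin; first exact: nearW.
  rewrite -[X in _ --> X](mulr0 (c0 * expR c0 + 1)).
  apply: cvgMl_tmp; rewrite (_ : (fun n => _) = (fun n => 2^-1 ^+ n)).
    by apply: cvg_expr; rewrite ger0_norm// invf_lt1// ltr1n.
  by apply/funext => n; rewrite exprVn.
Unshelve. all: by end_near. Qed.
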